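(* For every integer $n\ge1$, let $TSSC(2n)$ be the number of lozenge tilings of the regular hexagon $H(2n,2n,2n)$ that are invariant under the rotation by $120^\circ$ around its center, the rotation by $180^\circ$ around its center, and the reflection in a diagonal joining two opposite vertices (equivalently, under all symmetries of the hexagon). Then $$TSSC(2n)=\prod_{i=0}^{n-1}\frac{(3i+1)!}{(n+i)!}.$$
   Context: Work in the regular triangular lattice with unit side. $H(a,b,c)$ is the lattice hexagon with all angles $120^\circ$ and side lengths $a,b,c,a,b,c$ in cyclic order. A lozenge is a unit rhombus that is the union of two unit triangles of the lattice sharing an edge; a lozenge tiling of the hexagon is a covering of it by lozenges contained in it, without gaps or overlaps. (Such fully symmetric tilings correspond to totally symmetric self-complementary plane partitions contained in a $2n\times2n\times2n$ box.) *)

(* Defs.v *)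
From mathcomp Require Import all_boot all_order all_algebra finmap.

Set Implicit Arguments.
Unset Strict Implicit.
Unset Printing Implicit Defensive.

Import Order.TTheory GRing.Theory Num.Theory.
Local Open Scope fset_scope.
Local Open Scope ring_scope.

(* The pair (x, y) stands for the lattice point x e1 + y e2, where e1 and e2  *)
(* are unit vectors of the plane at an angle of 60 degrees (e2 is e1 rotated  *)
(* counterclockwise).                                                         *)
Definition point : Type := (int * int)%type.

(* |x e1 + y e2|^2 = x^2 + x y + y^2 since e1 . e2 = 1/2.                     *)
Definition sqdist (p q : point) : int :=
  let v := p - q in v.1 ^+ 2 + v.1 * v.2 + v.2 ^+ 2.

(* A unit triangle is given by its three vertices.                            *)
Definition triangle : Type := {fset point}.

Definition is_unit_triangle (t : triangle) : bool :=
  (#|` t| == 3)%N &&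
  [forall p : t, forall q : t, (p != q) ==> (sqdist (val p) (val q) == 1)].

(* A lozenge is given by the two unit triangles of which it is the union;     *)
(* they share an edge when they have exactly two vertices in common.          *)
Definition lozenge : Type := {fset triangle}.

Definition is_lozenge (l : lozenge) : bool :=
  [&& (#|` l| == 2)%N,
      [forall t : l, is_unit_triangle (val t)] &
      [forall t : l, forall u : l,
         (t != u) ==> (#|` val t `&` val u| == 2)%N]].

(* The lattice points of H(a,b,c), placed so that its corners are, in         *)
(* counterclockwise order, (0,0), (a,0), (a,b), (a-c,b+c), (-c,b+c), (-c,c);  *)
(* the successive sides are a e1, b e2, c (e2 - e1), and their opposites.     *)
Definition hexagon (a b c : nat) : {fset point} :=
  [fset p in [seq (i%:Z - c%:Z, j%:Z) | i <- iota 0 (a + c).+1,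
                                        j <- iota 0 (b + c).+1]
   | 0 <= p.1 + p.2 <= (a + b)%:Z].

(* The hexagon is convex, hence a unit triangle is contained in it as soon as *)
(* its vertices are.                                                          *)
Definition triangles_in (H : {fset point}) : {fset triangle} :=
  [fset t in fpowerset H | is_unit_triangle t].

Definition lozenges_in (H : {fset point}) : {fset lozenge} :=
  [fset l in fpowerset (triangles_in H) | is_lozenge l].

Definition tiling : Type := {fset lozenge}.

Definition is_tiling (H : {fset point}) (T : tiling) : bool :=
  (T `<=` lozenges_in H) &&
  [forall t : triangles_in H, (#|` [fset l in T | val t \in l]| == 1)%N].

Definition tilings (a b c : nat) : {fset tiling} :=
  [fset T in fpowerset (lozenges_in (hexagon a b c))
   | is_tiling (hexagon a b c) T].

(* Linear maps in the basis (e1, e2): rotation by 60 degrees, which sends e1  *)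
(* to e2 and e2 to e2 - e1, and reflection in the line spanned by e1, which   *)
(* sends e2 to e1 - e2.                                                       *)
Definition rot60 (v : point) : point := (- v.2, v.1 + v.2).
Definition refl_e1 (v : point) : point := (v.1 + v.2, - v.2).

Definition about (o : point) (f : point -> point) (p : point) : point :=
  o + f (p - o).

(* H(m,m,m) has center (0,m), and its diagonal joining the opposite corners   *)
(* (-m,m) and (m,m) is parallel to e1.                                        *)
Definition center (m : nat) : point := (0, m%:Z).

Definition rotation120 (m : nat) : point -> point :=
  about (center m) (rot60 \o rot60).

Definition rotation180 (m : nat) : point -> point :=
  about (center m) (rot60 \o rot60 \o rot60).

Definition reflection (m : nat) : point -> point :=
  about (center m) refl_e1.

Definition move_triangle (s : point -> point) (t : triangle) : triangle :=
  [fset s p | p in t].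

Definition move_lozenge (s : point -> point) (l : lozenge) : lozenge :=
  [fset move_triangle s t | t in l].

Definition move_tiling (s : point -> point) (T : tiling) : tiling :=
  [fset move_lozenge s l | l in T].

Definition invariant_tiling (s : point -> point) (T : tiling) : bool :=
  move_tiling s T == T.

Definition TSSC (m : nat) : nat :=
  #|` [fset T in tilings m m m
       | [&& invariant_tiling (rotation120 m) T,
             invariant_tiling (rotation180 m) T &
             invariant_tiling (reflection m) T]]|.

(* Main.v *)
(* Cut along the axes of symmetry, a totally symmetric tiling of H(2n,2n,2n)  *)
(* is determined by its lozenges in the sector 0 <= y <= x, and the lozenges  *)
(* on the axes are forced.  The horizontal sides in the sector that lie       *)
(* inside no lozenge are the vertices of n nonintersecting paths; the path    *)
(* from the point (i, i) of the axis takes i steps, each of them of one of    *)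
(* two kinds, so that it has the generating function (X(1+X))^i.  By the      *)
(* sign-reversing exchange of tails the number of path families is the sum of *)
(* the maximal minors of the matrix T of the coefficients of the (X(1+X))^i.  *)
(*                                                                            *)
(* If T S T^t = C J C^t, where S is the matrix of the signs of s - r and J    *)
(* the standard symplectic matrix, then this sum is det C (expand it like a   *)
(* Pfaffian).  After a unitriangular change of basis, T S T^t has the         *)
(* generating function (nu1(x) nu2(y) - nu2(x) nu1(y)) (x - y)/(z(x) - z(y))  *)
(* with z = X(1-X)^2 and explicit polynomials nu1, nu2 of small degree.  A    *)
(* Pade approximation e(z)/q(z) of X turns (z(x) - z(y))/(x - y) into the     *)
(* Bezout form of e and q, and the Sylvester matrix of e and q factors it     *)
(* over J.  This yields C, whose determinant is the product of the            *)
(* determinants of the coefficients of nu1 z^k, nu2 z^k and of z^k, X z^k.    *)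
(* Polynomials of Chebyshev type reduce these two to Vandermonde              *)
(* determinants.                                                              *)
Require Import Defs.
From mathcomp Require Import all_boot all_order all_algebra all_fingroup finmap.
From mathcomp Require Import ring lra zify.

Set Implicit Arguments.
Unset Strict Implicit.
Unset Printing Implicit Defensive.

Import Order.TTheory GRing.Theory Num.Theory.
Local Open Scope ring_scope.

(** A tiling is encoded by its field, the set of doubled midpoints, seen from the center, of the
    sides inside its lozenges. A field comes from a tiling when every unit triangle has exactly one
    marked side ([tiling_exact], [tiling_of_tiling]), and the symmetries act on it by linear maps
    ([midpoint_move]). Total symmetry leaves only the sector 0 <= y <= x. On its wall a reflection
    exchanges two sides of a triangle, so the third is the marked one. Inside, the unmarked
    horizontal sides form nonintersecting paths with fixed starts and free ends, and
    [TSSC_path_arrays] is the resulting bijection.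

    Exchange of tails ([card_path_arrays]) cancels the families that meet, so the count is the minor
    sum of the matrix T of coefficients of the (X(1+X))^i. By [minor_sum_expansion] such a sum obeys
    the recursion of the Pfaffian of T S T^t; hence T S T^t = C J C^t gives the value det C
    ([minor_sum_congruent]).

    In the basis [gram_basis] the Gram entries are coefficients of a fixed polynomial times powers
    of theta = 1+X+X^2. Lowering the row index multiplies by X^2/theta and lowering the column index
    by 1/theta. These two have the same value of z = X(1-X)^2, so multiplying the generating
    function by (z(x) - z(y))/(x - y) leaves only nu1(x) nu2(y) - nu2(x) nu1(y)
    ([gram_kernel_congr]). A Pade relation e(z) = X q(z) modulo X^n and the Bezout form of e and q
    then produce C, and q cancels from its determinant ([kernel_factorization]).

    Two determinants remain, with columns f z^k and g z^k. If 2 - 3X = t + 1/t then 2 - 27z = t^3 +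
    t^-3, so Chebyshev polynomials with indices advancing by 3 span the same columns. Their
    coefficients are Newton products, and the determinants reduce to Vandermonde ones
    ([normr_det_alternating]). For odd n the path from the origin has no step and is dropped
    ([minor_sum_path_odd]), which shifts the exponents by e = 1. Absolute values suffice because a
    count is nonnegative. *)

(** * Sums of maximal minors *)

(* The sign of the permutation that sorts x, and 0 if x is not injective.     *)
Definition vandermonde_sign k (x : 'I_k -> nat) : rat :=
  \prod_(i < k) \prod_(j < k | (i < j)%N) Num.sg ((x j)%:R - (x i)%:R).

Lemma sgr_bigprod (I : Type) (r : seq I) (P : pred I) (F : I -> rat) :
  Num.sg (\prod_(i <- r | P i) F i) = \prod_(i <- r | P i) Num.sg (F i).
Proof. by apply: big_morph; [exact: sgrM | exact: sgr1]. Qed.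

Lemma eq_vandermonde_sign k (x y : 'I_k -> nat) :
  x =1 y -> vandermonde_sign x = vandermonde_sign y.
Proof.
by move=> e; apply: eq_bigr => i _; apply: eq_bigr => j _; rewrite !e.
Qed.

Lemma vandermonde_sign_det k (x : 'I_k -> nat) :
  vandermonde_sign x = Num.sg (\det (Vandermonde k (\row_i (x i)%:R : 'rV[rat]_k))).
Proof.
rewrite det_Vandermonde sgr_bigprod; apply: eq_bigr => i _.
by rewrite sgr_bigprod; apply: eq_bigr => j _; rewrite !mxE.
Qed.

Lemma sgr_signM (b : bool) (a : rat) :
  Num.sg ((-1) ^+ b * a) = (-1) ^+ b * Num.sg a.
Proof. by case: b; rewrite ?expr1 ?mulN1r ?sgrN ?expr0 ?mul1r. Qed.

Lemma det_col_perm (R : comNzRingType) k (s : 'S_k) (A : 'M[R]_k) :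
  \det (col_perm s A) = (-1) ^+ s * \det A.
Proof. by rewrite col_permE det_mulmx det_perm odd_permV mulrC. Qed.

Lemma vandermonde_sign_perm k (x : 'I_k -> nat) (s : 'S_k) :
  vandermonde_sign (fun i => x (s i)) = (-1) ^+ s * vandermonde_sign x.
Proof.
rewrite !vandermonde_sign_det -sgr_signM -det_col_perm; congr (Num.sg (\det _)).
by apply/matrixP => i j; rewrite !mxE.
Qed.

Lemma vandermonde_sign_eq0 k (x : 'I_k -> nat) (i j : 'I_k) :
  i != j -> x i = x j -> vandermonde_sign x = 0.
Proof.
wlog ij : i j / (i < j)%N => [W ne e|_ e].
  by case: (ltngtP i j) => [/W|/W|/val_inj/eqP]; [apply | apply; rewrite // eq_sym|rewrite (negPf ne)].
by rewrite /vandermonde_sign (bigD1 i) //= (bigD1 j) //= e subrr sgr0 !mul0r.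
Qed.

Lemma vandermonde_sign_incr k (x : 'I_k -> nat) :
  {homo x : i j / (i < j)%N >-> (i < j)%N} -> vandermonde_sign x = 1.
Proof.
move=> mx; rewrite /vandermonde_sign big1 // => i _; rewrite big1 // => j /mx ij.
by rewrite gtr0_sg // subr_gt0 ltr_nat.
Qed.

(** Both sides are signs of determinants of a Vandermonde matrix bordered by an indicator row,
    before and after a permutation of columns. With k even the cofactor sign depends on the column
    only. *)
Lemma signed_minor_perm k (x : 'I_k.+1 -> nat) (s : 'S_k.+1) (j : 'I_k.+1) :
  ~~ odd k ->
  (-1) ^+ j * vandermonde_sign (fun i => x (s (lift j i))) =
  (-1) ^+ s * ((-1) ^+ s j * vandermonde_sign (fun i => x (lift (s j) i))).
Proof.
move=> evk.
(* A Vandermonde matrix whose last row is replaced by the indicator of l. *)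
pose B (y : 'I_k.+1 -> nat) (l : 'I_k.+1) : 'M[rat]_k.+1 :=
  \matrix_(r, c) (if r == ord_max then (c == l)%:R else (y c)%:R ^+ r).
have BE y l : Num.sg (\det (B y l)) =
    (-1) ^+ l * vandermonde_sign (fun i => y (lift l i)).
  rewrite (expand_det_row _ ord_max) (bigD1 l) //= big1 ?addr0; last first.
    by move=> c /negPf cl; rewrite mxE eqxx cl mul0r.
  rewrite mxE !eqxx mul1r /cofactor exprD -signr_odd (negPf evk) expr0 mul1r.
  rewrite -signr_odd sgr_signM; congr (_ * _).
  rewrite vandermonde_sign_det; congr (Num.sg (\det _)).
  apply/matrixP => r c; rewrite !mxE.
  have lr : lift ord_max r = r :> nat by exact: lift_max.
  rewrite lr ifF //; apply/eqP => /(congr1 (@nat_of_ord _)); rewrite lr => e.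
  by have := ltn_ord r; rewrite [X in (X < _)%N]e /= ltnn.
rewrite -!BE -(BE (fun i => x (s i))) -sgr_signM -det_col_perm.
congr (Num.sg (\det _)); apply/matrixP => r c; rewrite !mxE.
by case: ifP => // _; rewrite (inj_eq perm_inj).
Qed.

(** Only the place of x among the t j matters. Removing the two smallest values changes neither side
    while both lie below x; otherwise all later signs are 1. *)
Lemma alternating_sign_sum m (t : nat -> nat) (x : nat) :
  {homo t : i j / (i < j)%N >-> (i < j)%N} ->
  \prod_(j < m.*2.+1) Num.sg ((t j)%:R - x%:R : rat) =
  \sum_(j < m.*2.+1) (-1) ^+ j * Num.sg ((t j)%:R - x%:R).
Proof.
elim: m t => [|m IH] t mt; first by rewrite !big_ord_recl !big_ord0 expr0 mul1r mulr1 addr0.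
have mt2 : {homo (fun i => t i.+2) : i j / (i < j)%N >-> (i < j)%N} by move=> i j ij; apply: mt.
have pos j : (x < t j)%N -> Num.sg ((t j)%:R - x%:R : rat) = 1.
  by move=> h; rewrite gtr0_sg // subr_gt0 ltr_nat.
have neg j : (t j < x)%N -> Num.sg ((t j)%:R - x%:R : rat) = -1.
  by move=> h; rewrite ltr0_sg // subr_lt0 ltr_nat.
have zer j : t j = x -> Num.sg ((t j)%:R - x%:R : rat) = 0.
  by move=> ->; rewrite subrr sgr0.
rewrite doubleS; do 2!(rewrite big_ord_recl [in RHS]big_ord_recl).
rewrite (eq_bigr (fun j : 'I_m.*2.+1 => Num.sg ((t j.+2)%:R - x%:R))) //.
rewrite [in RHS](eq_bigr (fun j : 'I_m.*2.+1 => (-1) ^+ j * Num.sg ((t j.+2)%:R - x%:R))); last first.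
  by move=> j _; rewrite /= /bump /= !add1n !exprS !mulN1r opprK.
rewrite /= /bump /= expr0 expr1 mul1r mulN1r.
have t01 : (t 0 < t 1)%N by apply: mt.
have posr : (x <= t 1)%N -> \prod_(j < m.*2.+1) Num.sg ((t j.+2)%:R - x%:R : rat) = 1.
  by move=> h; rewrite big1 // => j _; apply: pos; apply: leq_ltn_trans h _; apply: mt.
rewrite -(IH _ mt2).
have [l1|g1|e1] := ltngtP (t 1%N) x.
- rewrite (neg _ l1) (neg _ (ltn_trans t01 l1)); ring.
- rewrite (posr (ltnW g1)) (pos _ g1); ring.
rewrite posr ?(leq_trans _ (eq_leq (esym e1))) // (zer _ e1) (neg 0%N); last by rewrite -e1.
ring.
Qed.

Lemma exists_sorting_perm k (x : 'I_k -> nat) :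
  exists s : 'S_k, {homo (fun i => x (s i)) : i j / (i <= j)%N >-> (i <= j)%N}.
Proof.
pose t := [tuple x i | i < k].
have /tuple_permP [s es] : perm_eq (sort leq t) t by rewrite perm_sort.
exists s => i j ij.
have xs l : x (s l) = nth 0%N (sort leq t) l.
  by rewrite es -tnth_nth !tnth_mktuple.
rewrite !xs; apply: (sorted_leq_nth leq_trans leqnn) => //.
- by apply: sort_sorted; exact: leq_total.
- by rewrite inE size_sort size_tuple.
- by rewrite inE size_sort size_tuple.
Qed.

(** This is the first-row expansion of the Pfaffian of the matrix of signs of x j - x i. Both sides
    alternate in the remaining entries, so these may be sorted; the smaller signs are then 1 and
    [alternating_sign_sum] remains. *)
Lemma vandermonde_sign_pfaffian_expansion k (x : 'I_k.+2 -> nat) :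
  ~~ odd k ->
  vandermonde_sign x =
  \sum_(j < k.+1) (-1) ^+ j * Num.sg ((x (lift ord0 j))%:R - (x ord0)%:R)
    * vandermonde_sign (fun i => x (lift ord0 (lift j i))).
Proof.
move=> evk; pose th i := x (lift ord0 i); pose a := x ord0.
have -> : vandermonde_sign x =
    (\prod_j Num.sg ((th j)%:R - a%:R)) * vandermonde_sign th.
  rewrite /vandermonde_sign big_ord_recl; congr (_ * _).
    rewrite big_mkcond big_ord_recl. by rewrite /= mul1r.
  apply: eq_bigr => i _; rewrite big_mkcond big_ord_recl /= mul1r [RHS]big_mkcond.
  by apply: eq_bigr => j _; rewrite ltnS.
rewrite -/a; under eq_bigr => j _ do rewrite -/(th _).
rewrite [RHS](_ : _ = \sum_(j < k.+1) Num.sg ((th j)%:R - a%:R) *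
    ((-1) ^+ j * vandermonde_sign (fun i => th (lift j i)))); last first.
  by apply: eq_bigr => j _; rewrite mulrA [_ * (-1) ^+ _]mulrC.
have [s ms] := exists_sorting_perm th.
pose rhs (y : 'I_k.+1 -> nat) := \sum_(j < k.+1) Num.sg ((y j)%:R - a%:R : rat) *
    ((-1) ^+ j * vandermonde_sign (fun i => y (lift j i))).
pose lhs (y : 'I_k.+1 -> nat) := (\prod_j Num.sg ((y j)%:R - a%:R : rat)) * vandermonde_sign y.
have rhs_perm y (r : 'S_k.+1) : rhs (fun i => y (r i)) = (-1) ^+ r * rhs y.
  rewrite /rhs mulr_sumr [in RHS](reindex_inj (@perm_inj _ r)).
  by apply: eq_bigr => j _; rewrite signed_minor_perm // mulrCA.
have lhs_perm y (r : 'S_k.+1) : lhs (fun i => y (r i)) = (-1) ^+ r * lhs y.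
  by rewrite /lhs vandermonde_sign_perm mulrCA [in RHS](reindex_inj (@perm_inj _ r)).
suff e : lhs (fun i => th (s i)) = rhs (fun i => th (s i)).
  by move: e; rewrite lhs_perm rhs_perm; apply: mulfI; rewrite signr_eq0.
move: (fun i => th (s i)) ms => y my.
have [inj_y|] := boolP (injectiveb y); last first.
  (* A repeated value kills the right side as well: the transposition of its two places fixes y and
     reverses the sign. *)
  case/injectivePn => i [j ij e]; rewrite /lhs (vandermonde_sign_eq0 ij e) mulr0.
  have := rhs_perm y (tperm i j); rewrite odd_tperm ij expr1 mulN1r.
  rewrite (_ : rhs _ = rhs y); first by move=> h; lra.
  have ey l : y (tperm i j l) = y l by case: tpermP => // ->.
  apply: eq_bigr => l _; rewrite ey; congr (_ * (_ * _)).
  by apply: eq_vandermonde_sign => c; rewrite ey.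
have sy : {homo y : i j / (i < j)%N >-> (i < j)%N}.
  move=> i j ij; rewrite ltn_neqAle my ?andbT; last exact: ltnW.
  by apply/eqP => /(injectiveP _ inj_y) e; rewrite e ltnn in ij.
rewrite /lhs vandermonde_sign_incr // mulr1.
transitivity (\sum_(j < k.+1) (-1) ^+ j * Num.sg ((y j)%:R - a%:R : rat)); last first.
  apply: eq_bigr => j _; rewrite vandermonde_sign_incr ?mulr1 1?mulrC // => i l il.
  by apply: sy; rewrite /= ltnNge leq_bump2 -ltnNge.
(* [alternating_sign_sum] speaks of a sequence on all of nat, so y is continued by a strictly
   increasing tail. *)
pose t l := if (l < k.+1)%N then y (inord l) else (y ord_max + l)%N.
have st : {homo t : i j / (i < j)%N >-> (i < j)%N}.
  move=> i j ij; rewrite /t; case: ifP => ik; case: ifP => jk; try lia.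
  - by apply: sy; rewrite !inordK.
  - have : (y (inord i) <= y ord_max)%N by apply: my; rewrite inordK // -ltnS.
    by lia.
have ty (j : 'I_k.+1) : y j = t j by rewrite /t ltn_ord inord_val.
have [m em] : exists m, k = m.*2 by exists k./2; rewrite even_halfK.
under eq_bigr do rewrite ty; under [RHS]eq_bigr do rewrite ty.
rewrite em; exact: (alternating_sign_sum m a st).
Qed.

(* The rows range over all functions, so that this is the sum of the maximal  *)
(* minors of T.                                                               *)
Definition minor_sum k N (T : 'M[rat]_(k, N)) : rat :=
  \sum_(f : {ffun 'I_k -> 'I_N}) (\prod_i T i (f i)) * vandermonde_sign (fun i => f i).

(** Summing over all relabellings of the rows turns products of entries into minors, on which a row
    operation acts by its determinant. *)
Lemma minor_sum_det k N (T : 'M[rat]_(k, N)) :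
  k`!%:R * minor_sum T =
  \sum_(f : {ffun 'I_k -> 'I_N}) vandermonde_sign (fun i => f i) * \det (\matrix_(i, j) T i (f j)).
Proof.
rewrite /determinant /minor_sum.
under [RHS]eq_bigr do rewrite mulr_sumr.
rewrite [RHS]exchange_big /= -[k`!](card_Sn k) mulr_natl -sumr_const.
apply: eq_big => [s|s _]; first by rewrite inE.
pose h (f : {ffun 'I_k -> 'I_N}) := [ffun i => f ((s^-1)%g i)].
have hi : injective h.
  move=> f1 f2 /ffunP e; apply/ffunP => i; have := e (s i); rewrite !ffunE.
  by rewrite permK.
rewrite [RHS](reindex_inj hi); apply: eq_bigr => f _.
rewrite (eq_vandermonde_sign (x := fun i => h f i) (y := fun i => f ((s^-1)%g i))); last by move=> i; rewrite ffunE.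
rewrite (vandermonde_sign_perm (fun i => f i)) odd_permV mulrACA -signr_addb addbb mul1r mulrC.
by congr (_ * _); apply: eq_bigr => i _; rewrite mxE ffunE permK.
Qed.

Lemma minor_sum_mul k N (g : 'M_k) (T : 'M[rat]_(k, N)) :
  minor_sum (g *m T) = \det g * minor_sum T.
Proof.
have nz : k`!%:R != 0 :> rat by rewrite pnatr_eq0 -lt0n fact_gt0.
apply: (mulfI nz); rewrite mulrCA !minor_sum_det mulr_sumr.
apply: eq_bigr => f _; rewrite mulrCA -det_mulmx; congr (_ * \det _).
by apply/matrixP => i j; rewrite !mxE; apply: eq_bigr => l _; rewrite !mxE.
Qed.

Definition ffun_insert k (A : Type) (j : 'I_k.+1) (a : A) (h : {ffun 'I_k -> A}) :
  {ffun 'I_k.+1 -> A} := [ffun i => oapp h a (unlift j i)].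

Lemma ffun_insert_at k (A : Type) (j : 'I_k.+1) (a : A) (h : {ffun 'I_k -> A}) :
  ffun_insert j a h j = a.
Proof. by rewrite ffunE unlift_none. Qed.

Lemma ffun_insert_lift k (A : Type) (j : 'I_k.+1) (a : A) (h : {ffun 'I_k -> A}) i :
  ffun_insert j a h (lift j i) = h i.
Proof. by rewrite ffunE liftK. Qed.

Lemma sum_ffun_insert (V : nmodType) k (A : finType) (j : 'I_k.+1)
    (F : {ffun 'I_k.+1 -> A} -> V) :
  \sum_f F f = \sum_a \sum_(h : {ffun 'I_k -> A}) F (ffun_insert j a h).
Proof.
rewrite pair_big /= (reindex (fun p : A * {ffun 'I_k -> A} => ffun_insert j p.1 p.2)) //=.
exists (fun f : {ffun 'I_k.+1 -> A} => (f j, [ffun i => f (lift j i)])) => [[a h] _|f _].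
  rewrite /= ffun_insert_at; congr (_, _); apply/ffunP => i.
  by rewrite ffunE ffun_insert_lift.
by apply/ffunP => i; rewrite ffunE; case: unliftP => [c|] -> //=; rewrite ffunE.
Qed.

Definition order_sign_mx N : 'M[rat]_N := \matrix_(r, s) Num.sg (s%:R - r%:R).

(** Once the values of f on rows 0 and j + 1 are split off, their sum is an entry of T S T^t and the
    rest is the minor sum without these rows: the recursion of a Pfaffian. *)
Lemma minor_sum_expansion k N (T : 'M[rat]_(k.+2, N)) :
  ~~ odd k ->
  minor_sum T = \sum_(j < k.+1) (-1) ^+ j *
    (T *m order_sign_mx N *m T^T) ord0 (lift ord0 j) *
    minor_sum (row' j (row' ord0 T)).
Proof.
move=> evk; rewrite /minor_sum.
under eq_bigr do rewrite vandermonde_sign_pfaffian_expansion // mulr_sumr.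
rewrite exchange_big; apply: eq_bigr => j _ /=.
rewrite (sum_ffun_insert ord0) /=.
under eq_bigr do rewrite (sum_ffun_insert j) /=.
transitivity ((\sum_(a < N) \sum_(b < N) (T ord0 a * T (lift ord0 j) b * Num.sg (b%:R - a%:R)))
   * ((-1) ^+ j * minor_sum (row' j (row' ord0 T)))).
  rewrite mulr_suml; apply: eq_bigr => a _; rewrite mulr_suml; apply: eq_bigr => b _.
  rewrite /minor_sum !mulr_sumr.
  apply: eq_bigr => h _.
  rewrite (bigD1_ord ord0) //= (bigD1_ord j) //= !ffun_insert_at ffun_insert_lift ffun_insert_at.
  rewrite (eq_bigr (fun i => (row' j (row' ord0 T)) i (h i))); last first.
    by move=> i _; rewrite !ffun_insert_lift !mxE.
  rewrite (eq_vandermonde_sign (y := fun i => h i)); last by move=> i; rewrite !ffun_insert_lift.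
  by ring.
rewrite mulrA; congr (_ * _); rewrite mulrC; congr (_ * _).
rewrite mxE exchange_big; apply: eq_bigr => b _; rewrite !mxE mulr_suml.
by apply: eq_bigr => a _; rewrite !mxE mulrAC.
Qed.

Definition symplectic_mx k : 'M[rat]_k :=
  \matrix_(i, j) ((~~ odd i && (j == i.+1 :> nat))%:R
                  - (~~ odd j && (i == j.+1 :> nat))%:R).

(** Only j = 0 survives in the expansion, and deleting the first two rows reproduces the
    hypothesis. *)
Lemma minor_sum_symplectic m N (T : 'M[rat]_(m.*2, N)) :
  T *m order_sign_mx N *m T^T = symplectic_mx m.*2 -> minor_sum T = 1.
Proof.
elim: m T => [|m IH] T eT.
  rewrite /minor_sum (eq_bigr (fun=> 1)) => [|f _]; last first.
    by rewrite /vandermonde_sign !big_ord0 mul1r.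
  by rewrite sumr_const card_ffun !card_ord expn0.
rewrite minor_sum_expansion ?odd_double // eT big_ord_recl big1 ?addr0 => [|j _]; last first.
  rewrite mxE /= /bump /= !add1n andbF subr0 mulr0 mul0r. by [].
rewrite mxE /= subr0 expr0 !mul1r; apply: IH.
apply/matrixP => i j; move/matrixP: eT => /(_ (lift ord0 (lift ord0 i)) (lift ord0 (lift ord0 j))).
rewrite !mxE /= /bump !add1n /= !negbK => <-; apply: eq_bigr => r _.
by rewrite !mxE; congr (_ * _); apply: eq_bigr => s _; rewrite !mxE.
Qed.

Lemma minor_sum_congruent m N (T : 'M[rat]_(m.*2, N)) (C : 'M_(m.*2)) :
  C \in unitmx ->
  T *m order_sign_mx N *m T^T = C *m symplectic_mx m.*2 *m C^T -> minor_sum T = \det C.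
Proof.
move=> uC e; rewrite -[T](mulKVmx uC) minor_sum_mul minor_sum_symplectic ?mulr1 //.
rewrite trmx_mul !mulmxA -(mulmxA (invmx C)) -(mulmxA (invmx C)) e !mulmxA mulVmx // mul1mx.
by rewrite -mulmxA -trmx_mul mulVmx // trmx1 mulmx1.
Qed.

(** * Factorization of the kernel *)

Definition coef2_mx n (p : {poly {poly rat}}) : 'M[rat]_n := \matrix_(i, j) (p`_j)`_i.

(** Multiplication by f modulo X^n. *)
Definition toeplitz_mx n (f : {poly rat}) : 'M[rat]_n :=
  \matrix_(i, j) (if (j <= i)%N then f`_(i - j) else 0).

(** This is (f(x) - f(y)) / (x - y), with x the inner variable. *)
Definition divided_difference (f : {poly rat}) : {poly {poly rat}} :=
  \poly_(j < size f) \poly_(i < size f) f`_(i + j).+1.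

Lemma coef_divided_difference f i j :
  ((divided_difference f)`_j)`_i = f`_(i + j).+1.
Proof.
have e k : (size f <= k)%N -> f`_(k).+1 = 0 by move=> h; rewrite nth_default // ltnW.
rewrite coef_poly; case: ltnP => hj; last by rewrite coef0 e // (leq_trans hj) ?leq_addl.
by rewrite coef_poly; case: ltnP => hi //; rewrite e // (leq_trans hi) ?leq_addr.
Qed.

Lemma divided_differenceE f :
  ('X%:P - 'X) * divided_difference f = f%:P - f^:P.
Proof.
apply/polyP => j; apply/polyP => i.
rewrite mulrBl !coefB coefCM coefXM coefC coef_map /= coefXM.
rewrite coef_divided_difference [X in _ - X = _](_ : _ = if j == 0%N then 0 else f`_(i + j)).
  case: i j => [|i] [|j] //=; rewrite ?coef0 ?coefC ?addn0 ?addnS //= ?subrr ?subr0 //.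
by case: j => [|j]; rewrite ?coef0 // coef_divided_difference /= addnS.
Qed.

(** For a down-set D of exponents, the polynomials without terms in D form an ideal. *)
Lemma coef2_mul_down (D : nat -> nat -> bool) (p r : {poly {poly rat}}) :
  (forall i j i' j', D i j -> (i' <= i)%N -> (j' <= j)%N -> D i' j') ->
  (forall i j, D i j -> (p`_j)`_i = 0) ->
  forall i j, D i j -> ((r * p)`_j)`_i = 0.
Proof.
move=> dD p0 i j Dij; rewrite coefM coef_sum big1 // => k _.
rewrite coefM big1 // => l _; rewrite p0 ?mulr0 //.
by apply: dD Dij _ _; rewrite leq_subr.
Qed.

Definition congr2 n (p r : {poly {poly rat}}) :=
  forall i j, (i < n)%N -> (j < n)%N -> (p`_j)`_i = (r`_j)`_i.

Lemma congr2_mx n p r : congr2 n p r -> coef2_mx n p = coef2_mx n r.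
Proof. by move=> h; apply/matrixP => i j; rewrite !mxE h. Qed.

Lemma congr2_sub n p r : congr2 n p r <-> congr2 n (p - r) 0.
Proof.
split=> h i j hi hj; first by rewrite !coefB h // subrr !coef0.
by apply/eqP; rewrite -subr_eq0 -!coefB h // !coef0.
Qed.

Lemma congr2_mul n p r s : congr2 n p r -> congr2 n (s * p) (s * r).
Proof.
move=> /congr2_sub h; apply/congr2_sub => i j hi hj; rewrite -mulrBr !coef0.
apply: (coef2_mul_down (D := fun i j => (i < n)%N && (j < n)%N)); last by rewrite hi.
- by move=> i1 j1 i2 j2 /andP[? ?] ? ?; lia.
- by move=> i1 j1 /andP[? ?]; rewrite h // !coef0.
Qed.

Lemma congr2_trans n p r s : congr2 n p r -> congr2 n r s -> congr2 n p s.
Proof. by move=> h1 h2 i j hi hj; rewrite h1 // h2. Qed.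

(** The factor has constant term 1, hence is a unit modulo x^n and y^n; the coefficients of the
    difference vanish by induction on the total degree. *)
Lemma congr2_cancel n (a b p r : {poly {poly rat}}) :
  congr2 n ((1 + 'X%:P * a + 'X * b) * p) ((1 + 'X%:P * a + 'X * b) * r) -> congr2 n p r.
Proof.
move=> /congr2_sub h; apply/congr2_sub; rewrite -mulrBr in h; move: (p - r) h => q h {p r}.
suff q0 s i j : (i + j < s)%N -> (i < n)%N -> (j < n)%N -> (q`_j)`_i = 0.
  by move=> i j hi hj; rewrite (q0 (i + j).+1) // !coef0.
elim: s i j => // s IH i j ijs hi hj.
pose D i j := [&& (i + j < s)%N, (i < n)%N & (j < n)%N].
have dD i1 j1 i2 j2 : D i1 j1 -> (i2 <= i1)%N -> (j2 <= j1)%N -> D i2 j2.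
  by rewrite /D; lia.
have qD c i1 j1 : D i1 j1 -> ((c * q)`_j1)`_i1 = 0.
  by move=> D1; apply: (coef2_mul_down c dD _ D1) => i2 j2 /and3P[? ? ?]; apply: IH.
have := h i j hi hj; rewrite !coef0 !mulrDl mul1r !coefD -!mulrA.
rewrite coefCM coefXM coefXM => e0; rewrite -[RHS]e0.
rewrite [X in _ + X + _](_ : _ = 0) ?addr0; last first.
  by case: ifP => // /negbT hi0; apply: qD; rewrite /D; lia.
rewrite [X in _ + X](_ : _ = 0) ?addr0 //.
by case: ifP => [_|/negbT hj0]; rewrite ?coef0 //; apply: qD; rewrite /D; lia.
Qed.

Lemma toeplitz_sum n (h : {poly rat}) k (F : nat -> rat) : (k < n)%N ->
  \sum_(l < n) (if (l <= k)%N then h`_(k - l) else 0) * F l =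
  \sum_(l < k.+1) h`_l * F (k - l)%N.
Proof.
move=> kn; rewrite [RHS](reindex_inj rev_ord_inj) /=.
rewrite -(big_mkord xpredT (fun l => (if (l <= k)%N then h`_(k - l) else 0) * F l)).
rewrite -(big_mkord xpredT (fun l => h`_(k.+1 - l.+1) * F (k - (k.+1 - l.+1))%N)).
rewrite (big_cat_nat (n := k.+1)) //= [X in _ + X](_ : _ = 0) ?addr0; last first.
  by rewrite big_nat big1 // => l /andP[kl _]; rewrite leqNgt kl mul0r.
by apply: eq_big_nat => l /andP[_ lk]; rewrite -ltnS lk subSS subKn // -ltnS.
Qed.

Lemma coef2_mx_conj n (f g : {poly rat}) p :
  coef2_mx n (f%:P * g^:P * p) =
  toeplitz_mx n f *m coef2_mx n p *m (toeplitz_mx n g)^T.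
Proof.
apply/matrixP => i j; rewrite mxE -mulrA coefCM coefM coefM.
transitivity (\sum_(k < i.+1) f`_k * \sum_(l < j.+1) g`_l * (p`_(j - l))`_(i - k)).
  apply: eq_bigr => k _; congr (_ * _); rewrite coef_sum; apply: eq_bigr => l _.
  by rewrite coef_map /= coefCM.
rewrite -(toeplitz_sum f (fun k => \sum_(l < j.+1) g`_l * (p`_(j - l))`_k) (ltn_ord i)).
rewrite mxE.
rewrite [RHS](eq_bigr (fun l : 'I_n => (if (l <= j)%N then g`_(j - l) else 0) *
   (\sum_(k < n) (if (k <= i)%N then f`_(i - k) else 0) * (p`_l)`_k))); last first.
  by move=> l _; rewrite !mxE mulrC; congr (_ * _); apply: eq_bigr => k _; rewrite !mxE.
under [RHS]eq_bigr do rewrite mulr_sumr.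
rewrite [RHS]exchange_big /=; apply: eq_bigr => k _.
rewrite -(toeplitz_sum g (fun l => (p`_l)`_k) (ltn_ord j)) mulr_sumr.
by apply: eq_bigr => l _; rewrite mulrCA.
Qed.

Lemma det_toeplitz n (f : {poly rat}) : \det (toeplitz_mx n f) = f`_0 ^+ n.
Proof.
rewrite det_trig; last first.
  by apply/is_trig_mxP => i j ij; rewrite mxE leqNgt ij.
rewrite (eq_bigr (fun=> f`_0)) ?prodr_const ?card_ord // => i _.
by rewrite mxE leqnn subnn.
Qed.

(** The form (e(x) q(y) - e(y) q(x)) / (x - y), written without division. *)
Definition bezout (e q : {poly rat}) : {poly {poly rat}} :=
  divided_difference e * q%:P - e%:P * divided_difference q.

Lemma bezoutE e q :
  ('X%:P - 'X) * bezout e q = e^:P * q%:P * -1 + e%:P * q^:P.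
Proof.
rewrite /bezout mulrBr mulrA divided_differenceE mulrCA divided_differenceE; ring.
Qed.

Definition cubic : {poly rat} := 'X * (1 - 'X) ^+ 2.

(* The quotient (z(x) - z(y)) / (x - y) for z = cubic. In {poly {poly rat}}   *)
(* the inner variable, written 'X%:P, is the row index.                       *)
Definition cubic_dd : {poly {poly rat}} :=
  1 + 'X%:P * ('X%:P + 'X - 2) + 'X * ('X - 2).

Lemma cubic_ddE : ('X%:P - 'X) * cubic_dd = cubic%:P - cubic^:P.
Proof.
rewrite /cubic /cubic_dd !(rmorphM, rmorphXn, rmorphB, rmorph1) /= map_polyX; ring.
Qed.

Definition subst2 (y : {poly rat}) : {poly {poly rat}} -> {poly {poly rat}} :=
  horner_morph (f := (polyC \o comp_poly y : {rmorphism {poly rat} -> {poly {poly rat}}}))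
    (fun f => mulrC (y^:P) _).

Lemma subst2_inl y f : subst2 y f%:P = (f \Po y)%:P.
Proof. by rewrite /subst2 horner_morphC. Qed.

Lemma subst2_inr y (f : {poly rat}) : subst2 y (f^:P) = (f \Po y)^:P.
Proof.
rewrite /subst2 /horner_morph -map_poly_comp.
rewrite /comp_poly -(horner_map (map_poly polyC)) -map_poly_comp.
congr (_.[_]); apply: eq_map_poly => c /=.
by rewrite comp_polyC map_polyC.
Qed.

Lemma subst2B y p r : subst2 y (p - r) = subst2 y p - subst2 y r.
Proof. exact: rmorphB. Qed.

Lemma subst2D y p r : subst2 y (p + r) = subst2 y p + subst2 y r.
Proof. exact: rmorphD. Qed.

Lemma subst2M y p r : subst2 y (p * r) = subst2 y p * subst2 y r.
Proof. exact: rmorphM. Qed.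

Lemma subst2N1 y : subst2 y (-1) = -1.
Proof. exact: rmorphN1. Qed.

Lemma subst2_sum y (I : Type) (s : seq I) (P : pred I) F :
  subst2 y (\sum_(i <- s | P i) F i) = \sum_(i <- s | P i) subst2 y (F i).
Proof. exact: rmorph_sum. Qed.

Lemma expand2 m (b : {poly {poly rat}}) :
  (forall i j, (m <= i)%N || (m <= j)%N -> (b`_j)`_i = 0) ->
  b = \sum_(i < m) \sum_(j < m) ((b`_j)`_i *: 'X^i)%:P * ('X^j)^:P.
Proof.
move=> b0.
have poly_expand (R : nzSemiRingType) (p : {poly R}) : (forall j, (m <= j)%N -> p`_j = 0) ->
    p = \sum_(j < m) p`_j *: 'X^j.
  move=> p0; rewrite -poly_def; apply/polyP => j; rewrite coef_poly.
  by case: ltnP => // /p0.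
have {1}-> : b = \sum_(j < m) b`_j *: 'X^j.
  by apply: poly_expand => j mj; apply/polyP => i; rewrite coef0 b0 // mj orbT.
rewrite exchange_big; apply: eq_bigr => j _ /=.
rewrite {1}(poly_expand _ b`_j) => [|i mi]; last by rewrite b0 // mi.
rewrite scaler_suml; apply: eq_bigr => i _.
by rewrite map_polyXn mul_polyC.
Qed.

Lemma congr2_inl0 n (r : {poly rat}) s :
  (forall i, (i < n)%N -> r`_i = 0) -> congr2 n (r%:P * s) 0.
Proof.
move=> r0; rewrite mulrC -(mulr0 s); apply: congr2_mul => i j hi hj.
by rewrite coefC; case: eqP => _; rewrite !coef0 ?r0.
Qed.

Lemma congr2_inr0 n (r : {poly rat}) s :
  (forall i, (i < n)%N -> r`_i = 0) -> congr2 n (r^:P * s) 0.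
Proof.
move=> r0; rewrite mulrC -(mulr0 s); apply: congr2_mul => i j hi hj.
by rewrite coef_map /= coefC r0 // !coef0 if_same.
Qed.

(** Modulo x^n and y^n the relation e(z) = X q(z) turns z(x) - z(y) times the Bezout form into (x -
    y) q(z(x)) q(z(y)). The factor x - y cannot be cancelled under truncation; the cofactor N
    supplies it instead. *)
Lemma pade_kernel n (k N : {poly {poly rat}}) (nu1 nu2 e q : {poly rat}) :
  nu1%:P * nu2^:P - nu2%:P * nu1^:P = ('X - 'X%:P) * N ->
  congr2 n (cubic_dd * k) (nu1%:P * nu2^:P - nu2%:P * nu1^:P) ->
  (forall i, (i < n)%N -> ((e \Po cubic) - 'X * (q \Po cubic))`_i = 0) ->
  congr2 n ((q \Po cubic)%:P * (q \Po cubic)^:P * k)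
           (subst2 cubic (bezout e q) * (nu1%:P * nu2^:P - nu2%:P * nu1^:P)).
Proof.
move=> eN hk he; set q' := q \Po cubic; set r := (_ - _) in he.
have ee : e \Po cubic = 'X * q' + r by rewrite /r /q'; ring.
clearbody r.
(* It suffices to compare after multiplication by the unit [cubic_dd], whose definition has the
   shape required here. *)
apply: (@congr2_cancel n ('X%:P + 'X - 2) ('X - 2)); rewrite -/cubic_dd.
rewrite [X in congr2 n X](_ : _ = q'%:P * q'^:P * (cubic_dd * k)); last by ring.
apply: (congr2_trans (congr2_mul _ hk)); rewrite eN.
rewrite [X in congr2 n _ X](_ : _ = - (('X%:P - 'X) * cubic_dd * subst2 cubic (bezout e q)) * N); last by ring.
have eX : cubic%:P - cubic^:P = subst2 cubic ('X%:P - 'X).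
  by rewrite subst2B subst2_inl -[X in _ = _ - subst2 _ X](map_polyX polyC) subst2_inr comp_polyX.
rewrite cubic_ddE eX -subst2M bezoutE.
rewrite subst2D !subst2M subst2N1 !subst2_inl !subst2_inr -/q' ee.
apply/congr2_sub; rewrite !rmorphD !rmorphM /= map_polyX.
rewrite [X in congr2 n X](_ : _ = r%:P * (q'^:P * N) - r^:P * (q'%:P * N)); last by ring.
move=> i j hi hj; rewrite coefB coefB (congr2_inl0 _ he) // (congr2_inr0 _ he) //.
by rewrite !coef0 subrr.
Qed.

Definition basis_mx n m (f y : {poly rat}) : 'M[rat]_(n, m) := \matrix_(i, k) (f * y ^+ k)`_i.

Lemma coef2_mx_subst n m (b : {poly {poly rat}}) (y f g : {poly rat}) :
  (forall i j, (m <= i)%N || (m <= j)%N -> (b`_j)`_i = 0) ->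
  coef2_mx n (subst2 y b * (f%:P * g^:P)) =
  basis_mx n m f y *m coef2_mx m b *m (basis_mx n m g y)^T.
Proof.
move=> b0; apply/matrixP => i j; rewrite {1}(expand2 b0) mxE.
rewrite subst2_sum mulr_suml 2!coef_sum mxE.
transitivity (\sum_(k < m) \sum_(l < m) (b`_l)`_k * (f * y ^+ k)`_i * (g * y ^+ l)`_j).
  apply: eq_bigr => k _; rewrite subst2_sum mulr_suml 2!coef_sum; apply: eq_bigr => l _.
  rewrite subst2M subst2_inl subst2_inr comp_polyZ !comp_Xn_poly.
  rewrite mulrACA -polyCM -rmorphM coefCM coef_map /= coefMC -scalerAl coefZ.
  by rewrite ![y ^+ _ * _]mulrC.
rewrite exchange_big; apply: eq_bigr => l _; rewrite !mxE mulr_suml.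
by apply: eq_bigr => k _; rewrite !mxE; ring.
Qed.

Lemma bezout_coef0 m (e q : {poly rat}) i j :
  (size e <= m.+1)%N -> (size q <= m.+1)%N -> (m <= i)%N || (m <= j)%N ->
  ((bezout e q)`_j)`_i = 0.
Proof.
move=> se sq.
have dd0 (f : {poly rat}) i' j' : (size f <= m.+1)%N -> (m <= i')%N || (m <= j')%N ->
    ((divided_difference f)`_j')`_i' = 0.
  move=> sf h; rewrite coef_divided_difference nth_default //.
  by apply: leq_trans sf _; lia.
case/orP=> [mi|mj].
  suff -> : bezout e q = divided_difference e * q^:P - e^:P * divided_difference q.
    rewrite [e^:P * _]mulrC !coefB !coefM !coef_sum.
    by rewrite !big1 ?subrr // => l _; rewrite coef_map /= coefMC dd0 ?mi // mul0r.
  rewrite /bezout.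
  have -> : q%:P = q^:P + ('X%:P - 'X) * divided_difference q.
    by rewrite divided_differenceE; ring.
  have -> : e%:P = e^:P + ('X%:P - 'X) * divided_difference e.
    by rewrite divided_differenceE; ring.
  ring.
rewrite /bezout mulrC !coefB !coefCM !coefM !big1 ?subrr // => l _.
  by rewrite dd0 ?mj ?orbT // mulr0.
by rewrite dd0 ?mj ?orbT // mulr0.
Qed.

Lemma sum_double (V : nmodType) m (F : nat -> V) :
  \sum_(c < m.*2) F c = \sum_(i < m) (F i.*2 + F i.*2.+1).
Proof.
by elim: m => [|m IH]; rewrite ?big_ord0 // doubleS !big_ord_recr /= IH addrA.
Qed.

Lemma symplectic_sum m (F G : nat -> rat) :
  \sum_(c < m.*2) \sum_(d < m.*2) F c * symplectic_mx m.*2 c d * G d =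
  \sum_(i < m) (F i.*2 * G i.*2.+1 - F i.*2.+1 * G i.*2).
Proof.
rewrite (eq_bigr (fun c : 'I_m.*2 => if odd c then - (F c * G c.-1) else F c * G c.+1)).
  rewrite (sum_double _ (fun c => if odd c then - (F c * G c.-1) else F c * G c.+1)).
  by apply: eq_bigr => i _; rewrite /= odd_double.
move=> c _; case: ifP => oc.
  have c0 : (0 < c)%N by case: (nat_of_ord c) oc.
  have lc : (c.-1 < m.*2)%N by apply: leq_ltn_trans (leq_pred _) (ltn_ord c).
  rewrite (bigD1 (Ordinal lc)) //= big1 ?addr0.
    rewrite mxE /= oc /= sub0r.
    have -> : odd c.-1 = false by case: (nat_of_ord c) oc => //= k /negbTE.
    by rewrite prednK // eqxx mulrN mulNr mulr1.
  move=> d dc; rewrite mxE oc /= sub0r; case: eqP => [e|]; last by rewrite andbF oppr0 mulr0 mul0r.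
  by case/eqP: dc; apply: val_inj; rewrite /= e.
have lc : (c.+1 < m.*2)%N.
  rewrite ltn_neqAle ltn_ord andbT; apply/eqP => e.
  by have := odd_double m; rewrite -e /= oc.
rewrite (bigD1 (Ordinal lc)) //= big1 ?addr0.
  rewrite mxE /= oc eqxx /= [X in _ - X](_ : _ = 0) ?subr0 ?mulr1 //.
move=> d dc; rewrite mxE oc /=; case: eqP => [e|_].
  by case/eqP: dc; apply: val_inj.
rewrite sub0r; case: eqP => [e|]; last by rewrite andbF oppr0 mulr0 mul0r.
by move: oc; rewrite e /= => /negbFE ->; rewrite oppr0 mulr0 mul0r.
Qed.

Lemma symplectic_sum_addnn m (F G : nat -> rat) :
  \sum_(c < m + m) \sum_(d < m + m) F c * symplectic_mx (m + m) c d * G d =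
  \sum_(i < m) (F i.*2 * G i.*2.+1 - F i.*2.+1 * G i.*2).
Proof. by move: (symplectic_sum m F G); rewrite -addnn. Qed.

Lemma toeplitz_mul n (f p : {poly rat}) (i : 'I_n) :
  \sum_(l < n) toeplitz_mx n f i l * p`_l = (f * p)`_i.
Proof.
under eq_bigr do rewrite mxE.
by rewrite (toeplitz_sum f (fun l => p`_l) (ltn_ord i)) coefM.
Qed.

Lemma coef_comp_sum n (p y : {poly rat}) i :
  (size p <= n)%N -> (p \Po y)`_i = \sum_(k < n) (y ^+ k)`_i * p`_k.
Proof.
move=> sp; rewrite comp_polyE coef_sum.
rewrite (big_ord_widen n (fun k => (p`_k *: y ^+ k)`_i) sp) big_mkcond.
apply: eq_bigr => k _; rewrite coefZ mulrC; case: ltnP => // h.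
by rewrite (nth_default 0 h) mulr0.
Qed.

Lemma cubicXn_coef k i : (i < k)%N -> (cubic ^+ k)`_i = 0.
Proof. by move=> ik; rewrite /cubic exprMn coefXnM ik. Qed.

Lemma cubicXn_lead k : (cubic ^+ k)`_k = 1.
Proof.
rewrite /cubic exprMn coefXnM ltnn subnn -exprM -horner_coef0.
by rewrite horner_exp !hornerE ?subr0 expr1n.
Qed.

Lemma det_cubic_powers n : \det (basis_mx n n 1 cubic) = 1.
Proof.
rewrite det_trig; last first.
  by apply/is_trig_mxP => i j ij; rewrite mxE mul1r cubicXn_coef.
by rewrite big1 // => i _; rewrite mxE mul1r cubicXn_lead.
Qed.

Definition alternating_mx n (f g : {poly rat}) : 'M[rat]_n :=
  \matrix_(i, k) ((if odd k then g else f) * cubic ^+ k./2)`_i.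

Lemma normr_det_reindex n (F : nat -> nat -> rat) (s : nat -> nat) :
  (forall k, (k < n)%N -> (s k < n)%N) ->
  (forall k l, (k < n)%N -> (l < n)%N -> s k = s l -> k = l) ->
  `|\det (\matrix_(i < n, k < n) F i (s k))| = `|\det (\matrix_(i < n, k < n) F i k)|.
Proof.
move=> sn si; pose t (k : 'I_n) := Ordinal (sn k (ltn_ord k)).
have ti : injective t by move=> k l [] /si e; apply: val_inj; apply: e.
rewrite (_ : (\matrix_(i, k) F i (s k)) = col_perm (perm ti) (\matrix_(i, k) F i k)).
  by rewrite det_col_perm normrM normr_sign mul1r.
by apply/matrixP => i k; rewrite !mxE permE.
Qed.

(** * Factorization over the symplectic matrix by the Sylvester matrix *)

Section Factorization.

Variables (m : nat) (k N : {poly {poly rat}}) (nu1 nu2 e q : {poly rat}).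
Let n := (m + m)%N.
Hypothesis nuN : nu1%:P * nu2^:P - nu2%:P * nu1^:P = ('X - 'X%:P) * N.
Hypothesis kE : congr2 n (cubic_dd * k) (nu1%:P * nu2^:P - nu2%:P * nu1^:P).
Hypothesis se : (size e <= m.+1)%N.
Hypothesis sq : (size q <= m.+1)%N.
Hypothesis pade : forall i, (i < n)%N -> ((e \Po cubic) - 'X * (q \Po cubic))`_i = 0.
Hypothesis q0 : q`_0 != 0.

Let q' := q \Po cubic.

(** The columns of the Sylvester matrix of q and e, ordered so that J pairs q X^(m-1-i) with e
    X^i. *)
Let sylv (c : nat) : {poly rat} := if odd c then e * 'X^(c./2) else q * 'X^(m.-1 - c./2).
Let syl : 'M[rat]_n := \matrix_(r, c) (sylv c)`_r.

(** The factor y^m - x^m does two things: it clears the denominator x - y of the Bezout form, and it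
    places the Bezout matrix in the off-diagonal blocks of a matrix of twice the size. *)
Let bz := bezout e q * ('X^m - 'X%:P ^+ m).

Lemma bezout_symplectic : coef2_mx n bz = syl *m symplectic_mx n *m syl^T.
Proof.
have -> : bz = \sum_(i < m) ((sylv i.*2)%:P * (sylv i.*2.+1)^:P
                            - (sylv i.*2.+1)%:P * (sylv i.*2)^:P).
  rewrite /bz subrXX mulrA [bezout _ _ * _](_ : _ = q%:P * e^:P - e%:P * q^:P); last first.
    by transitivity (- (('X%:P - 'X) * bezout e q)); [ring | rewrite bezoutE; ring].
  rewrite mulrBl !mulr_sumr sumrB; congr (_ - _).
    rewrite (reindex_inj rev_ord_inj); apply: eq_bigr => i _.
    rewrite /sylv /= odd_double /= uphalf_double doubleK.
    rewrite !rmorphM /= !map_polyXn polyC_exp.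
    have -> : (m - i.+1 = m.-1 - i)%N by lia.
    by rewrite subKn; [ring|have := ltn_ord i; lia].
  apply: eq_bigr => i _; rewrite /sylv /= odd_double /= uphalf_double doubleK.
  by rewrite !rmorphM /= !map_polyXn polyC_exp; ring.
apply/matrixP => r s; rewrite mxE mxE 2!coef_sum.
rewrite (eq_bigr (fun i : 'I_m => (sylv i.*2)`_r * (sylv i.*2.+1)`_s
   - (sylv i.*2.+1)`_r * (sylv i.*2)`_s)); last first.
  by move=> i _; rewrite 2!coefB !coefCM !coef_map /= !coefMC.
rewrite -(symplectic_sum_addnn m (fun c => (sylv c)`_r) (fun c => (sylv c)`_s)).
rewrite exchange_big; apply: eq_bigr => d _; rewrite !mxE mulr_suml.
by apply: eq_bigr => c _; rewrite !mxE.
Qed.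

Let wnu : 'M[rat]_(n, m + m) := row_mx (basis_mx n m nu1 cubic) (basis_mx n m nu2 cubic).

Lemma bezout_blocks : coef2_mx (m + m) bz =
  block_mx 0 (coef2_mx m (bezout e q)) (- coef2_mx m (bezout e q)) 0.
Proof.
have bz0 i j : (m <= i)%N || (m <= j)%N -> ((bezout e q)`_j)`_i = 0.
  exact: (bezout_coef0 se sq).
have bzE i j : (bz`_j)`_i = (if (j < m)%N then 0 else ((bezout e q)`_(j - m))`_i)
                          - (if (i < m)%N then 0 else ((bezout e q)`_j)`_(i - m)).
  rewrite /bz; move: (bezout e q) => b; rewrite mulrBr !coefB coefMXn -polyC_exp coefMC coefMXn.
  by case: (j < m)%N; rewrite ?coef0.
apply/matrixP => i j; rewrite mxE bzE.
case: (split_ordP i) => a ->; case: (split_ordP j) => b -> /=.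
- by rewrite block_mxEul mxE subrr.
- by rewrite block_mxEur mxE subr0 addKn.
- by rewrite block_mxEdl !mxE sub0r addKn.
- by rewrite block_mxEdr mxE !addKn !bz0 ?leq_addr ?orbT // subrr.
Qed.

Lemma kernel_congruence :
  toeplitz_mx n q' *m coef2_mx n k *m (toeplitz_mx n q')^T =
  wnu *m coef2_mx (m + m) bz *m wnu^T.
Proof.
rewrite -coef2_mx_conj (congr2_mx (pade_kernel nuN kE pade)) bezout_blocks.
rewrite /wnu tr_row_mx mul_row_block mul_row_col !mulmx0 add0r addr0 mulmxN.
have bz0 i j : (m <= i)%N || (m <= j)%N -> ((bezout e q)`_j)`_i = 0 by exact: (bezout_coef0 se sq).
rewrite addrC mulNmx -!(coef2_mx_subst _ _ _ _ bz0).
apply/matrixP => i j; by rewrite !mxE mulrDr mulrN !coefD !coefN.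
Qed.

Let w1 : 'M[rat]_n :=
  \matrix_(i, c) ((if odd c then 'X * cubic ^+ c./2 else cubic ^+ (m.-1 - c./2))`_i).

(** At z, the Sylvester columns q X^j and e X^j become q(z) z^j and, by the Pade relation modulo
    X^n, q(z) X z^j. *)
Lemma sylvester_det : toeplitz_mx n q' *m w1 = basis_mx n n 1 cubic *m syl.
Proof.
apply/matrixP => i c; rewrite !mxE.
under eq_bigr do rewrite [w1 _ _]mxE.
rewrite (toeplitz_mul q' (if odd c then _ else _)).
transitivity ((sylv c \Po cubic)`_i).
  rewrite /sylv; case: ifP => oc; rewrite comp_polyM comp_Xn_poly //.
  rewrite mulrA -[_ \Po cubic](subrK ('X * q')) mulrDl coefD [X in _ = X + _](_ : _ = 0).
    by rewrite add0r ['X * q']mulrC.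
  rewrite coefM big1 // => l _; rewrite pade ?mul0r //.
  by apply: leq_ltn_trans (ltn_ord i); rewrite -ltnS.
rewrite (@coef_comp_sum n).
  by apply: eq_bigr => l _; rewrite !mxE mul1r.
have cm : (c./2 < m)%N by rewrite ltn_half_double -addnn.
rewrite /sylv; case: ifP => _; apply: leq_trans (size_polyMleq _ _) _;
  rewrite size_polyXn addnS /=.
  by move: (size e) se => s; rewrite /n; lia.
by move: (size q) sq => s; rewrite /n; lia.
Qed.

Lemma normr_det_w1 : `|\det w1| = `|\det (alternating_mx n 1 'X)|.
Proof.
pose s (c : nat) := if odd c then c else (m.-1 - c./2).*2.
have odd_n : odd n = false by rewrite /n addnn odd_double.
rewrite -(@normr_det_reindex n (fun i k => ((if odd k then 'X else 1) * cubic ^+ k./2)`_i) s).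
- congr `|\det _|; apply/matrixP => i c; rewrite !mxE /s.
  by case: ifP => oc; rewrite ?oc // odd_double doubleK mul1r.
- by rewrite /n /s => c; case: ifP => _; lia.
- rewrite /n /s => c d hc hd.
  have := odd_double_half c; have := odd_double_half d.
  by case: (odd c); case: (odd d); rewrite -!mul2n; lia.
Qed.

Lemma normr_det_wnu : `|\det wnu| = `|\det (alternating_mx n nu1 nu2)|.
Proof.
pose s (c : nat) := if (c < m)%N then c.*2 else (c - m).*2.+1.
rewrite -(@normr_det_reindex n (fun i k => ((if odd k then nu2 else nu1) * cubic ^+ k./2)`_i) s).
- congr `|\det _|; apply/matrixP => i c; rewrite /wnu [RHS]mxE /s.
  case: (split_ordP c) => a ->.
    by rewrite row_mxEl mxE /= ?ltn_ord odd_double doubleK.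
  by rewrite row_mxEr mxE /= ?ltnNge ?leq_addr /= addKn odd_double /= ?uphalf_double.
- by rewrite /n /s => c; case: (ltnP c m); rewrite -!mul2n; lia.
- by rewrite /n /s => c d; case: (ltnP c m); case: (ltnP d m); rewrite -!mul2n; lia.
Qed.

(** C is the inverse Toeplitz matrix of q(z), times the columns nu1 z^k and nu2 z^k, times the
    Sylvester matrix. By [sylvester_det] the Toeplitz determinant cancels, so that e and q leave no
    trace in det C. *)
Lemma kernel_factorization :
  \det (alternating_mx n nu1 nu2) != 0 -> \det (alternating_mx n 1 'X) != 0 ->
  exists2 c : 'M[rat]_n, coef2_mx n k = c *m symplectic_mx n *m c^T &
    c \in unitmx /\
    `|\det c| = `|\det (alternating_mx n nu1 nu2)| * `|\det (alternating_mx n 1 'X)|.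
Proof.
move=> dnu d1; set tq := toeplitz_mx n q'.
have utq : tq \in unitmx.
  rewrite unitmxE unitfE det_toeplitz expf_neq0 //.
  have c0 : cubic.[0] = 0 by rewrite /cubic hornerM hornerX mul0r.
  by rewrite /q' -horner_coef0 horner_comp c0 horner_coef0.
have dtq : \det tq != 0 by rewrite -unitfE -unitmxE.
have dsyl : \det tq * \det w1 = \det syl.
  by rewrite -det_mulmx sylvester_det det_mulmx det_cubic_powers mul1r.
have dc : \det (invmx tq *m wnu *m syl) = \det wnu * \det w1.
  by rewrite !det_mulmx det_inv -dsyl; field.
exists (invmx tq *m wnu *m syl); last first.
  have e0 : `|\det (invmx tq *m wnu *m syl)| =
      `|\det (alternating_mx n nu1 nu2)| * `|\det (alternating_mx n 1 'X)|.
    by rewrite dc normrM normr_det_w1 normr_det_wnu.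
  split=> //; rewrite unitmxE unitfE -normr_gt0 e0 mulr_gt0 // normr_gt0 //.
have ut : tq^T \in unitmx by rewrite unitmx_tr.
have -> : coef2_mx n k = invmx tq *m (tq *m coef2_mx n k *m tq^T) *m invmx tq^T.
  by rewrite !mulmxA mulVmx // mul1mx mulmxK.
by rewrite kernel_congruence bezout_symplectic !trmx_mul trmx_inv !mulmxA.
Qed.

End Factorization.

(** * Existence of the Pade approximation *)

Definition alternating_seq (f g : {poly rat}) k : {poly rat} :=
  (if odd k then g else f) * cubic ^+ k./2.

Lemma alternating_seqSS f g k :
  alternating_seq f g k.+2 = cubic * alternating_seq f g k.
Proof. by rewrite /alternating_seq /= negbK exprS mulrCA. Qed.

Lemma coef_mul_eq0 n (g d : {poly rat}) :
  g`_0 != 0 -> (forall i, (i < n)%N -> (g * d)`_i = 0) ->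
  forall i, (i < n)%N -> d`_i = 0.
Proof.
move=> g0 h; elim/ltn_ind => i IH hi.
have := h i hi; rewrite coefM big_ord_recl /= subn0 big1 ?addr0.
  by move/eqP; rewrite mulf_eq0 (negPf g0) => /eqP.
move=> l _; rewrite IH ?mulr0 //=; first by rewrite /bump /=; have := ltn_ord l; lia.
by apply: leq_ltn_trans hi; rewrite leq_subr.
Qed.

(* If q vanished at 0, the relation between e and q could be divided by the   *)
(* cubic, against the independence of fewer columns.                          *)
Lemma pade_exists m :
  (forall N, \det (alternating_mx N 1 'X) != 0) ->
  exists e q : {poly rat}, [/\ (size e <= m.+2)%N, (size q <= m.+2)%N,
    forall i, (i < m.+1 + m.+1)%N -> ((e \Po cubic) - 'X * (q \Po cubic))`_i = 0 &
    q`_0 != 0].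
Proof.
move=> dN; set n := (m.+1 + m.+1)%N; pose w := alternating_seq 1 'X.
have n2 : n = m.*2.+2 by rewrite /n -addnn; lia.
have uA N : alternating_mx N 1 'X \in unitmx by rewrite unitmxE unitfE.
(* Column n = 2(m + 1) is z^(m+1). Solving for it in terms of the n columns before it, the even
   coefficients give e and the odd ones q. *)
pose al_vec := invmx (alternating_mx n 1 'X) *m (\col_i (w n)`_i).
pose al k := if insub k is Some o then al_vec o 0 else 0.
have alE (o : 'I_n) : al o = al_vec o 0 by rewrite /al valK.
have wn i : (i < n)%N -> (w n - \sum_(k < n) al k *: w k)`_i = 0.
  move=> hi; rewrite coefB coef_sum; apply/eqP; rewrite subr_eq0; apply/eqP.
  have /matrixP/(_ (Ordinal hi) 0) : alternating_mx n 1 'X *m al_vec = \col_i (w n)`_i.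
    by rewrite /al_vec mulmxA mulmxV // mul1mx.
  rewrite !mxE => <-; apply: eq_bigr => k _.
  by rewrite coefZ alE mxE mulrC.
exists ('X^(m.+1) - \poly_(l < m.+1) al l.*2), (\poly_(l < m.+1) al l.*2.+1).
have comp_poly_sum (F : nat -> rat) : (\poly_(l < m.+1) F l) \Po cubic = \sum_(l < m.+1) F l *: cubic ^+ l.
  rewrite poly_def raddf_sum; apply: eq_bigr => l _.
  by rewrite /= comp_polyZ comp_Xn_poly.
split.
- apply: leq_trans (size_polyD _ _) _; rewrite geq_max size_polyXn leqnn size_polyN.
  exact: leq_trans (size_poly _ _) _.
- exact: leq_trans (size_poly _ _) _.
- move=> i hi; rewrite -[RHS](wn i hi); congr (_`_i).
  rewrite comp_polyB comp_Xn_poly !comp_poly_sum mulr_sumr.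
  have we l : w l.*2 = cubic ^+ l by rewrite /w /alternating_seq odd_double doubleK mul1r.
  have wo l : w l.*2.+1 = 'X * cubic ^+ l.
    by rewrite /w /alternating_seq /= odd_double /= uphalf_double.
  rewrite [in RHS]n2 -doubleS we (sum_double m.+1 (fun k => al k *: w k)) -addrA -opprD.
  rewrite [in RHS](eq_bigr (fun l : 'I_m.+1 =>
    al l.*2 *: cubic ^+ l + 'X * (al l.*2.+1 *: cubic ^+ l))) ?big_split // => l _.
  by rewrite we wo scalerAr.
rewrite coef_poly /=; apply/eqP => al1.
have w0 l : (w l.+2)`_0 = 0.
  by rewrite /w alternating_seqSS coef0M /cubic coef0M coefX !mul0r.
have al0 : al 0%N = 0.
  have := wn 0%N isT; rewrite coefB coef_sum n2 w0 sub0r => /eqP.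
  rewrite oppr_eq0 !big_ord_recl big1 => [|l _]; last by rewrite coefZ w0 mulr0.
  by rewrite !coefZ al1 mul0r !addr0 /w /alternating_seq mulr1 coef1 mulr1 => /eqP.
(* Division by z costs one power of X and two columns, leaving a dependence among 2m + 1 columns
   modulo X^(2m+1). *)
pose d := w m.*2 - \sum_(k < m.*2) al k.+2 *: w k.
have cd : cubic * d = w n - \sum_(k < n) al k *: w k.
  rewrite n2 !big_ord_recl al0 al1 !scale0r !add0r /w alternating_seqSS /d mulrBr mulr_sumr.
  congr (_ - _); apply: eq_bigr => k _; rewrite /= /bump /= !add1n alternating_seqSS.
  by rewrite -scalerAr.
have d0 i : (i < m.*2.+1)%N -> d`_i = 0.
  apply: (@coef_mul_eq0 _ ((1 - 'X) ^+ 2)).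
    by rewrite -horner_coef0 !hornerE ?expr1n ?oner_eq0.
  move=> l hl; have := wn l.+1; rewrite -cd /cubic -mulrA coefXM /= => -> //.
  by rewrite n2.
pose b : 'cV[rat]_(m.*2.+1) := \col_k (if (k < m.*2)%N then - al k.+2 else 1).
have Ab : alternating_mx m.*2.+1 1 'X *m b = 0.
  apply/matrixP => i j; rewrite !mxE -[RHS](d0 i) // /d.
  rewrite coefB coef_sum big_ord_recr /= !mxE ltnn mulr1 addrC; congr (_ + _).
  rewrite -sumrN; apply: eq_bigr => k _.
  by rewrite !mxE /= ltn_ord coefZ mulrN mulrC.
have /matrixP/(_ ord_max 0) : b = 0 by rewrite -[b](mulKmx (uA _)) Ab mulmx0.
by rewrite !mxE ltnn => /eqP; rewrite oner_eq0.
Qed.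

Theorem normr_minor_sum_kernel m M (T : 'M[rat]_(m + m, M)) (k N : {poly {poly rat}})
    (nu1 nu2 : {poly rat}) :
  (forall N, \det (alternating_mx N 1 'X) != 0) ->
  \det (alternating_mx (m + m) nu1 nu2) != 0 ->
  nu1%:P * nu2^:P - nu2%:P * nu1^:P = ('X - 'X%:P) * N ->
  congr2 (m + m) (cubic_dd * k) (nu1%:P * nu2^:P - nu2%:P * nu1^:P) ->
  T *m order_sign_mx M *m T^T = coef2_mx (m + m) k ->
  `|minor_sum T| = `|\det (alternating_mx (m + m) nu1 nu2)|
                   * `|\det (alternating_mx (m + m) 1 'X)|.
Proof.
case: m T => [|m] T dN dnu hN hk hT.
  rewrite !det_mx00 !normr1 mulr1.
  by rewrite (@minor_sum_symplectic 0) ?normr1 //; apply/matrixP => -[].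
have [e [q [se sq pade q0]]] := pade_exists m dN.
have [c ec [uc <-]] := kernel_factorization hN hk se sq pade q0 dnu (dN _).
rewrite (_ : minor_sum T = \det c) //.
move: T c hT ec uc; rewrite addnn => T c hT ec uc.
by apply: (minor_sum_congruent uc); rewrite hT ec.
Qed.

(** * Determinants of Chebyshev type *)

(** Row i holds the values at the x k of a monic polynomial of degree i, up to the scalars; passing
    to monomials is unitriangular and leaves a Vandermonde matrix. *)
Lemma det_newton N (h g x b : nat -> rat) :
  \det (\matrix_(i < N, k < N) (h i * g k * \prod_(l < i) (x k - b l))) =
  \prod_(k < N) (h k * g k * \prod_(i < k) (x k - x i)).
Proof.
pose p i : {poly rat} := \prod_(l < i) ('X - (b l)%:P).
have pm i : p i \is monic by apply: monic_prod_XsubC.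
have ps i : size (p i) = i.+1 by rewrite size_prod_XsubC /index_enum -enumT size_enum_ord.
pose c : 'M[rat]_N := \matrix_(i, j) (p i)`_j.
pose v := Vandermonde N (\row_(k < N) x k).
have -> : (\matrix_(i < N, k < N) (h i * g k * \prod_(l < i) (x k - b l))) =
   diag_mx (\row_i h i) *m (c *m v) *m diag_mx (\row_k g k).
  apply/matrixP => i k; rewrite mul_mx_diag mul_diag_mx !mxE.
  rewrite mulrAC; congr (_ * _ * _); rewrite -[LHS](_ : (p i).[x k] = _).
    rewrite (horner_coef_wide _ (n := N)) ?ps //.
    by apply: eq_bigr => j _; rewrite !mxE.
  by rewrite horner_prod; apply: eq_bigr => l _; rewrite hornerXsubC.
rewrite !det_mulmx !det_diag det_Vandermonde.
rewrite [X in _ * (X * _)](_ : _ = 1) ?mul1r; last first.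
  rewrite det_trig; last first.
    by apply/is_trig_mxP => i j ij; rewrite mxE nth_default // ps.
  rewrite big1 // => i _; rewrite mxE; have /monicP := pm i.
  by rewrite lead_coefE ps.
rewrite mulrAC [RHS]big_split big_split /=; congr (_ * _ * _).
- by apply: eq_bigr => i _; rewrite mxE.
- by apply: eq_bigr => i _; rewrite mxE.
rewrite (exchange_big_dep xpredT) //=; apply: eq_bigr => k _.
rewrite (big_ord_widen N (fun i => x k - x i) (ltnW (ltn_ord k))).
by apply: eq_bigr => i _; rewrite !mxE.
Qed.

Definition in_span (w : nat -> {poly rat}) k (p : {poly rat}) :=
  exists t : nat -> rat, p = \sum_(l < k) t l *: w l.

Lemma in_spanD w k p r : in_span w k p -> in_span w k r -> in_span w k (p + r).
Proof.
move=> [t ->] [s ->]; exists (fun l => t l + s l).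
by rewrite -big_split; apply: eq_bigr => l _; rewrite scalerDl.
Qed.

Lemma in_spanZ w k a p : in_span w k p -> in_span w k (a *: p).
Proof.
move=> [t ->]; exists (fun l => a * t l).
by rewrite scaler_sumr; apply: eq_bigr => l _; rewrite scalerA.
Qed.

Lemma in_span_mem w k l : (l < k)%N -> in_span w k (w l).
Proof.
move=> lk; exists (fun j => (j == l)%:R).
rewrite (bigD1 (Ordinal lk)) //= eqxx scale1r big1 ?addr0 // => j /eqP jl.
by case: eqP => [e|]; [case: jl; apply: val_inj | rewrite scale0r].
Qed.

Lemma in_span_widen w k k' p : (k <= k')%N -> in_span w k p -> in_span w k' p.
Proof.
move=> kk [t ->]; exists (fun l => if (l < k)%N then t l else 0).
rewrite (big_ord_widen k' (fun l => t l *: w l) kk) big_mkcond.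
by apply: eq_bigr => l _; case: ifP; rewrite ?scale0r.
Qed.

Lemma in_span_cubic f g k p :
  in_span (alternating_seq f g) k p -> in_span (alternating_seq f g) k.+2 (cubic * p).
Proof.
move=> [t ->]; exists (fun l => if l is j.+2 then t j else 0).
rewrite !big_ord_recl /= !scale0r !add0r mulr_sumr; apply: eq_bigr => l _.
by rewrite /bump /= !add1n alternating_seqSS -scalerAr.
Qed.

(** If 2 - 3X = t + 1/t, this is t^3 + t^-3 (see [cheb3E]). *)
Definition cheb3 : {poly rat} := 2 - 27%:R *: cubic.

(** By the recurrence, p k is a known multiple of the k-th of the columns f, g, z f, z g, ... plus
    earlier ones: each step by two multiplies by -27 z up to earlier columns. *)
Lemma det_alternating_triangular N (p : nat -> {poly rat}) (f g : {poly rat}) (l0 l1 : rat) :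
  p 0%N = l0 *: f ->
  in_span (alternating_seq f g) 1 (p 1%N - l1 *: g) ->
  in_span (alternating_seq f g) 2 (p 2 - cheb3 * p 0%N) ->
  in_span (alternating_seq f g) 2 (p 3 - cheb3 * p 1%N) ->
  (forall k, p k.+4 = cheb3 * p k.+2 - p k) ->
  \det (\matrix_(i < N, k < N) (p k)`_i) =
  (\prod_(k < N) ((if odd k then l1 else l0) * (- 27%:R) ^+ k./2)) * \det (alternating_mx N f g).
Proof.
move=> h0 h1 h2 h3 hS; set w := alternating_seq f g in h1 h2 h3.
pose ld k : rat := (if odd k then l1 else l0) * (- 27%:R) ^+ k./2.
have ldSS k : ld k.+2 = - 27%:R * ld k by rewrite /ld /= negbK exprS mulrCA.
have step k r : in_span w k (p k - ld k *: w k) -> in_span w k.+2 (r - cheb3 * p k) ->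
    in_span w k.+2 (r - ld k.+2 *: w k.+2).
  move=> hk hr; rewrite ldSS /w alternating_seqSS -/w.
  rewrite (_ : _ - _ = (r - cheb3 * p k) + (2 *: (p k - ld k *: w k) + ((2 * ld k) *: w k +
     (- 27%:R) *: (cubic * (p k - ld k *: w k))))); last first.
    by rewrite /cheb3 -!mul_polyC !rmorphM !rmorphN /= !rmorph_nat; ring.
  apply: in_spanD => //; apply: in_spanD; first by apply/in_spanZ/(in_span_widen _ hk); lia.
  apply: in_spanD; first by apply/in_spanZ/in_span_mem.
  by apply/in_spanZ/in_span_cubic.
have main k : in_span w k (p k - ld k *: w k).
  suff H : in_span w k (p k - ld k *: w k) /\ in_span w k.+1 (p k.+1 - ld k.+1 *: w k.+1) /\
     in_span w k.+2 (p k.+2 - ld k.+2 *: w k.+2) /\ in_span w k.+3 (p k.+3 - ld k.+3 *: w k.+3) by case: H.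
  elim: k => [|k [i0 [i1 [i2 i3]]]].
    have i0 : in_span w 0 (p 0%N - ld 0%N *: w 0%N).
      exists (fun=> 0); rewrite big_ord0 h0 /ld /w /alternating_seq /= expr0 !mulr1; exact: subrr.
    have i1 : in_span w 1 (p 1%N - ld 1%N *: w 1%N).
      by move: h1; rewrite /ld /w /alternating_seq /= expr0 !mulr1.
    split=> //; split=> //; split; first exact: step.
    by apply: step => //; apply: in_span_widen h3.
  split=> //; split=> //; split=> //; apply: step => //.
  rewrite hS (_ : _ - _ = (-1) *: (p k - ld k *: w k) + (- ld k) *: w k).
    apply: in_spanD; first by apply/in_spanZ/(in_span_widen _ i0); lia.
    by apply/in_spanZ/in_span_mem; lia.
  by rewrite -!mul_polyC !rmorphN /= !rmorph1; ring.
have /fin_all_exists [t tE] : forall k : 'I_N, exists t : nat -> rat,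
    p k - ld k *: w k = \sum_(l < k) t l *: w l by move=> k; exact: main.
pose u : 'M[rat]_N := \matrix_(l, k) (if (l < k)%N then t k l else if l == k then ld k else 0).
have -> : (\matrix_(i < N, k < N) (p k)`_i) = alternating_mx N f g *m u.
  apply/matrixP => i k; rewrite !mxE -[p k](subrK (ld k *: w k)) tE.
  rewrite coefD coef_sum coefZ addrC (bigD1 k) //= !mxE ltnn eqxx mulrC; congr (_ + _).
  rewrite (big_ord_widen N (fun l => (t k l *: w l)`_i) (ltnW (ltn_ord k))).
  rewrite [RHS](bigID (fun l : 'I_N => (l < k)%N)) /= [X in _ + X]big1 ?addr0.
    apply: eq_big => [l|l lk]; last by rewrite !mxE lk coefZ mulrC.
    by case: ltngtP; rewrite ?andbT ?andbF // => lk; apply/esym/eqP => e; rewrite e ltnn in lk.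
  by move=> l /andP[lk /negPf nlk]; rewrite !mxE nlk (negPf lk) mulr0.
rewrite det_mulmx mulrC; congr (_ * _); rewrite -det_tr det_trig.
  by apply: eq_bigr => k _; rewrite !mxE ltnn eqxx.
apply/is_trig_mxP => i j ij; rewrite !mxE ltnNge ltnW //=.
by case: eqP => // e; rewrite e ltnn in ij.
Qed.

Definition cheb1 : {poly rat} := 2 - 3%:R *: 'X.

Fixpoint cheb (p0 p1 : {poly rat}) n : {poly rat} :=
  match n with
  | 0 => p0
  | n'.+1 => match n' with 0 => p1 | n''.+1 => cheb1 * cheb p0 p1 n' - cheb p0 p1 n'' end
  end.

Lemma chebSS p0 p1 n : cheb p0 p1 n.+2 = cheb1 * cheb p0 p1 n.+1 - cheb p0 p1 n.
Proof. by []. Qed.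

Lemma cheb3E : cheb3 = cheb1 ^+ 3 - 3 * cheb1.
Proof.
rewrite /cheb3 /cheb1 /cubic -!mul_polyC !rmorph_nat; ring.
Qed.

(** Advancing the index by 3 amounts to replacing t by t^3. *)
Lemma cheb_add6 p0 p1 n :
  cheb p0 p1 n.+3.+3 = cheb3 * cheb p0 p1 n.+3 - cheb p0 p1 n.
Proof. rewrite cheb3E !chebSS; ring. Qed.

(** With [cheb1] = t + 1/t, the three families are (t^n - t^-n) / (t - t^-1), t^n + t^-n, and the
    sum of t^j over -n <= j <= n. *)
Definition chebU := cheb 0 1.
Definition chebE := cheb 2 cheb1.
Definition chebO := cheb 1 (cheb1 + 1).

Lemma chebE_U n : chebE n.+1 = chebU n.+2 - chebU n.
Proof.
rewrite /chebE /chebU; have [] : cheb 2 cheb1 n.+1 = cheb 0 1 n.+2 - cheb 0 1 n /\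
  cheb 2 cheb1 n.+2 = cheb 0 1 n.+3 - cheb 0 1 n.+1; last by [].
elim: n => [|n [IH1 IH2]]; first by rewrite /=; split; ring.
by split=> //; rewrite chebSS IH1 IH2 !chebSS; ring.
Qed.

Lemma chebO_U n : chebO n = chebU n.+1 + chebU n.
Proof.
rewrite /chebO /chebU; have [] : cheb 1 (cheb1 + 1) n = cheb 0 1 n.+1 + cheb 0 1 n /\
  cheb 1 (cheb1 + 1) n.+1 = cheb 0 1 n.+2 + cheb 0 1 n.+1; last by [].
elim: n => [|n [IH1 IH2]]; first by rewrite /=; split; ring.
by split=> //; rewrite chebSS IH1 IH2 !chebSS; ring.
Qed.

Lemma coef_cheb1M p i :
  (cheb1 * p)`_i = 2 * p`_i - 3%:R * (if i is j.+1 then p`_j else 0).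
Proof.
rewrite /cheb1 mulrBl coefB -scalerAl coefZ coefXM -[2 : {poly rat}](rmorph_nat polyC) coefCM.
by case: i.
Qed.

Lemma coef_chebU n i : (chebU n)`_i = (- 3%:R) ^+ i * 'C(n + i, i.*2.+1)%:R.
Proof.
rewrite /chebU; have [] : (cheb 0 1 n)`_i = (- 3%:R) ^+ i * 'C(n + i, i.*2.+1)%:R /\
  (cheb 0 1 n.+1)`_i = (- 3%:R) ^+ i * 'C(n.+1 + i, i.*2.+1)%:R; last by [].
elim: n i => [|n IH] i.
  split; rewrite /= ?coef0 ?coef1 ?add0n.
    by rewrite bin_small ?mulr0 // -addnn; lia.
  case: i => [|i]; first by rewrite expr0 mul1r.
  by rewrite bin_small ?mulr0 // -addnn; lia.
split; first by case: (IH i).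
rewrite chebSS coefB coef_cheb1M; case: (IH i) => -> ->.
case: i => [|i]; first by rewrite !expr0 !addn0 !bin1 mulr0 subr0 -[n.+2]addn2 -[n.+1]addn1 !natrD; ring.
case: (IH i) => _ ->; rewrite !addSn !addnS doubleS.
move: (n + i)%N i.*2 => a d.
have e1 : 'C(a.+3, d.+3) = ('C(a.+2, d.+3) + 'C(a.+2, d.+2))%N by rewrite binS.
have e2 : 'C(a.+2, d.+3) = ('C(a.+1, d.+3) + 'C(a.+1, d.+2))%N by rewrite binS.
have e3 : 'C(a.+2, d.+2) = ('C(a.+1, d.+2) + 'C(a.+1, d.+1))%N by rewrite binS.
by rewrite e1 e2 e3 !natrD !exprS; ring.
Qed.

Lemma ffact_natrS n m : (n ^_ m.+1)%:R = (n ^_ m)%:R * (n%:R - m%:R) :> rat.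
Proof.
rewrite ffactnSr natrM; case: (leqP m n) => h; first by rewrite natrB.
by rewrite ffact_small // !mul0r.
Qed.

(** As a function of n the coefficient is n times a Newton product in n^2, the shape that
    [det_newton] needs. *)
Lemma newton_bin_odd n i :
  'C(n + i, i.*2.+1)%:R = n%:R * \prod_(l < i) (n%:R ^+ 2 - l.+1%:R ^+ 2) / (i.*2.+1)`!%:R :> rat.
Proof.
have -> : 'C(n + i, i.*2.+1)%:R = ((n + i) ^_ i.*2.+1)%:R / (i.*2.+1)`!%:R :> rat.
  by rewrite -bin_ffact natrM mulfK // pnatr_eq0 -lt0n fact_gt0.
congr (_ / _); elim: i => [|i IH]; first by rewrite addn0 ffactn1 big_ord0 mulr1.
rewrite addnS doubleS ffactSS natrM ffact_natrS IH big_ord_recr /=.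
rewrite -[(n + i).+1]addn1 -addnn -[(i + i).+1]addn1 -[i.+1]addn1 !natrD; ring.
Qed.

(** Neither term is even in n + 1. Multiplied by n + 1, they are n + 1 + i and n + 1 - i times the
    same even product, and the odd parts cancel in the sum. *)
Lemma newton_bin_even n i :
  'C(n.+1 + i, i.*2)%:R + 'C(n + i, i.*2)%:R =
  2 * \prod_(l < i) (n.+1%:R ^+ 2 - l%:R ^+ 2) / (i.*2)`!%:R :> rat.
Proof.
have E a : 'C(a, i.*2)%:R = (a ^_ i.*2)%:R / (i.*2)`!%:R :> rat.
  by rewrite -bin_ffact natrM mulfK // pnatr_eq0 -lt0n fact_gt0.
rewrite !E -mulrDl; congr (_ / _).
have n0 : n.+1%:R != 0 :> rat by rewrite pnatr_eq0.
apply: (mulfI n0).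
have H1 j : n.+1%:R * ((n.+1 + j) ^_ j.*2)%:R =
    (n.+1%:R + j%:R) * \prod_(l < j) (n.+1%:R ^+ 2 - l%:R ^+ 2) :> rat.
  elim: j => [|j IH]; first by rewrite addn0 ffactn0 big_ord0 addr0.
  rewrite addnS doubleS ffactSS natrM ffact_natrS mulrCA [n.+1%:R * (_ * _)]mulrA IH big_ord_recr /=.
  rewrite -[(n.+1 + j).+1]addn1 -addnn -[j.+1]addn1 !natrD; ring.
have H2 j : n.+1%:R * ((n + j) ^_ j.*2)%:R =
    (n.+1%:R - j%:R) * \prod_(l < j) (n.+1%:R ^+ 2 - l%:R ^+ 2) :> rat.
  elim: j => [|j IH]; first by rewrite addn0 ffactn0 big_ord0 subr0.
  rewrite addnS doubleS ffactSS natrM ffact_natrS mulrCA [n.+1%:R * (_ * _)]mulrA IH big_ord_recr /=.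
  rewrite -[(n + j).+1]addn1 -addnn -[j.+1]addn1 -[n.+1]addn1 !natrD; ring.
by rewrite mulrDr H1 H2; ring.
Qed.

Lemma newton_bin_sum n i :
  'C(n.+1 + i, i.*2.+1)%:R + 'C(n + i, i.*2.+1)%:R =
  n.*2.+1%:R * \prod_(l < i) ((n * n.+1)%:R - (l * l.+1)%:R) / (i.*2.+1)`!%:R :> rat.
Proof.
rewrite !newton_bin_odd -mulrDl; congr (_ / _).
have H1 j : n.+1%:R * \prod_(l < j) (n.+1%:R ^+ 2 - l.+1%:R ^+ 2) =
    (n%:R + j.+1%:R) * \prod_(l < j) ((n * n.+1)%:R - (l * l.+1)%:R) :> rat.
  elim: j => [|j IH]; first by rewrite !big_ord0 !mulr1 -natrD addn1.
  rewrite !big_ord_recr /= mulrA IH !natrM -[j.+2]addn2 -[j.+1]addn1 -[n.+1]addn1 !natrD; ring.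
have H2 j : n%:R * \prod_(l < j) (n%:R ^+ 2 - l.+1%:R ^+ 2) =
    (n%:R - j%:R) * \prod_(l < j) ((n * n.+1)%:R - (l * l.+1)%:R) :> rat.
  elim: j => [|j IH]; first by rewrite !big_ord0 !mulr1 subr0.
  rewrite !big_ord_recr /= mulrA IH !natrM -[j.+1]addn1 -[n.+1]addn1 !natrD; ring.
rewrite H1 H2 -addnn -[(n + n).+1]addn1 -[i.+1]addn1 !natrD; ring.
Qed.

Lemma coef_chebE n i : (chebE n.+1)`_i =
  (- 3%:R) ^+ i * (2 * \prod_(l < i) (n.+1%:R ^+ 2 - l%:R ^+ 2) / (i.*2)`!%:R).
Proof.
rewrite chebE_U coefB !coef_chebU -mulrBr -newton_bin_even; congr (_ * _).
rewrite !addSn !binS.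
by rewrite !natrD; ring.
Qed.

Lemma coef_chebO n i : (chebO n)`_i = (- 3%:R) ^+ i *
  (n.*2.+1%:R * \prod_(l < i) ((n * n.+1)%:R - (l * l.+1)%:R) / (i.*2.+1)`!%:R).
Proof. by rewrite chebO_U coefD !coef_chebU -mulrDr -newton_bin_sum. Qed.

Definition prog3 s n : rat := \prod_(i < n) (3 * i + s)%:R.

Lemma prog3S s n : prog3 s n.+1 = prog3 s n * (3 * n + s)%:R.
Proof. by rewrite /prog3 big_ord_recr. Qed.

Lemma prod_double m (F : nat -> rat) :
  \prod_(c < m.*2) F c = \prod_(i < m) (F i.*2 * F i.*2.+1).
Proof.
by elim: m => [|m IH]; rewrite ?big_ord0 // doubleS !big_ord_recr /= IH mulrA.
Qed.

Lemma prod_mirror l (F : nat -> rat) :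
  \prod_(i < l) (F (l - i.+1)%N * F (l + i)%N) = \prod_(i < l.*2) F i.
Proof.
rewrite big_split /= -addnn big_split_ord /=; congr (_ * _).
by rewrite (reindex_inj rev_ord_inj); apply: eq_bigr => i _; congr F; have := ltn_ord i; rewrite /=; lia.
Qed.

Lemma prog3_mirror s l :
  \prod_(i < l) ((3 * (l - i.+1) + s)%:R * (3 * (l + i) + s)%:R : rat) = prog3 s l.*2.
Proof. exact: (prod_mirror l (fun i => (3 * i + s)%:R)). Qed.

Lemma prog3_mirrorS s l :
  s%:R * \prod_(i < l) ((3 * (l - i) + s)%:R * (3 * (l.+1 + i) + s)%:R : rat) = prog3 s l.*2.+1.
Proof.
rewrite /prog3 big_ord_recl /= muln0 add0n; congr (_ * _).
rewrite -(prod_mirror l (fun i => (3 * i.+1 + s)%:R)); apply: eq_bigr => i _.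
by rewrite subnSK ?ltn_ord // addSn.
Qed.

(* The numbers 1, 2, 4, 5, 7, ... prime to 3.                                 *)
Definition kap k := (k + k./2).+1.

Lemma kap_double l : kap l.*2 = (3 * l + 1)%N.
Proof. rewrite /kap doubleK; lia. Qed.

Lemma kap_doubleS l : kap l.*2.+1 = (3 * l + 2)%N.
Proof. rewrite /kap /= uphalf_double; lia. Qed.

(** Each factor is a difference times a sum; two consecutive factors run through both progressions
    modulo 3, collected by [prog3_mirror]. *)
Lemma kap_prod_double l :
  \prod_(i < l.*2) ((kap l.*2)%:R ^+ 2 - (kap i)%:R ^+ 2 : rat) =
  prog3 2 l.*2 * prog3 3 l.*2.
Proof.
rewrite (prod_double _ (fun i => (kap l.*2)%:R ^+ 2 - (kap i)%:R ^+ 2)).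
rewrite -!prog3_mirror -big_split; apply: eq_bigr => i _ /=.
have il : (i.+1 <= l)%N by [].
rewrite !kap_double kap_doubleS !(natrM, natrD) natrB // -[i.+1]addn1 !(natrM, natrD); ring.
Qed.

Lemma kap_prod_doubleS l :
  \prod_(i < l.*2.+1) ((kap l.*2.+1)%:R ^+ 2 - (kap i)%:R ^+ 2 : rat) =
  prog3 1 l.*2.+1 * prog3 3 l.*2.+1.
Proof.
rewrite big_ord_recr /= (prod_double _ (fun i => (kap l.*2.+1)%:R ^+ 2 - (kap i)%:R ^+ 2)).
rewrite [prog3 3 _]prog3S -prog3_mirrorS -prog3_mirror mul1r mulrA -big_split; congr (_ * _).
  apply: eq_bigr => i _ /=; have il : (i.+1 <= l)%N by [].
  have il' : (i <= l)%N by apply: ltnW.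
  rewrite kap_double !kap_doubleS !(natrM, natrD) !natrB // -[i.+1]addn1 -[l.+1]addn1 !natrD; ring.
rewrite kap_double kap_doubleS -addnn !(natrM, natrD); ring.
Qed.

(* The numbers 0, 2, 3, 5, 6, ... not congruent to 1 modulo 3.                *)
Definition iot k := (k + uphalf k)%N.

Lemma iot_double l : iot l.*2 = (3 * l)%N.
Proof. rewrite /iot uphalf_double; lia. Qed.

Lemma iot_doubleS l : iot l.*2.+1 = (3 * l + 2)%N.
Proof. rewrite /iot /= doubleK; lia. Qed.

Lemma iot_prod_double l :
  \prod_(i < l.*2) ((iot l.*2 * (iot l.*2).+1)%:R - (iot i * (iot i).+1)%:R : rat) =
  prog3 1 l.*2 * prog3 3 l.*2.
Proof.
rewrite (prod_double _ (fun i => (iot l.*2 * (iot l.*2).+1)%:R - (iot i * (iot i).+1)%:R)).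
rewrite -!prog3_mirror -big_split; apply: eq_bigr => i _ /=.
have il : (i.+1 <= l)%N by [].
rewrite !iot_double iot_doubleS -![(_ + _).+1]addn1 -?[(_ * _).+1]addn1.
rewrite !(natrM, natrD) natrB // -[i.+1]addn1 !(natrM, natrD); ring.
Qed.

Lemma iot_prod_doubleS l :
  \prod_(i < l.*2.+1) ((iot l.*2.+1 * (iot l.*2.+1).+1)%:R - (iot i * (iot i).+1)%:R : rat) =
  prog3 2 l.*2.+1 * prog3 3 l.*2.+1.
Proof.
rewrite big_ord_recr /= (prod_double _ (fun i => (iot l.*2.+1 * (iot l.*2.+1).+1)%:R - (iot i * (iot i).+1)%:R)).
rewrite [prog3 3 _]prog3S -prog3_mirrorS -prog3_mirror.
rewrite [RHS](_ : _ = (\prod_(i < l) ((3 * (l - i) + 2)%:R * (3 * (l.+1 + i) + 2)%:R) *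
   \prod_(i < l) ((3 * (l - i.+1) + 3)%:R * (3 * (l + i) + 3)%:R)) * (2 * (3 * l.*2 + 3)%:R)); last by ring.
rewrite -big_split; congr (_ * _).
  apply: eq_bigr => i _ /=; have il : (i.+1 <= l)%N by [].
  have il' : (i <= l)%N by apply: ltnW.
  rewrite iot_double !iot_doubleS -![(_ + _).+1]addn1 -?[(_ * _).+1]addn1.
  rewrite !(natrM, natrD) !natrB // -[i.+1]addn1 -[l.+1]addn1 !natrD; ring.
rewrite iot_double iot_doubleS -![(_ + _).+1]addn1 -?[(_ * _).+1]addn1 -addnn !(natrM, natrD); ring.
Qed.

Lemma prog3_3 n : prog3 3 n = 3 ^+ n * n`!%:R.
Proof.
elim: n => [|n IH]; first by rewrite /prog3 big_ord0 mulr1.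
rewrite prog3S IH exprS factS natrM natrD natrM -[n.+1]addn1 natrD; ring.
Qed.

Lemma prog3_fact n : prog3 1 n * prog3 2 n * prog3 3 n = (3 * n)`!%:R.
Proof.
elim: n => [|n IH]; first by rewrite /prog3 !big_ord0 !mulr1.
rewrite !prog3S mulnS addnC !addnS addn0 !factS !natrM -IH.
rewrite -![(_ * _).+3]addn3 -![(_ * _).+2]addn2 -?[(_ * _).+1]addn1 !(natrM, natrD); ring.
Qed.

Lemma kapSS k : kap k.+2 = (kap k).+3.
Proof. rewrite /kap /=; lia. Qed.

Lemma iotSS k : iot k.+2 = (iot k).+3.
Proof. rewrite /iot /=; lia. Qed.

(** The determinant of the coefficients of the p k is evaluated twice: triangularly over the columns
    f z^k and g z^k, and as a Newton determinant. *)
Lemma normr_det_alternating N (p : nat -> {poly rat}) (f g : {poly rat}) (l0 l1 : rat)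
    (h c x b : nat -> rat) :
  l0 != 0 -> l1 != 0 ->
  p 0%N = l0 *: f ->
  in_span (alternating_seq f g) 1 (p 1%N - l1 *: g) ->
  in_span (alternating_seq f g) 2 (p 2 - cheb3 * p 0%N) ->
  in_span (alternating_seq f g) 2 (p 3 - cheb3 * p 1%N) ->
  (forall k, p k.+4 = cheb3 * p k.+2 - p k) ->
  (forall i k, (p k)`_i = h i * c k * \prod_(l < i) (x k - b l)) ->
  `|\det (alternating_mx N f g)| =
  \prod_(k < N) `|h k * c k * \prod_(i < k) (x k - x i)
                  / ((if odd k then l1 else l0) * 27%:R ^+ k./2)|.
Proof.
move=> l0n l1n h0 h1 h2 h3 hS hp.
have := det_alternating_triangular N h0 h1 h2 h3 hS.
rewrite (_ : (\matrix_(i < N, k < N) (p k)`_i) =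
    (\matrix_(i < N, k < N) (h i * c k * \prod_(l < i) (x k - b l)))); last first.
  by apply/matrixP => i k; rewrite !mxE hp.
rewrite det_newton; set P := \prod_(k < N) _; set L := \prod_(k < N) _ => e.
have Ln : L != 0.
  apply/prodf_neq0 => k _; apply: mulf_neq0; first by case: ifP.
  exact: expf_neq0.
have -> : \det (alternating_mx N f g) = P / L by rewrite e mulrC mulKf.
rewrite normrM normfV !normr_prod -prodfV -big_split; apply: eq_bigr => k _ /=.
by rewrite -normfV -normrM !normrM !normfV !normrM !normrX normrN.
Qed.

Lemma in_span2 f g (a b : rat) : in_span (alternating_seq f g) 2 (a *: f + b *: g).
Proof.
exists (fun l => if l is 0 then a else b).
by rewrite !big_ord_recl big_ord0 addr0 /alternating_seq /= expr0 !mulr1.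
Qed.

Lemma in_span1 f g (a : rat) : in_span (alternating_seq f g) 1 (a *: f).
Proof.
exists (fun=> a); by rewrite big_ord_recl big_ord0 addr0 /alternating_seq /= expr0 !mulr1.
Qed.

(** * The three families of columns *)

Lemma normr_det_U N :
  `|\det (alternating_mx N 1 'X)| =
  \prod_(k < N) `|(- 3%:R) ^+ k / (k.*2.+1)`!%:R * (kap k)%:R
     * \prod_(i < k) ((kap k)%:R ^+ 2 - (kap i)%:R ^+ 2)
     / ((if odd k then - 3%:R else 1) * 27%:R ^+ k./2)|.
Proof.
apply: (@normr_det_alternating N (fun k => chebU (kap k)) 1 'X 1 (- 3%:R)
  (fun k => (- 3%:R) ^+ k / (k.*2.+1)`!%:R) (fun k => (kap k)%:R) (fun k => (kap k)%:R ^+ 2)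
  (fun l => l.+1%:R ^+ 2)) => //.
- by rewrite scale1r.
- rewrite (_ : _ - _ = 2 *: 1); first exact: in_span1.
  by rewrite /chebU /= /cheb1 -!mul_polyC !rmorphN /= !rmorph_nat; ring.
- rewrite (_ : _ - _ = 2 *: 1 + (- 3%:R) *: 'X); first exact: in_span2.
  by rewrite /chebU /= cheb3E /cheb1 -!mul_polyC !rmorphN /= !rmorph_nat; ring.
- rewrite (_ : _ - _ = 1 *: 1 + 0 *: 'X); first exact: in_span2.
  by rewrite /chebU /= cheb3E scale0r scale1r; ring.
- by move=> k; rewrite !kapSS; exact: cheb_add6.
- by move=> i k; rewrite coef_chebU newton_bin_odd; ring.
Qed.

(** The factor -1/9 makes nu1(x) nu2(y) - nu2(x) nu1(y) agree with the Gram matrix in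
    [gram_kernel_congr]. *)
Definition nu1_even : {poly rat} := (- 9%:R^-1) *: chebE 1.
Definition nu2_even : {poly rat} := chebE 2.

Lemma normr_det_E N :
  `|\det (alternating_mx N nu1_even nu2_even)| =
  \prod_(k < N) `|(- 3%:R) ^+ k / (k.*2)`!%:R * 2
     * \prod_(i < k) ((kap k)%:R ^+ 2 - (kap i)%:R ^+ 2)
     / ((if odd k then 1 else - 9%:R) * 27%:R ^+ k./2)|.
Proof.
have e1 : chebE 1 = (- 9%:R) *: nu1_even.
  by rewrite /nu1_even scalerA mulrNN divff ?scale1r.
apply: (@normr_det_alternating N (fun k => chebE (kap k)) nu1_even nu2_even (- 9%:R) 1
  (fun k => (- 3%:R) ^+ k / (k.*2)`!%:R) (fun k => 2) (fun k => (kap k)%:R ^+ 2)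
  (fun l => l%:R ^+ 2)) => //.
- rewrite (_ : _ - _ = 0 *: nu1_even); first exact: in_span1.
  by rewrite scale0r scale1r subrr.
- rewrite (_ : _ - _ = 0 *: nu1_even + (-1) *: nu2_even); first exact: in_span2.
  by rewrite /nu2_even /chebE /= cheb3E scale0r scaleN1r; ring.
- rewrite (_ : _ - _ = (9%:R) *: nu1_even + 0 *: nu2_even); first exact: in_span2.
  rewrite scale0r addr0 -[9%:R]opprK scaleNr -e1.
  by rewrite /chebE /= cheb3E; ring.
- by move=> k; rewrite !kapSS; exact: cheb_add6.
- by move=> i k; rewrite /kap coef_chebE; ring.
Qed.

Definition nu1_odd : {poly rat} := 3%:R *: 'X - 5%:R.
Definition nu2_odd : {poly rat} := (1 - 'X) ^+ 2.

(** At the indices 0 and 2 the family [chebO] gives 1 and 5 + 3X(3X - 5), which exhibits X [nu1_odd]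
    as the second column. *)
Lemma normr_det_O N :
  `|\det (alternating_mx N 1 ('X * nu1_odd))| =
  \prod_(k < N) `|(- 3%:R) ^+ k / (k.*2.+1)`!%:R * (iot k).*2.+1%:R
     * \prod_(i < k) ((iot k * (iot k).+1)%:R - (iot i * (iot i).+1)%:R)
     / ((if odd k then 3%:R else 1) * 27%:R ^+ k./2)|.
Proof.
apply: (@normr_det_alternating N (fun k => chebO (iot k)) 1 ('X * nu1_odd) 1 3%:R
  (fun k => (- 3%:R) ^+ k / (k.*2.+1)`!%:R) (fun k => (iot k).*2.+1%:R)
  (fun k => (iot k * (iot k).+1)%:R) (fun l => (l * l.+1)%:R)) => //.
- by rewrite scale1r.
- rewrite (_ : _ - _ = 5%:R *: 1); first exact: in_span1.
  by rewrite /chebO /= /nu1_odd /cheb1 -!mul_polyC !rmorph_nat; ring.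
- rewrite (_ : _ - _ = 5%:R *: 1 + 3%:R *: ('X * nu1_odd)); first exact: in_span2.
  by rewrite /chebO /= cheb3E /nu1_odd /cheb1 -!mul_polyC !rmorph_nat; ring.
- rewrite (_ : _ - _ = 1 *: 1 + 0 *: ('X * nu1_odd)); first exact: in_span2.
  by rewrite /chebO /= cheb3E scale0r scale1r; ring.
- by move=> k; rewrite !iotSS; exact: cheb_add6.
- by move=> i k; rewrite coef_chebO; ring.
Qed.

(** The first row is (1, 0, ..., 0). Deleting it with the first column and dividing by X turns X g
    z^k into g z^k and z^(k+1) into (1 - X)^2 z^k. *)
Lemma det_alternating_shift N g :
  \det (alternating_mx N.+1 1 ('X * g)) = \det (alternating_mx N g nu2_odd).
Proof.
rewrite (expand_det_row _ ord0) big_ord_recl big1 ?addr0.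
  rewrite mxE /= expr0 mulr1 coef1 /= mul1r /cofactor /= expr0 mul1r; congr (\det _).
  apply/matrixP => i k; rewrite !mxE /= /bump /= !add1n uphalf_half.
  case: (odd k); rewrite /= ?add0n ?add1n.
    by rewrite mul1r exprS /cubic /nu2_odd -!mulrA coefXM.
  by rewrite -mulrA coefXM.
move=> k _; rewrite mxE /=.
case: ifP => ok; first by rewrite -mulrA coef0M coefX mul0r mul0r.
rewrite mul1r cubicXn_coef ?mul0r //.
by move: ok; rewrite /= => /negbFE; case: (nat_of_ord k) => //= j _; rewrite uphalf_gt0.
Qed.

(** * Comparison with the product of factorials *)

Definition factorial_product n : rat :=
  \prod_(0 <= i < n) ((3 * i + 1)`!%:R / (n + i)`!%:R).

Lemma fact_neq0 n : n`!%:R != 0 :> rat.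
Proof. by rewrite pnatr_eq0 -lt0n fact_gt0. Qed.

Lemma factorial_productS n :
  factorial_product n.+1 =
  factorial_product n * ((3 * n + 1)`!%:R * n`!%:R / (n.*2`!%:R * (n.*2.+1)`!%:R)).
Proof.
rewrite /factorial_product !prodf_div big_nat_recr //= !big_mkord.
have e : (\prod_(i < n.+1) (n.+1 + i)`!%:R) * n`!%:R =
    (\prod_(i < n) (n + i)`!%:R) * (n.*2`!%:R * (n.*2.+1)`!%:R) :> rat.
  transitivity (\prod_(i < n.+2) (n + i)`!%:R : rat).
    rewrite [in RHS]big_ord_recl addn0 mulrC; congr (_ * _).
    by apply: eq_bigr => i _; rewrite /= /bump /= add1n addSnnS.
  by rewrite !big_ord_recr /= addnS addnn mulrA.
have -> : \prod_(i < n.+1) (n.+1 + i)`!%:R =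
    (\prod_(i < n) (n + i)`!%:R) * (n.*2`!%:R * (n.*2.+1)`!%:R) / n`!%:R :> rat.
  by rewrite -e mulfK ?fact_neq0.
have d0 : \prod_(i < n) (n + i)`!%:R != 0 :> rat.
  by apply/prodf_neq0 => i _; rewrite fact_neq0.
by field; rewrite d0 !fact_neq0.
Qed.

Lemma prog3_gt0 s n : (0 < s)%N -> 0 < prog3 s n.
Proof. by move=> s0; apply: prodr_gt0 => i _; rewrite ltr0n addn_gt0 s0 orbT. Qed.

Definition ratioU k : rat :=
  `|(- 3%:R) ^+ k / (k.*2.+1)`!%:R * (kap k)%:R
     * \prod_(i < k) ((kap k)%:R ^+ 2 - (kap i)%:R ^+ 2)
     / ((if odd k then - 3%:R else 1) * 27%:R ^+ k./2)|.

Definition ratioE k : rat :=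
  `|(- 3%:R) ^+ k / (k.*2)`!%:R * 2
     * \prod_(i < k) ((kap k)%:R ^+ 2 - (kap i)%:R ^+ 2)
     / ((if odd k then 1 else - 9%:R) * 27%:R ^+ k./2)|.

Definition ratioO k : rat :=
  `|(- 3%:R) ^+ k / (k.*2.+1)`!%:R * (iot k).*2.+1%:R
     * \prod_(i < k) ((iot k * (iot k).+1)%:R - (iot i * (iot i).+1)%:R)
     / ((if odd k then 3%:R else 1) * 27%:R ^+ k./2)|.

(** One even and one odd column together use all three progressions modulo 3, whose product is a
    factorial by [prog3_fact]; hence the steps by two. *)
Lemma ratioU_pair l :
  ratioU l.*2 * ratioU l.*2.+1 =
  (9%:R ^+ l * 9%:R ^+ l / (27%:R ^+ l * 27%:R ^+ l)) *
  ((3 * l + 1)%:R * (3 * l + 2)%:R * (prog3 1 l.*2 * prog3 2 l.*2 * prog3 3 l.*2) * prog3 3 l.*2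
   * (6 * l + 1)%:R * (6 * l + 3)%:R / ((l.*2.*2.+1)`!%:R * (l.*2.*2.+3)`!%:R)).
Proof.
rewrite /ratioU !kap_prod_double !kap_prod_doubleS kap_double kap_doubleS odd_double /= uphalf_double doubleK !prog3S.
have p1 := prog3_gt0 l.*2 (isT : (0 < 1)%N).
have p2 := prog3_gt0 l.*2 (isT : (0 < 2)%N).
have p3 := prog3_gt0 l.*2 (isT : (0 < 3)%N).
rewrite odd_double /= !normrM !normfV !normrM !normrX !normrN !normr1 !normr_nat.
rewrite [ `|prog3 1 _|]gtr0_norm // [ `|prog3 2 _|]gtr0_norm // [ `|prog3 3 _|]gtr0_norm //.
rewrite exprS doubleS.
have -> : 3 ^+ l.*2 = 9 ^+ l :> rat by rewrite -muln2 mulnC exprM -natrX.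
have -> : (3 * l.*2 + 1)%:R = (6 * l + 1)%:R :> rat by congr (_%:R); lia.
have -> : (3 * l.*2 + 3)%:R = (6 * l + 3)%:R :> rat by congr (_%:R); lia.
have n27 : 27%:R ^+ l != 0 :> rat by rewrite expf_neq0.
move: (fact_neq0 l.*2.*2.+1) (fact_neq0 l.*2.*2.+3) n27.
move: _`!%:R _`!%:R (27%:R ^+ l) (9%:R ^+ l) => F1 F3 A B f1 f3 a0.
by field; rewrite a0 f1 f3.
Qed.

Lemma ratioE_pair l :
  ratioE l.*2 * ratioE l.*2.+1 =
  (9%:R ^+ l * 9%:R ^+ l / (27%:R ^+ l * 27%:R ^+ l)) *
  (4%:R / 3%:R * (prog3 1 l.*2 * prog3 2 l.*2 * prog3 3 l.*2) * prog3 3 l.*2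
   * (6 * l + 1)%:R * (6 * l + 3)%:R / ((l.*2.*2)`!%:R * (l.*2.*2.+2)`!%:R)).
Proof.
rewrite /ratioE !kap_prod_double !kap_prod_doubleS odd_double /= uphalf_double doubleK !prog3S.
have p1 := prog3_gt0 l.*2 (isT : (0 < 1)%N).
have p2 := prog3_gt0 l.*2 (isT : (0 < 2)%N).
have p3 := prog3_gt0 l.*2 (isT : (0 < 3)%N).
rewrite odd_double /= !normrM !normfV !normrM !normrX !normrN !normr1 !normr_nat.
rewrite [ `|prog3 1 _|]gtr0_norm // [ `|prog3 2 _|]gtr0_norm // [ `|prog3 3 _|]gtr0_norm //.
rewrite exprS doubleS.
have -> : 3 ^+ l.*2 = 9 ^+ l :> rat by rewrite -muln2 mulnC exprM -natrX.
have -> : (3 * l.*2 + 1)%:R = (6 * l + 1)%:R :> rat by congr (_%:R); lia.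
have -> : (3 * l.*2 + 3)%:R = (6 * l + 3)%:R :> rat by congr (_%:R); lia.
have n27 : 27%:R ^+ l != 0 :> rat by rewrite expf_neq0.
move: (fact_neq0 l.*2.*2) (fact_neq0 l.*2.*2.+2) n27.
move: _`!%:R _`!%:R (27%:R ^+ l) (9%:R ^+ l) => F1 F3 A B f1 f3 a0.
by field; rewrite a0 f1 f3.
Qed.

Lemma ratioO0 : ratioO 0 = 1.
Proof. by rewrite /ratioO big_ord0. Qed.

Lemma ratioO_pair l :
  ratioO l.*2.+1 * ratioO l.*2.+2 =
  (9%:R ^+ l * 9%:R ^+ l / (27%:R ^+ l * 27%:R ^+ l)) *
  ((6 * l + 5)%:R * (6 * l + 7)%:R / 3%:R * (prog3 1 l.*2 * prog3 2 l.*2 * prog3 3 l.*2) * prog3 3 l.*2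
   * (6 * l + 1)%:R * (6 * l + 2)%:R * (6 * l + 3)%:R ^+ 2 * (6 * l + 4)%:R * (6 * l + 6)%:R
   / ((l.*2.*2.+3)`!%:R * ((l.*2.*2.+4).+1)`!%:R)).
Proof.
rewrite /ratioO -doubleS !iot_prod_double !iot_prod_doubleS iot_double iot_doubleS odd_double /= uphalf_double doubleK doubleS !prog3S.
have p1 := prog3_gt0 l.*2 (isT : (0 < 1)%N).
have p2 := prog3_gt0 l.*2 (isT : (0 < 2)%N).
have p3 := prog3_gt0 l.*2 (isT : (0 < 3)%N).
rewrite odd_double /= !normrM !normfV !normrM !normrX !normrN !normr1 !normr_nat.
rewrite [ `|prog3 1 _|]gtr0_norm // [ `|prog3 2 _|]gtr0_norm // [ `|prog3 3 _|]gtr0_norm //.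
rewrite !exprS !doubleS.
have -> : 3 ^+ l.*2 = 9 ^+ l :> rat by rewrite -muln2 mulnC exprM -natrX.
have -> : (3 * l.*2 + 1)%:R = (6 * l + 1)%:R :> rat by congr (_%:R); lia.
have -> : (3 * l.*2 + 2)%:R = (6 * l + 2)%:R :> rat by congr (_%:R); lia.
have -> : (3 * l.*2 + 3)%:R = (6 * l + 3)%:R :> rat by congr (_%:R); lia.
have -> : (3 * l.*2.+1 + 1)%:R = (6 * l + 4)%:R :> rat by congr (_%:R); lia.
have -> : (3 * l.*2.+1 + 3)%:R = (6 * l + 6)%:R :> rat by congr (_%:R); lia.
have -> : ((3 * l + 2).*2.+1)%:R = (6 * l + 5)%:R :> rat by congr (_%:R); lia.
have -> : ((3 * l.+1).*2.+1)%:R = (6 * l + 7)%:R :> rat by congr (_%:R); lia.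
have n27 : 27%:R ^+ l != 0 :> rat by rewrite expf_neq0.
move: (fact_neq0 l.*2.*2.+3) (fact_neq0 (l.*2.*2.+4).+1) n27.
move: _`!%:R _`!%:R (27%:R ^+ l) (9%:R ^+ l) => F1 F3 A B f1 f3 a0.
by field; rewrite a0 f1 f3.
Qed.

Lemma pow9_27 l : 9%:R ^+ l * 9%:R ^+ l / (27%:R ^+ l * 27%:R ^+ l) * (3 ^+ l.*2) = 1 :> rat.
Proof.
rewrite -!exprMn -mul2n exprM -expr_div_n -exprMn.
by rewrite (_ : _ / _ * _ = 1) ?expr1n.
Qed.

Lemma fact_step2 l :
  ((3 * l.*2 + 1)`!%:R = (6 * l + 1)%:R * (prog3 1 l.*2 * prog3 2 l.*2 * prog3 3 l.*2)) /\
  ((3 * l.*2.+1 + 1)`!%:R = (6 * l + 4)%:R * (6 * l + 3)%:R * (6 * l + 2)%:R * (6 * l + 1)%:R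
    * (prog3 1 l.*2 * prog3 2 l.*2 * prog3 3 l.*2)).
Proof.
rewrite prog3_fact.
have -> : (3 * l.*2.+1 + 1 = (3 * l.*2).+4)%N by lia.
have -> : (3 * l.*2 = 6 * l)%N by lia.
rewrite !factS !natrM -[(6 * l).+4]addn4 -[(6 * l).+3]addn3 -[(6 * l).+2]addn2.
by rewrite addn1 factS natrM -addn1; split=> //; ring.
Qed.

Lemma fact_step3 l :
  (3 * l.*2.+2 + 1)`!%:R = (6 * l + 7)%:R * (6 * l + 6)%:R * (6 * l + 5)%:R * (6 * l + 4)%:R * (6 * l + 3)%:R * (6 * l + 2)%:R * (6 * l + 1)%:R
    * (prog3 1 l.*2 * prog3 2 l.*2 * prog3 3 l.*2) :> rat.
Proof.
rewrite prog3_fact.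
have -> : (3 * l.*2 = 6 * l)%N by lia.
have -> : (3 * l.*2.+2 + 1 = (6 * l).+4.+3)%N by lia.
rewrite !factS !natrM -[(6 * l).+4.+3]addn1 -[(6 * l).+4.+2]addn1 -[(6 * l).+4.+1]addn1.
rewrite -[(6 * l).+4]addn4 -[(6 * l).+3]addn3 -[(6 * l).+2]addn2 -[(6 * l).+1]addn1.
by rewrite -!addnA; ring.
Qed.

Lemma normr_det_even m :
  `|\det (alternating_mx m.*2 nu1_even nu2_even)| * `|\det (alternating_mx m.*2 1 'X)| =
  factorial_product m.*2.
Proof.
rewrite normr_det_E normr_det_U (prod_double m ratioE) (prod_double m ratioU) -big_split /=.
elim: m => [|m IH]; first by rewrite big_ord0 /factorial_product big_nil.
rewrite doubleS big_ord_recr /= IH ratioU_pair ratioE_pair !factorial_productS -[RHS]mulrA.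
congr (_ * _); have [-> ->] := fact_step2 m.
have := pow9_27 m; set q := _ / _; move: (prog3 1 _ * prog3 2 _ * _) => a; rewrite prog3_3 => e.
have q1 : q = (3 ^+ m.*2)^-1.
  by apply: (mulIf (expf_neq0 m.*2 (_ : 3 != 0 :> rat))) => //; rewrite e mulVf ?expf_neq0.
have t0 : 3 ^+ m.*2 != 0 :> rat by rewrite expf_neq0.
have -> : m.*2.+1`!%:R = (m.*2 + 1)%:R * m.*2`!%:R :> rat by rewrite factS natrM addn1.
have -> : (6 * m + 3)%:R = 3%:R * (m.*2 + 1)%:R :> rat.
  by rewrite -natrM; congr (_%:R); lia.
have -> : (6 * m + 4)%:R = 2%:R * (3 * m + 2)%:R :> rat.
  by rewrite -natrM; congr (_%:R); lia.
have -> : (6 * m + 2)%:R = 2%:R * (3 * m + 1)%:R :> rat.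
  by rewrite -natrM; congr (_%:R); lia.
rewrite !doubleS q1.
move: t0 (fact_neq0 m.*2.*2) (fact_neq0 m.*2.*2.+1) (fact_neq0 m.*2.*2.+2) (fact_neq0 m.*2.*2.+3).
move: (3 ^+ m.*2) => t t0.
move: m.*2.*2`!%:R m.*2.*2.+1`!%:R m.*2.*2.+2`!%:R m.*2.*2.+3`!%:R m.*2`!%:R => F0 F1 F2 F3 G f0 f1 f2 f3.
by field; rewrite t0 f0 f1 f2 f3.
Qed.

Lemma normr_det_odd m :
  `|\det (alternating_mx m.*2 nu1_odd nu2_odd)| * `|\det (alternating_mx m.*2 1 'X)| =
  factorial_product m.*2.+1.
Proof.
rewrite -det_alternating_shift normr_det_O normr_det_U (prod_double m ratioU).
rewrite big_ord_recl (_ : `|_| = ratioO 0%N) // ratioO0 mul1r.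
rewrite (_ : \prod_(i < m.*2) _ = \prod_(i < m) (ratioO i.*2.+1 * ratioO i.*2.+2)); last first.
  by rewrite -(prod_double m (fun k => ratioO k.+1)); apply: eq_bigr.
rewrite -big_split /=.
elim: m => [|m IH].
  by rewrite big_ord0 /factorial_product big_nat1.
rewrite big_ord_recr /= IH ratioU_pair ratioO_pair doubleS.
rewrite (factorial_productS m.*2.+2) (factorial_productS m.*2.+1) -[RHS]mulrA fact_step3.
congr (_ * _); have [_ ->] := fact_step2 m.
have := pow9_27 m; set q := _ / _; move: (prog3 1 _ * prog3 2 _ * _) => a; rewrite prog3_3 => e.
have q1 : q = (3 ^+ m.*2)^-1.
  by apply: (mulIf (expf_neq0 m.*2 (_ : 3 != 0 :> rat))) => //; rewrite e mulVf ?expf_neq0.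
have t0 : 3 ^+ m.*2 != 0 :> rat by rewrite expf_neq0.
have -> : m.*2.+2`!%:R = (m.*2 + 2)%:R * (m.*2 + 1)%:R * m.*2`!%:R :> rat.
  by rewrite !factS !natrM addn1 addn2 mulrA.
have -> : m.*2.+1`!%:R = (m.*2 + 1)%:R * m.*2`!%:R :> rat by rewrite factS natrM addn1.
have -> : (6 * m + 3)%:R = 3%:R * (m.*2 + 1)%:R :> rat.
  by rewrite -natrM; congr (_%:R); lia.
have -> : (6 * m + 4)%:R = 2%:R * (3 * m + 2)%:R :> rat.
  by rewrite -natrM; congr (_%:R); lia.
have -> : (6 * m + 2)%:R = 2%:R * (3 * m + 1)%:R :> rat.
  by rewrite -natrM; congr (_%:R); lia.
have -> : (6 * m + 6)%:R = 3%:R * (m.*2 + 2)%:R :> rat.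
  by rewrite -natrM; congr (_%:R); lia.
rewrite !doubleS q1.
have -> : m.*2.*2.+4`!%:R = 2%:R * (m.*2 + 2)%:R * m.*2.*2.+3`!%:R :> rat.
  by rewrite factS -natrM -natrM; congr (_%:R); congr (_ * _)%N; lia.
have -> : m.*2.*2.+2`!%:R = 2%:R * (m.*2 + 1)%:R * m.*2.*2.+1`!%:R :> rat.
  by rewrite factS -natrM -natrM; congr (_%:R); congr (_ * _)%N; lia.
have a0 : (m.*2 + 1)%:R != 0 :> rat by rewrite pnatr_eq0 addn1.
have b0 : (m.*2 + 2)%:R != 0 :> rat by rewrite pnatr_eq0 addn2.
move: t0 a0 b0 (fact_neq0 m.*2.*2.+1) (fact_neq0 m.*2.*2.+3) (fact_neq0 (m.*2.*2.+4).+1).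
move: (3 ^+ m.*2) (m.*2 + 1)%:R (m.*2 + 2)%:R => t x y t0 x0 y0.
move: m.*2.*2.+1`!%:R m.*2.*2.+3`!%:R (m.*2.*2.+4).+1`!%:R m.*2`!%:R => F1 F3 F5 G f1 f3 f5.
by field; rewrite t0 x0 y0 f1 f3 f5.
Qed.

(** * The Gram matrix of the paths *)

(** The reversal X^D f(1/X), for f of degree at most D. *)
Definition revp D (f : {poly rat}) : {poly rat} := \sum_(i < D.+1) f`_i *: 'X^(D - i).

Lemma revp_sum D (I : Type) (r : seq I) (P : pred I) (F : I -> {poly rat}) :
  revp D (\sum_(i <- r | P i) F i) = \sum_(i <- r | P i) revp D (F i).
Proof.
rewrite exchange_big; apply: eq_bigr => i _ /=.
by rewrite coef_sum scaler_suml.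
Qed.

Lemma revpZ D a f : revp D (a *: f) = a *: revp D f.
Proof. by rewrite /revp scaler_sumr; apply: eq_bigr => i _; rewrite coefZ scalerA. Qed.

Lemma revpXn D i : (i <= D)%N -> revp D 'X^i = 'X^(D - i).
Proof.
move=> iD; rewrite /revp (bigD1 (Ordinal (iD : i < D.+1)%N)) //= coefXn eqxx scale1r.
rewrite big1 ?addr0 // => j ji; rewrite coefXn; case: eqP => [e|]; last by rewrite scale0r.
by case/eqP: ji; apply: val_inj.
Qed.

Lemma revpM D1 D2 (f g : {poly rat}) : (size f <= D1.+1)%N -> (size g <= D2.+1)%N ->
  revp (D1 + D2) (f * g) = revp D1 f * revp D2 g.
Proof.
move=> sf sg.
have ex (p : {poly rat}) D : (size p <= D.+1)%N -> p = \sum_(i < D.+1) p`_i *: 'X^i.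
  by move=> sp; rewrite -poly_def; apply/polyP => i; rewrite coef_poly; case: ltnP => // h;
     rewrite nth_default // (leq_trans sp).
rewrite {1}(ex f _ sf) {1}(ex g _ sg) mulr_suml revp_sum [in RHS]mulr_suml.
apply: eq_bigr => i _; rewrite mulr_sumr revp_sum [in RHS]mulr_sumr.
apply: eq_bigr => j _; rewrite -scalerAl -scalerAr -exprD !revpZ revpXn; last first.
  by have := ltn_ord i; have := ltn_ord j; lia.
rewrite -scalerAl -scalerAr -exprD; congr (_ *: (_ *: 'X^_)).
by have := ltn_ord i; have := ltn_ord j; lia.
Qed.

Lemma coef_revp D (f : {poly rat}) k : (k <= D)%N -> (revp D f)`_k = f`_(D - k).
Proof.
move=> kD; rewrite coef_sum (bigD1 (Ordinal (leq_subr k D : D - k < D.+1)%N)) //=.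
rewrite coefZ coefXn subKn // eqxx mulr1 big1 ?addr0 // => j jk.
rewrite coefZ coefXn; case: eqP => [e|]; last by rewrite mulr0.
by case/eqP: jk; apply: val_inj; rewrite /= e subKn // -ltnS.
Qed.

Lemma revp_dot D M (f p : {poly rat}) : (size f <= D.+1)%N -> (D < M)%N ->
  \sum_(r < M) f`_r * p`_r = (revp D f * p)`_D.
Proof.
move=> sf DM; rewrite mulr_suml coef_sum.
rewrite (big_ord_widen M (fun i => (f`_i *: 'X^(D - i) * p)`_D) DM) [RHS]big_mkcond.
apply: eq_bigr => r _; rewrite -scalerAl coefZ coefXnM.
case: ltnP => [rD|Dr]; last by rewrite nth_default ?mul0r // (leq_trans sf).
by rewrite ltnNge leq_subr /= subKn.
Qed.

(** Summation by parts: sgn(s + 1 - r) - sgn(s - r) is 1 for s = r and for s + 1 = r, and 0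
    otherwise. *)
Lemma order_sign_dot M (f h : {poly rat}) : (size h < M)%N ->
  \sum_(r < M) \sum_(s < M) f`_r * Num.sg (s%:R - r%:R) * (('X - 1) * h)`_s =
  \sum_(r < M) f`_r * ((1 + 'X) * h)`_r.
Proof.
case: M => // M sh; apply: eq_bigr => r _.
under eq_bigr do rewrite -mulrA.
rewrite -mulr_sumr; congr (_ * _).
under eq_bigr do rewrite mulrBl mul1r coefB mulrBr.
rewrite sumrB big_ord_recl coefXM mulr0 add0r [X in _ - X]big_ord_recr /=.
rewrite [h`_M]nth_default // mulr0 addr0 -sumrB.
rewrite (eq_bigr (fun s : 'I_M => ((s == r :> nat) || (s.+1 == r :> nat))%:R * h`_s)); last first.
  move=> s _; rewrite coefXM /= /bump /= add1n -mulrBl; congr (_ * _).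
  have [sr|rs|->] := ltngtP s r.
  - rewrite [Num.sg (s%:R - _)]ltr0_sg ?subr_lt0 ?ltr_nat // opprK.
    case: eqP => [->|/eqP ne]; first by rewrite subrr sgr0 add0r.
    by rewrite ltr0_sg ?addNr // subr_lt0 ltr_nat ltn_neqAle ne.
  - rewrite !gtr0_sg ?subr_gt0 ?ltr_nat ?subrr //; last exact: ltnW.
    by case: eqP => // e; rewrite -e ltnNge leqnSn in rs.
  - by rewrite subrr sgr0 subr0 gtr0_sg // subr_gt0 ltr_nat.
rewrite mulrDl mul1r coefD coefXM.
have hz k : (M <= k)%N -> h`_k = 0 by move=> Mk; rewrite nth_default // (leq_trans _ Mk).
have pick k : \sum_(s < M) (s == k :> nat)%:R * h`_s = h`_k.
  case: (ltnP k M) => kM; last first.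
    rewrite hz // big1 // => s _; case: eqP => [e|]; last by rewrite mul0r.
    by move: (ltn_ord s); rewrite e ltnNge kM.
  rewrite (bigD1 (Ordinal kM)) //= eqxx mul1r big1 ?addr0 // => s sk.
  by case: eqP => [e|]; [case/eqP: sk; apply: val_inj | rewrite mul0r].
rewrite (eq_bigr (fun s : 'I_M => (s == r :> nat)%:R * h`_s + (s.+1 == r :> nat)%:R * h`_s)); last first.
  move=> s _; rewrite -mulrDl; congr (_ * _); case: (s =P r :> nat) => [->|_].
    by rewrite [_.+1 == _]gtn_eqF // addr0.
  by rewrite add0r.
rewrite big_split /= pick; congr (_ + _); case: (nat_of_ord r) => [|k] /=.
  by rewrite big1 // => s _; rewrite mul0r.
by rewrite -[RHS]pick; apply: eq_bigr => s _; rewrite eqSS.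
Qed.

Definition theta : {poly rat} := 1 + 'X + 'X ^+ 2.
Definition step_poly : {poly rat} := 'X * (1 + 'X).
(** The part of a Gram entry independent of the indices: (1 - X)(1 + 2X) is the reversal of (X -
    1)(X + 2), and a factor 1 + X replaces X - 1 by [order_sign_dot]. *)
Definition gram_poly e : {poly rat} :=
  (1 + 'X) ^+ (e + e) * ((1 - 'X) * (1 + 2%:P * 'X) * (1 + 'X) * ('X + 2%:P)).
(* Since step_poly - 2 = (X - 1)(X + 2) and step_poly + 1 = theta, this is    *)
(* step_poly ^+ e times a monic polynomial in step_poly. The factor X - 1     *)
(* turns the pairing with the signs of s - r into a single coefficient        *)
(* extraction (order_sign_dot).                                               *)
Definition gram_basis e i : {poly rat} :=
  step_poly ^+ e * (if i is i'.+1 then ('X - 1) * (('X + 2%:P) * theta ^+ i') else 1).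

(** The entry (0, 1), where the exponent i + j - 2 would be negative: the coefficient of X^e in (1 +
    X)^(2e+1) (X + 2). *)
Definition gram_base e : rat := if e == 0%N then 2 else 7%:R.

Definition gram_coef e i j : rat :=
  if (2 <= i + j)%N then (gram_poly e * theta ^+ (i + j - 2))`_(i.*2 + e)
  else if (i < j)%N then gram_base e else if (j < i)%N then - gram_base e else 0.

Lemma size_theta : (size theta <= 3)%N.
Proof.
by apply/leq_sizeP => -[|[|[|j]]] // _; rewrite !coefE /= !addr0.
Qed.

Lemma size_step_poly : (size step_poly <= 3)%N.
Proof.
by apply/leq_sizeP => -[|[|[|j]]] // _; rewrite /step_poly !coefE /= ?addr0.
Qed.

Lemma size_linear (a b : rat) : (size (a%:P + b%:P * 'X : {poly rat})%R <= 2)%N.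
Proof.
by apply/leq_sizeP => -[|[|j]] // _; rewrite !coefE /= ?mulr0 ?addr0.
Qed.

Lemma size_polyM_leq (p q : {poly rat}) a b :
  (size p <= a.+1)%N -> (size q <= b.+1)%N -> (size (p * q)%R <= (a + b).+1)%N.
Proof.
move=> hp hq; apply: leq_trans (size_polyMleq _ _) _.
by move: (size p) (size q) hp hq => x y hx hy; lia.
Qed.

Lemma size_polyX_leq (p : {poly rat}) a k :
  (size p <= a.+1)%N -> (size (p ^+ k) <= (k * a).+1)%N.
Proof.
move=> hp; elim: k => [|k IH]; first by rewrite expr0 size_polyC oner_eq0.
by rewrite exprS mulSn; apply: size_polyM_leq.
Qed.

Lemma revp_linear (a b : rat) : revp 1 (a%:P + b%:P * 'X) = b%:P + a%:P * 'X.
Proof.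
rewrite /revp !big_ord_recr big_ord0 /= !coefE /= subn0 subnn expr1 expr0.
by rewrite ?mulr1 ?mulr0 ?addr0 ?add0r alg_polyC addrC mul_polyC.
Qed.

Lemma revp_theta : revp 2 theta = theta.
Proof.
rewrite /revp !big_ord_recr big_ord0 /= /theta !coefE /= !subn0 /=.
by rewrite ?addr0 ?add0r !scale1r expr1 expr0; ring.
Qed.

Lemma revp_step_poly : revp 2 step_poly = 1 + 'X.
Proof.
rewrite /revp !big_ord_recr big_ord0 /= /step_poly !coefE /=.
by rewrite ?addr0 ?add0r !scale1r ?scale0r expr1 expr0; ring.
Qed.

Lemma revpX D (f : {poly rat}) k : (size f <= D.+1)%N -> revp (k * D) (f ^+ k) = (revp D f) ^+ k.
Proof.
move=> sf; elim: k => [|k IH].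
  by rewrite mul0n /revp big_ord_recr big_ord0 /= !expr0 coef1 scale1r add0r.
by rewrite !exprS mulSn revpM // ?IH //; apply: size_polyX_leq.
Qed.

Lemma XsubE : 'X - 1 = (-1)%:P + 1%:P * 'X :> {poly rat}.
Proof. by rewrite polyCN mul1r addrC. Qed.

Lemma Xadd2E : 'X + 2%:P = 2%:P + 1%:P * 'X :> {poly rat}.
Proof. by rewrite mul1r addrC. Qed.

Lemma revp_gram_basis e i : revp (e.*2 + i.*2) (gram_basis e i) =
  (1 + 'X) ^+ e * (if i is i'.+1 then (1 - 'X) * ((1 + 2%:P * 'X) * theta ^+ i') else 1).
Proof.
rewrite /gram_basis revpM; last first.
- case: i => [|i]; first by rewrite size_polyC oner_eq0.
  rewrite doubleS -[i.*2.+2]/(1 + (1 + i.*2))%N; apply: size_polyM_leq.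
    by rewrite XsubE size_linear.
  apply: size_polyM_leq; first by rewrite Xadd2E size_linear.
  by rewrite -muln2; apply: size_polyX_leq; exact: size_theta.
- by rewrite -muln2; apply: size_polyX_leq; exact: size_step_poly.
congr (_ * _); first by rewrite -muln2 revpX ?size_step_poly // revp_step_poly.
case: i => [|i]; first by rewrite /revp big_ord_recr big_ord0 /= coef1 scale1r add0r.
rewrite doubleS -[i.*2.+2]/(1 + (1 + i.*2))%N revpM ?XsubE ?size_linear //; last first.
  apply: size_polyM_leq; first by rewrite Xadd2E size_linear.
  by rewrite -muln2; apply: size_polyX_leq; exact: size_theta.
rewrite revp_linear polyCN mulN1r polyC1; congr (_ * _).
rewrite revpM ?Xadd2E ?size_linear //; last by rewrite -muln2; apply: size_polyX_leq; exact: size_theta.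
rewrite revp_linear polyC1; congr (_ * _).
by rewrite -muln2 revpX ?size_theta // revp_theta.
Qed.

Lemma size_gram_basis e i : (size (gram_basis e i) <= (e.*2 + i.*2).+1)%N.
Proof.
rewrite /gram_basis; apply: size_polyM_leq.
  by rewrite -muln2; apply: size_polyX_leq; exact: size_step_poly.
case: i => [|i]; first by rewrite size_polyC oner_eq0.
rewrite doubleS -[i.*2.+2]/(1 + (1 + i.*2))%N; apply: size_polyM_leq.
  by rewrite XsubE size_linear.
apply: size_polyM_leq; first by rewrite Xadd2E size_linear.
by rewrite -muln2; apply: size_polyX_leq; exact: size_theta.
Qed.

Definition order_form M (f g : {poly rat}) : rat :=
  \sum_(r < M) \sum_(s < M) f`_r * Num.sg (s%:R - r%:R) * g`_s.

Lemma order_formC M f g : order_form M g f = - order_form M f g.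
Proof.
rewrite /order_form exchange_big -sumrN; apply: eq_bigr => r _.
rewrite -sumrN; apply: eq_bigr => s _.
by rewrite -[_ - _]opprB sgrN mulrN mulNr mulrAC [g`_s * _]mulrC mulrAC.
Qed.

Lemma coef_shift (p q : {poly rat}) e : (e <= 1)%N -> ('X^2 * p + q)`_e = q`_e.
Proof. by move=> e1; rewrite coefD coefXnM ltnS e1 add0r. Qed.

(** Row 0 of the Gram matrix lacks the factor (1 - X)(1 + 2X). Since this factor is theta - 3X^2,
    row 0 obeys the common formula up to a multiple of X^2, invisible in the coefficient of X^e for
    e <= 1. *)
Lemma gram_poly_parts e k : ((1 + 'X) ^+ (e + e).+1 * ('X + 2%:P) * theta ^+ k.+1) =
  'X^2 * (3%:P * ((1 + 'X) ^+ (e + e).+1 * ('X + 2%:P) * theta ^+ k)) + gram_poly e * theta ^+ k.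
Proof. rewrite /gram_poly !exprS /theta; ring. Qed.

Lemma order_form_gramS M e i j : (e <= 1)%N -> (e.*2 + i.*2 < M)%N -> (e.*2 + j.*2 + 2 < M)%N ->
  order_form M (gram_basis e i) (gram_basis e j.+1) = gram_coef e i j.+1.
Proof.
move=> e1 iM jM.
have sh : (size (step_poly ^+ e * (('X + 2%:P) * theta ^+ j))%R < M)%N.
  apply: leq_ltn_trans jM; apply: leq_trans (_ : (e.*2 + (1 + j.*2)).+1 <= _)%N; last by lia.
  apply: size_polyM_leq; first by rewrite -muln2; apply: size_polyX_leq; exact: size_step_poly.
  apply: size_polyM_leq; first by rewrite Xadd2E size_linear.
  by rewrite -muln2; apply: size_polyX_leq; exact: size_theta.
rewrite /order_form {2}/gram_basis mulrCA order_sign_dot //.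
rewrite (revp_dot _ (size_gram_basis e i) iM) revp_gram_basis.
case: i iM => [|i] iM.
  have -> : (1 + 'X) ^+ e * 1 * ((1 + 'X) * (step_poly ^+ e * (('X + 2%:P) * theta ^+ j))) =
      'X^e * ((1 + 'X) ^+ (e + e).+1 * ('X + 2%:P) * theta ^+ j).
    by rewrite /step_poly exprMn !exprS exprD; ring.
  rewrite coefXnM -addnn addn0 ltnNge leq_addr /= addKn /gram_coef.
  case: j {jM sh} => [|j].
    rewrite /= /gram_base expr0 mulr1; case: e e1 {iM} => [|[|e]] //= _.
      by rewrite expr1 -horner_coef0 !hornerE.
    have -> : (1 + 'X) ^+ 3 * ('X + 2%:P) =
      'X^2 * (9%:P + 5%:P * 'X + 'X^2) + (2%:P + 7%:P * 'X) :> {poly rat} by ring.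
    by rewrite coef_shift // !coefE /= add0r mulr1.
  by rewrite gram_poly_parts coef_shift // !add0n subn2.
have -> : (1 + 'X) ^+ e * ((1 - 'X) * ((1 + 2%:P * 'X) * theta ^+ i)) *
    ((1 + 'X) * (step_poly ^+ e * (('X + 2%:P) * theta ^+ j))) =
    'X^e * (gram_poly e * theta ^+ (i + j)).
  by rewrite /gram_poly /step_poly exprMn exprD exprD; ring.
rewrite coefXnM -addnn -addnA ltnNge leq_addr /= addKn /gram_coef.
by rewrite addSn addnS ltnS ltnS leq0n subn2 /= [(e + _)%N]addnC.
Qed.

(** The antisymmetry of the Gram matrix on the level of polynomials: reversal exchanges 1 + 2X with
    X + 2 and negates 1 - X. *)
Lemma revp_gram_poly e k :
  revp (e.*2 + (4 + k.*2)) (gram_poly e * theta ^+ k) = - (gram_poly e * theta ^+ k).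
Proof.
have E1 : 1 + 'X = 1%:P + 1%:P * 'X :> {poly rat} by rewrite polyC1 mul1r.
have E2 : 1 - 'X = 1%:P + (-1)%:P * 'X :> {poly rat} by rewrite polyCN polyC1 mulN1r.
have E3 : 1 + 2%:P * 'X = 1%:P + 2%:P * 'X :> {poly rat} by rewrite polyC1.
have s1 : (size (1 + 'X : {poly rat})%R <= 2)%N by rewrite E1; exact: size_linear.
have r1 : revp 1 (1 + 'X) = 1 + 'X by rewrite E1 revp_linear.
have s2 : (size (1 - 'X : {poly rat})%R <= 2)%N by rewrite E2; exact: size_linear.
have r2 : revp 1 (1 - 'X) = 'X - 1 by rewrite E2 revp_linear polyCN !polyC1; ring.
have s3 : (size (1 + 2%:P * 'X : {poly rat})%R <= 2)%N by rewrite E3; exact: size_linear.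
have r3 : revp 1 (1 + 2%:P * 'X) = 'X + 2%:P by rewrite E3 revp_linear polyC1; ring.
have s4 : (size ('X + 2%:P : {poly rat})%R <= 2)%N by rewrite Xadd2E; exact: size_linear.
have r4 : revp 1 ('X + 2%:P) = 1 + 2%:P * 'X.
  by rewrite Xadd2E revp_linear polyC1.
have s12 := size_polyM_leq s2 s3; have s123 := size_polyM_leq s12 s1.
have st : (size (theta ^+ k)%R <= k.*2.+1)%N.
  by rewrite -muln2; apply: size_polyX_leq; exact: size_theta.
rewrite /gram_poly -!mulrA revpM; last first.
- rewrite -[(4 + k.*2)%N]/(1 + (1 + (1 + (1 + k.*2))))%N.
  by do 4!(apply: size_polyM_leq => //).
- by have := size_polyX_leq (e + e) s1; rewrite muln1 addnn.
have -> : revp e.*2 ((1 + 'X) ^+ (e + e)) = (1 + 'X) ^+ (e + e).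
  by have := revpX (e + e) s1; rewrite r1 muln1 addnn.
rewrite -[(4 + k.*2)%N]/(1 + (1 + (1 + (1 + k.*2))))%N.
do 3!(rewrite revpM //; last by do ?(apply: size_polyM_leq => //)).
rewrite revpM //.
rewrite r1 r2 r3 r4 -muln2 revpX ?size_theta // revp_theta; ring.
Qed.

Lemma gram_coefC0 e i : (e <= 1)%N -> gram_coef e i 0 = - gram_coef e 0 i.
Proof.
move=> e1; case: i => [|[|i]]; rewrite /gram_coef ?oppr0 //.
rewrite add0n addn0 !subn2 /= add0n.
have eD : (i.+2.*2 + e = e.*2 + (4 + i.*2) - e)%N by lia.
by rewrite eD -coef_revp ?revp_gram_poly ?coefN //; lia.
Qed.

Lemma order_form_gram M e i j : (e <= 1)%N -> (e.*2 + i.*2 < M)%N -> (e.*2 + j.*2 < M)%N ->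
  order_form M (gram_basis e i) (gram_basis e j) = gram_coef e i j.
Proof.
move=> e1 iM; case: j => [|j] jM; last by apply: order_form_gramS => //; lia.
case: i iM => [|i] iM.
  have := order_formC M (gram_basis e 0) (gram_basis e 0).
  by rewrite /gram_coef /= => h; lra.
by rewrite order_formC order_form_gramS ?gram_coefC0 //; lia.
Qed.

(** * The generating function of the Gram matrix *)

Definition nu1 e := if e == 0%N then nu1_even else nu1_odd.
Definition nu2 e := if e == 0%N then nu2_even else nu2_odd.

Definition gram_shift e i j a b : rat :=
  if (a <= i)%N && (b <= j)%N then gram_coef e (i - a) (j - b) else 0.

Lemma size_gram_poly e k : (size (gram_poly e * theta ^+ k)%R <= (e.*2 + (4 + k.*2)).+1)%N.
Proof.
have s1 : (size (1 + 'X : {poly rat})%R <= 2)%N by rewrite -[X in (_ + X)%R]mul1r -!polyC1; exact: size_linear.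
have s2 : (size (1 - 'X : {poly rat})%R <= 2)%N.
  by rewrite -[X in (_ - X)%R]mul1r -mulNr -!polyC1 -polyCN; exact: size_linear.
have s3 : (size (1 + 2%:P * 'X : {poly rat})%R <= 2)%N by rewrite -polyC1; exact: size_linear.
have s4 : (size ('X + 2%:P : {poly rat})%R <= 2)%N by rewrite Xadd2E; exact: size_linear.
have st : (size (theta ^+ k)%R <= k.*2.+1)%N.
  by rewrite -muln2; apply: size_polyX_leq; exact: size_theta.
rewrite /gram_poly -!mulrA; apply: size_polyM_leq.
  by have := size_polyX_leq (e + e) s1; rewrite muln1 addnn.
rewrite -[(4 + k.*2)%N]/(1 + (1 + (1 + (1 + k.*2))))%N.
by do 4!(apply: size_polyM_leq => //).
Qed.

(** A shift of the row index costs X^2/theta and one of the column index 1/theta. Shifts out of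
    range agree too, because the coefficient then lies beyond an end of the polynomial. *)
Lemma gram_shiftE e i j a b : (e <= 1)%N -> (4 <= i + j)%N -> (a + b <= 2)%N ->
  gram_shift e i j a b =
  ('X^(a.*2) * (gram_poly e * theta ^+ (i + j - 4 + (2 - (a + b)))))`_(i.*2 + e).
Proof.
move=> e1 ij ab; rewrite /gram_shift coefXnM.
case: (leqP a i) => [ai|ia] /=; last by have -> : (i.*2 + e < a.*2)%N by lia.
rewrite (_ : (_ < _)%N = false); last by lia.
case: (leqP b j) => [bj|jb].
  rewrite /gram_coef; have -> : (2 <= i - a + (j - b))%N by lia.
  have -> : (i - a + (j - b) - 2 = i + j - 4 + (2 - (a + b)))%N by lia.
  by have -> : ((i - a).*2 + e = i.*2 + e - a.*2)%N by lia.
rewrite nth_default //; apply: leq_trans (size_gram_poly _ _) _; lia.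
Qed.

Lemma nu_even : nu1 0 = (- (2 / 9%:R))%:P + (3%:R^-1)%:P * 'X :> {poly rat} /\
  nu2 0 = 2%:P + (- 12%:R)%:P * 'X + 9%:P * 'X^2 :> {poly rat}.
Proof.
rewrite /nu1 /nu2 /= /nu1_even /nu2_even /chebE /= /cheb1 -!mul_polyC; split.
  have -> : - (2 / 9%:R) = - 9%:R^-1 * 2 :> rat by field.
  have -> : 3%:R^-1 = 9%:R^-1 * 3%:R :> rat by field.
  by rewrite !polyCM !polyCN !rmorph_nat; ring.
by rewrite !polyCN !rmorph_nat; ring.
Qed.

Lemma nu_odd : nu1 1 = (- 5%:R)%:P + 3%:P * 'X :> {poly rat} /\
  nu2 1 = 1 + (- 2)%:P * 'X + 'X^2 :> {poly rat}.
Proof.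
rewrite /nu1 /nu2 /= /nu1_odd /nu2_odd -!mul_polyC; split;
  by rewrite !polyCN !rmorph_nat; ring.
Qed.

Lemma gram_poly_expand00 : gram_poly 0 * theta ^+ 0 =
  2%:P + 5%:P * 'X^1 + (- 5%:R)%:P * 'X^3 + (- 2%:R)%:P * 'X^4 :> {poly rat}.
Proof. rewrite /gram_poly /theta !polyCN; ring. Qed.

Lemma gram_poly_expand01 : gram_poly 0 * theta ^+ 1 =
  2%:P + 7%:P * 'X^1 + 7%:P * 'X^2 + (- 7%:R)%:P * 'X^4 + (- 7%:R)%:P * 'X^5 + (- 2%:R)%:P * 'X^6 :> {poly rat}.
Proof. rewrite /gram_poly /theta !polyCN; ring. Qed.

Lemma gram_poly_expand10 : gram_poly 1 * theta ^+ 0 =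
  2%:P + 9%:P * 'X^1 + 12%:P * 'X^2 + (- 12%:R)%:P * 'X^4 + (- 9%:R)%:P * 'X^5 + (- 2%:R)%:P * 'X^6 :> {poly rat}.
Proof. rewrite /gram_poly /theta !polyCN; ring. Qed.

Lemma gram_poly_expand11 : gram_poly 1 * theta ^+ 1 =
  2%:P + 11%:P * 'X^1 + 23%:P * 'X^2 + 21%:P * 'X^3 + (- 21%:R)%:P * 'X^5 + (- 23%:R)%:P * 'X^6 + (- 11%:R)%:P * 'X^7 + (- 2%:R)%:P * 'X^8 :> {poly rat}.
Proof. rewrite /gram_poly /theta !polyCN; ring. Qed.

Lemma gram_coef_small0 :
   gram_coef 0 0 0 = 0 /\
   gram_coef 0 0 1 = 2 /\
   gram_coef 0 1 0 = - 2 /\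
   gram_coef 0 0 2 = 2 /\
   gram_coef 0 1 1 = 0 /\
   gram_coef 0 2 0 = - 2 /\
   gram_coef 0 0 3 = 2 /\
   gram_coef 0 1 2 = 7%:R /\
   gram_coef 0 2 1 = - 7%:R /\
   gram_coef 0 3 0 = - 2.
Proof.
do !split; rewrite // /gram_coef [(2 <= _)%N]/= [(_ - 2)%N]/= ?gram_poly_expand00 ?gram_poly_expand01.
all: by rewrite !coefE /= ?mulr0 ?mulr1 ?addr0 ?add0r.
Qed.

Lemma gram_coef_small1 :
   gram_coef 1 0 0 = 0 /\
   gram_coef 1 0 1 = 7%:R /\
   gram_coef 1 1 0 = - 7%:R /\
   gram_coef 1 0 2 = 9%:R /\
   gram_coef 1 1 1 = 0 /\
   gram_coef 1 2 0 = - 9%:R /\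
   gram_coef 1 0 3 = 11%:R /\
   gram_coef 1 1 2 = 21%:R /\
   gram_coef 1 2 1 = - 21%:R /\
   gram_coef 1 3 0 = - 11%:R.
Proof.
do !split; rewrite // /gram_coef [(2 <= _)%N]/= [(_ - 2)%N]/= ?gram_poly_expand10 ?gram_poly_expand11.
all: by rewrite !coefE /= ?mulr0 ?mulr1 ?addr0 ?add0r.
Qed.

(** The finitely many entries below the reach of [gram_shiftE], with their values abstracted so that
    both parities share the check. *)
Lemma shift_small (g : nat -> nat -> rat) (c d : nat -> rat) i j :
  let S a b := if (a <= i)%N && (b <= j)%N then g (i - a)%N (j - b)%N else 0 in
  g 0%N 0%N = 0 -> g 1%N 1%N = 0 -> g 1%N 0%N = - g 0%N 1%N -> g 2 0%N = - g 0%N 2 ->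
  g 3 0%N = - g 0%N 3 -> g 2 1%N = - g 1%N 2 ->
  c 2 = 0 -> c 3 = 0 -> d 3 = 0 ->
  g 0%N 1%N = c 0%N * d 1%N - d 0%N * c 1%N -> g 0%N 2 = 2 * g 0%N 1%N + c 0%N * d 2 ->
  g 0%N 3 = 2 * g 0%N 2 - g 0%N 1%N -> g 1%N 2 = 2 * g 0%N 2 + c 1%N * d 2 ->
  (i + j < 4)%N ->
  S 0%N 0%N - 2 * S 1%N 0%N - 2 * S 0%N 1%N + S 2 0%N + S 1%N 1%N + S 0%N 2 = c i * d j - d i * c j.
Proof.
move=> S g00 g11 g10 g20 g30 g21 c2 c3 d3 g01 g02 g03 g12 ij; rewrite /S {S}.
have [hi hj] : (i < 4)%N /\ (j < 4)%N by lia.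
case: i hi ij => [|[|[|[|i]]]] // _; case: j hj => [|[|[|[|j]]]] // _ _;
  rewrite /= ?subn0 ?subSS ?subn0 ?g00 ?g11 ?g10 ?g20 ?g30 ?g21 ?g03 ?g12 ?g02 ?g01 ?c2 ?c3 ?d3; ring.
Qed.

(** The coefficients on the left are those of [cubic_dd]. For 4 <= i + j the right side vanishes by
    degree, except at i = j = 2, where it does by antisymmetry. *)
Lemma gram_recurrence e i j : (e <= 1)%N ->
  gram_shift e i j 0 0 - 2 * gram_shift e i j 1 0 - 2 * gram_shift e i j 0 1
  + gram_shift e i j 2 0 + gram_shift e i j 1 1 + gram_shift e i j 0 2 =
  (nu1 e)`_i * (nu2 e)`_j - (nu2 e)`_i * (nu1 e)`_j.
Proof.
move=> e1; case: (leqP 4 (i + j)) => ij.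
  rewrite !gram_shiftE //=; set d := (_ - 4)%N; set g := gram_poly e.
  set s := (i.*2 + e)%N.
  transitivity ((g * theta ^+ d * (theta ^+ 2 - 2%:P * ('X^2 * theta) - 2%:P * theta
     + 'X^4 + 'X^2 + 1))`_s).
    rewrite !expr0 !mul1r !addn0 !subn0 ?subnn ?addn0 ?(addn1, addn2) !exprS.
    have c2 (p : {poly rat}) : 2 * p`_s = (2%:P * p)`_s by rewrite coefCM.
    rewrite !c2 -!(coefB, coefD); apply: (congr1 (fun p : {poly rat} => p`_s)); ring.
  (* This is [cubic_dd] at x = X^2/theta and y = 1/theta, cleared of denominators. *)
  rewrite (_ : theta ^+ 2 - _ - _ + _ + _ + _ = 0) ?mulr0 ?coef0; last first.
    by rewrite /theta; ring.
  have large k : (2 < k)%N -> (nu1 e)`_k = 0 /\ (nu2 e)`_k = 0.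
    case: k => [|[|[|k]]] // _; case: e e1 {d g s} => [|[|e]] // _.
      by have [-> ->] := nu_even; rewrite !coefE /= !mulr0 !addr0.
    by have [-> ->] := nu_odd; rewrite !coefE /= !mulr0 !addr0.
  have [/large[-> ->]|[/large[-> ->]|[-> ->]]] : (2 < i)%N \/ ((2 < j)%N \/ (i = 2 /\ j = 2)%N) by lia.
  - by rewrite !mul0r subrr.
  - by rewrite !mulr0 subrr.
  - by rewrite mulrC subrr.
case: e e1 => [|[|e]] // _.
- have [f1 f2] := nu_even.
  have [v00 [v01 [v10 [v02 [v11 [v20 [v03 [v12 [v21 v30]]]]]]]]] := gram_coef_small0.
  apply: (@shift_small (gram_coef 0) (fun k => (nu1 0)`_k) (fun k => (nu2 0)`_k) _ _ v00 v11);
    rewrite ?v00 ?v01 ?v10 ?v02 ?v11 ?v20 ?v03 ?v12 ?v21 ?v30 ?f1 ?f2 ?coefE /=;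
    solve [exact: ij | by field].
- have [f1 f2] := nu_odd.
  have [v00 [v01 [v10 [v02 [v11 [v20 [v03 [v12 [v21 v30]]]]]]]]] := gram_coef_small1.
  apply: (@shift_small (gram_coef 1) (fun k => (nu1 1)`_k) (fun k => (nu2 1)`_k) _ _ v00 v11);
    rewrite ?v00 ?v01 ?v10 ?v02 ?v11 ?v20 ?v03 ?v12 ?v21 ?v30 ?f1 ?f2 ?coefE /=;
    solve [exact: ij | ring].
Qed.

Definition gram_kernel e n : {poly {poly rat}} :=
  \poly_(j < n) \poly_(i < n) gram_coef e i j.

Lemma coef_gram_kernel e n i j : (i < n)%N -> (j < n)%N ->
  ((gram_kernel e n)`_j)`_i = gram_coef e i j.
Proof. by move=> hi hj; rewrite coef_poly hj coef_poly hi. Qed.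

Lemma coef_gram_kernel_shift e n i j a b : (i < n)%N -> (j < n)%N ->
  (('X%:P ^+ a * 'X^b * gram_kernel e n)`_j)`_i = gram_shift e i j a b.
Proof.
move=> hi hj; rewrite -mulrA -polyC_exp coefCM coefXnM coefXnM /gram_shift.
case: (ltnP i a) => ia /=; first by [].
case: (ltnP j b) => jb /=; first by rewrite coef0.
by rewrite coef_gram_kernel //; apply: leq_ltn_trans (leq_subr _ _) _.
Qed.

Lemma gram_kernel_congr e n : (e <= 1)%N ->
  congr2 n (cubic_dd * gram_kernel e n) ((nu1 e)%:P * (nu2 e)^:P - (nu2 e)%:P * (nu1 e)^:P).
Proof.
move=> e1 i j hi hj; rewrite coefB !coefCM !coef_map /= coefB !coefMC -gram_recurrence //.
have -> : cubic_dd * gram_kernel e n =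
   'X%:P ^+ 0 * 'X^0 * gram_kernel e n - 2%:P%:P * ('X%:P ^+ 1 * 'X^0 * gram_kernel e n)
   - 2%:P%:P * ('X%:P ^+ 0 * 'X^1 * gram_kernel e n) + 'X%:P ^+ 2 * 'X^0 * gram_kernel e n
   + 'X%:P ^+ 1 * 'X^1 * gram_kernel e n + 'X%:P ^+ 0 * 'X^2 * gram_kernel e n.
  rewrite /cubic_dd; ring.
by rewrite !(coefD, coefN, coefCM) !coef_gram_kernel_shift.
Qed.

Lemma nu_wedge e : (e <= 1)%N ->
  exists N : {poly {poly rat}},
  (nu1 e)%:P * (nu2 e)^:P - (nu2 e)%:P * (nu1 e)^:P = ('X - 'X%:P) * N.
Proof.
rewrite /nu1 /nu2; case: e => [|[|e]] // _ /=.
  exists ((9%:R^-1)%:P%:P * (- 18%:R + 18%:R * 'X%:P + 18%:R * 'X - 27%:R * 'X * 'X%:P) * -1).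
  rewrite /nu1_even /nu2_even /chebE /= /cheb1 -!mul_polyC !polyCN.
  rewrite !(rmorphM, rmorphB, rmorphN, rmorph_nat) /= !map_polyC /= !map_polyX; ring.
exists (7%:R - 5%:R * 'X%:P - 5%:R * 'X + 3%:R * 'X * 'X%:P).
rewrite /nu1_odd /nu2_odd -!mul_polyC.
rewrite !(rmorphM, rmorphXn, rmorphB, rmorph_nat, rmorph1) /= !map_polyX; ring.
Qed.

(** * The minor sum of the path matrix *)

Definition path_mx e n M : 'M[rat]_(n, M) := \matrix_(i, r) (step_poly ^+ (i + e))`_r.

Lemma det_alternating_U_neq0 N : \det (alternating_mx N 1 'X) != 0.
Proof.
rewrite -normr_gt0 normr_det_U; apply: prodr_gt0 => k _; rewrite normr_gt0.
have kmono i : (i < k)%N -> (kap i < kap k)%N.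
  by move=> ik; rewrite /kap ltnS -addSn leq_add // half_leq // ltnW.
rewrite !mulf_neq0 ?invr_neq0 ?expf_neq0 ?fact_neq0 ?pnatr_eq0 //.
  apply/prodf_neq0 => i _; rewrite subr_eq0 eq_sym eqrXn2 ?ler0n // eqr_nat.
  by rewrite neq_ltn kmono.
by rewrite mulf_neq0 ?expf_neq0 //; case: ifP.
Qed.

Lemma factorial_product_gt0 n : 0 < factorial_product n.
Proof. by rewrite /factorial_product prodr_gt0 // => i _; rewrite divr_gt0 ?ltr0n ?fact_gt0. Qed.

Lemma normr_det_nu e m : (e <= 1)%N ->
  `|\det (alternating_mx m.*2 (nu1 e) (nu2 e))| * `|\det (alternating_mx m.*2 1 'X)| =
  factorial_product (m.*2 + e).
Proof.
case: e => [|[|e]] // _; first by rewrite addn0 -normr_det_even.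
by rewrite addn1 -normr_det_odd.
Qed.

Lemma minor_sum_path_double e m M : (e <= 1)%N -> (m.*2.*2 + 4 < M)%N ->
  `|minor_sum (path_mx e m.*2 M)| = factorial_product (m.*2 + e).
Proof.
move=> e1; rewrite -normr_det_nu // -(addnn m) => mM.
(* Monic polynomials in [step_poly] amount to a unitriangular row operation, which puts [gram_basis]
   in place of the powers. *)
pose gam i : {poly rat} := if i is i'.+1 then ('X - 2%:P) * ('X - (-1)%:P) ^+ i' else 1.
have gamE i : gram_basis e i = step_poly ^+ e * (gam i \Po step_poly).
  rewrite /gram_basis; congr (_ * _); case: i => [|i]; first by rewrite -[1]/(1%:P) comp_polyC.
  rewrite /gam comp_polyM comp_polyB comp_polyC comp_polyX rmorphXn /= comp_polyB comp_polyX.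
  rewrite comp_polyC mulrA polyCN; congr (_ * _ ^+ _).
    by rewrite /step_poly; ring.
  by rewrite /theta /step_poly; ring.
have mgam i : gam i \is monic.
  case: i => [|i]; first exact: monic1.
  by rewrite monicMl ?monicXsubC // monic_exp ?monicXsubC.
have sgam i : size (gam i) = i.+1.
  case: i => [|i]; first by rewrite size_polyC oner_eq0.
  by rewrite size_monicM ?monicXsubC ?monic_neq0 ?monic_exp ?monicXsubC // size_XsubC size_exp_XsubC.
pose B : 'M[rat]_(m + m) := \matrix_(i, j) (gam i)`_j.
have detB : \det B = 1.
  rewrite det_trig; last by apply/is_trig_mxP => i j ij; rewrite mxE nth_default // sgam.
  by rewrite big1 // => i _; rewrite mxE; have := monicP (mgam i); rewrite lead_coefE sgam.
have TE : B *m path_mx e (m + m) M = \matrix_(i, r) (gram_basis e i)`_r.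
  apply/matrixP => i r; rewrite !mxE gamE comp_polyE mulr_sumr coef_sum sgam.
  rewrite (big_ord_widen (m + m) (fun k => (step_poly ^+ e * ((gam i)`_k *: step_poly ^+ k))`_r)) //.
  rewrite [RHS]big_mkcond; apply: eq_bigr => k _; rewrite !mxE ltnS.
  case: leqP => ki; last by rewrite nth_default ?mul0r // sgam.
  by rewrite -scalerAr coefZ -exprD addnC.
have -> : minor_sum (path_mx e (m + m) M) = minor_sum (\matrix_(i < m + m, r < M) (gram_basis e i)`_r).
  by rewrite -TE minor_sum_mul detB mul1r.
have [N hN] := nu_wedge e1.
refine (@normr_minor_sum_kernel m M _ (gram_kernel e (m + m)%N) N (nu1 e) (nu2 e) det_alternating_U_neq0 _ hN (@gram_kernel_congr e (m + m)%N e1) _).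
  have := factorial_product_gt0 (m.*2 + e); rewrite -normr_det_nu // -(addnn m) => h.
  by rewrite -normr_gt0; move: h; rewrite pmulr_lgt0 // normr_gt0 det_alternating_U_neq0.
apply/matrixP => i j; rewrite [RHS]mxE coef_gram_kernel //.
have hk (k : 'I_(m + m)) : (e.*2 + k.*2 < M)%N by have := ltn_ord k; lia.
rewrite -(order_form_gram e1 (hk i) (hk j)) mxE /order_form exchange_big.
apply: eq_bigr => s _; rewrite !mxE mulr_suml.
by apply: eq_bigr => r _; rewrite !mxE.
Qed.

(** Row 0 is (1, 0, 0, ...) and X divides all other rows. Path 0 thus ends at 0 and the others
    contribute only when they end to its right, so dropping it changes no sign. *)
Lemma minor_sum_path_odd n M :
  minor_sum (path_mx 0 n.+1 M.+1) = minor_sum (path_mx 1 n M.+1).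
Proof.
rewrite /minor_sum (sum_ffun_insert ord0) /= (bigD1 ord0) //= [X in _ + X]big1 ?addr0; last first.
  move=> a a0; rewrite big1 // => h _; rewrite big_ord_recl ffun_insert_at mxE.
  by rewrite addn0 expr0 coef1 -[_ == 0%N]/(a == ord0) (negPf a0) !mul0r.
apply: eq_bigr => h _; rewrite big_ord_recl ffun_insert_at mxE addn0 expr0 coef1 mul1r.
rewrite [X in X * _ = _](eq_bigr (fun i => path_mx 1 n M.+1 i (h i))); last first.
  by move=> i _; rewrite ffun_insert_lift !mxE /= /bump /= add1n addn0 addn1.
have [/existsP[i /eqP hi]|/existsPn h0] := boolP [exists i, h i == ord0].
  by rewrite (bigD1 i) //= mxE hi addn1 exprS /step_poly -mulrA coefXM !mul0r.
congr (_ * _); rewrite /vandermonde_sign big_ord_recl /= big1 ?mul1r; last first.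
  move=> j; case: (unliftP ord0 j) => [i ->|->] // _.
  rewrite ffun_insert_lift ffun_insert_at gtr0_sg // subr0 ltr0n lt0n.
  exact: h0.
apply: eq_bigr => i _; rewrite big_mkcond big_ord_recl /= mul1r [RHS]big_mkcond.
by apply: eq_bigr => j _; rewrite ltnS !ffun_insert_lift.
Qed.

Theorem minor_sum_path n M : (0 < n)%N -> (n.*2 + 4 < M)%N ->
  `|minor_sum (path_mx 0 n M)| = factorial_product n.
Proof.
case: M => // M; case: n => // n _ hM; have := odd_double_half n.+1.
move: (n.+1)./2 => m; case: (odd n.+1) => e.
  have {e} en : n = m.*2 by lia.
  rewrite minor_sum_path_odd en (minor_sum_path_double (e := 1)) ?addn1 //.
  by move: hM; rewrite en; lia.
rewrite add0n in e; move: hM; rewrite -e => hM.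
by rewrite (minor_sum_path_double (e := 0)) ?addn0 //; lia.
Qed.

(** * Nonintersecting paths *)

(** Entry (i, k) is the step of path i from line k + 1 to line k, which occurs only for k < i
    ([triangular]). *)
Definition array n := {ffun 'I_n -> {ffun 'I_n -> bool}}.

(* False outside of the array.                                                *)
Definition entry n (b : array n) (i k : nat) : bool :=
  if insub i is Some i' then if insub k is Some k' then b i' k' else false else false.

Definition triangular n (b : array n) :=
  [forall i : 'I_n, forall k : 'I_n, (i <= k)%N ==> ~~ b i k].

(* The abscissa on line d of the path that starts at the point (i, i).        *)
Definition pos n (b : array n) (i d : nat) : nat :=
  (i + \sum_(d <= k < i) entry b i k)%N.

Definition ordered_at n (b : array n) (d : nat) :=
  [forall i : 'I_n, (d <= i)%N && (i.+1 < n)%N ==> (pos b i d < pos b i.+1 d)%N].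

Definition ordered_from n (b : array n) (d : nat) :=
  [forall e : 'I_n, (d <= e)%N ==> ordered_at b e].

Definition path_arrays n : {set array n} :=
  [set b | triangular b && ordered_from b 0].

Lemma entryE n (b : array n) (i k : 'I_n) : entry b i k = b i k.
Proof. by rewrite /entry !valK. Qed.

Lemma entry_range n (b : array n) i k : entry b i k -> (i < n)%N && (k < n)%N.
Proof. by rewrite /entry; case: insubP => // i' -> _; case: insubP => // k' ->. Qed.

Lemma entry_ltn n (b : array n) i k : triangular b -> entry b i k -> (k < i)%N.
Proof.
move=> tb; rewrite /entry; case: insubP => // i' _ <-; case: insubP => // k' _ <- h.
by rewrite ltnNge; apply/negP => ik; move/forallP/(_ i')/forallP/(_ k'): tb; rewrite ik h.
Qed.

Lemma pos_step n (b : array n) i d : (d < i)%N -> pos b i d = (pos b i d.+1 + entry b i d)%N.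
Proof. by move=> di; rewrite /pos big_ltn // [(entry b i d + _)%N]addnC addnA. Qed.

Lemma pos_diag n (b : array n) i : pos b i i = i.
Proof. by rewrite /pos big_geq ?addn0. Qed.

Lemma pos_cat n (b : array n) i d : (d <= i)%N ->
  pos b i 0 = (pos b i d + \sum_(0 <= k < d) entry b i k)%N.
Proof. by move=> di; rewrite /pos (big_cat_nat (n := d)) //= -addnA [X in (i + X)%N]addnC. Qed.

Lemma leq_pos n (b : array n) i d : (i <= pos b i d)%N.
Proof. exact: leq_addr. Qed.

Lemma pos_leq n (b : array n) i d : (d <= i)%N -> (pos b i d + d <= i.*2)%N.
Proof.
move=> di; rewrite /pos -addnn -addnA leq_add2l.
apply: leq_trans (_ : (\sum_(d <= k < i) 1 + d <= i)%N).
  by rewrite leq_add2r; apply: leq_sum => k _; case: entry.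
by rewrite sum_nat_const_nat muln1 subnK.
Qed.

Lemma ordered_fromS n (b : array n) d : (d < n)%N ->
  ordered_from b d = ordered_at b d && ordered_from b d.+1.
Proof.
move=> dn; apply/forallP/andP => [h|[h0 /forallP h] e].
  split; first by have := h (Ordinal dn); rewrite leqnn.
  by apply/forallP => e; apply/implyP => de; apply: (implyP (h e)); apply: ltnW.
by rewrite leq_eqVlt; case: eqP => [<- //|_] /=; exact: h.
Qed.

(** * Exchange of tails *)

Definition swap_tails n (b : array n) (d a : nat) : array n :=
  [ffun i : 'I_n => [ffun k : 'I_n =>
    if (k < d)%N then entry b (if i == a :> nat then a.+1 else if i == a.+1 :> nat then a else i) k
    else b i k]].

Lemma entry_swap_tails n (b : array n) d a i k : (a.+1 < n)%N ->
  entry (swap_tails b d a) i k =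
  entry b (if (k < d)%N then (if i == a then a.+1 else if i == a.+1 then a else i) else i) k.
Proof.
move=> an; case: (ltnP k n) => kn; last first.
  by apply/idP/idP => /entry_range/andP[_]; rewrite ltnNge kn.
case: (ltnP i n) => hi; last first.
  apply/idP/idP => /entry_range/andP[]; first by rewrite ltnNge hi.
  by move=> h _; move: h hi an; do ?case: ifP => [|_]; rewrite ?ltnNge; lia.
have /= -> := entryE (swap_tails b d a) (Ordinal hi) (Ordinal kn).
by rewrite !ffunE /=; case: ifP => // _; rewrite -entryE.
Qed.

Lemma swap_tailsK n (b : array n) d a : (a.+1 < n)%N ->
  swap_tails (swap_tails b d a) d a = b.
Proof.
move=> an; apply/ffunP => i; apply/ffunP => k.
rewrite -!entryE !entry_swap_tails //; congr entry.
by case: (k < d)%N => //; do ?case: ifP; lia.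
Qed.

Lemma pos_swap_tails_high n (b : array n) d a i e : (a.+1 < n)%N -> (d <= e)%N ->
  pos (swap_tails b d a) i e = pos b i e.
Proof.
move=> an de; rewrite /pos; congr addn; apply: eq_big_nat => k /andP[ek _].
by rewrite entry_swap_tails // ltnNge (leq_trans de ek).
Qed.

Lemma pos_swap_tails_end n (b : array n) d a i : (a.+1 < n)%N -> (d <= a)%N ->
  pos b a d = pos b a.+1 d -> triangular b ->
  pos (swap_tails b d a) i 0 = pos b (if i == a then a.+1 else if i == a.+1 then a else i) 0.
Proof.
move=> an da e tb; have da1 : (d <= a.+1)%N by apply: leqW.
have tail j : (d <= j)%N -> (\sum_(0 <= k < d) entry (swap_tails b d a) j k =
    \sum_(0 <= k < d) entry b (if j == a then a.+1 else if j == a.+1 then a else j) k)%N.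
  by move=> dj; apply: eq_big_nat => k /andP[_ kd]; rewrite entry_swap_tails // kd.
case: (i =P a) => [->|ia].
  by rewrite (pos_cat _ da) pos_swap_tails_high // tail // eqxx e -(pos_cat _ da1).
case: (i =P a.+1) => [->|ia1].
  rewrite (pos_cat _ da1) pos_swap_tails_high // tail // eqxx -e.
  have -> : (a.+1 == a) = false by apply/eqP; lia.
  by rewrite -(pos_cat _ da).
rewrite /pos; congr addn; apply: eq_big_nat => k _; rewrite entry_swap_tails //.
by case: ifP => // _; case: eqP => // _; case: eqP.
Qed.

Lemma triangular_swap_tails n (b : array n) d a : (a.+1 < n)%N -> (d <= a)%N ->
  triangular b -> triangular (swap_tails b d a).
Proof.
move=> an da tb; apply/forallP => i; apply/forallP => k; apply/implyP => ik.
rewrite -entryE entry_swap_tails //; apply/negP => /(entry_ltn tb).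
by do ?case: ifP; lia.
Qed.

Definition collision n (b : array n) (d : nat) (i : 'I_n) :=
  [&& (d <= i)%N, (i.+1 < n)%N & pos b i d == pos b i.+1 d].

(** Steps move by 0 or 1, so neighbours in strict order on line d + 1 can at worst meet on line d;
    the path that begins on line d lies to the left of its neighbour by [leq_pos]. *)
Lemma not_ordered_collision n (b : array n) d : triangular b ->
  ordered_from b d.+1 -> ~~ ordered_at b d -> exists i, collision b d i.
Proof.
move=> tb /forallP od /forallPn[i]; rewrite negb_imply -leqNgt => /andP[/andP[di hi] le].
exists i; rewrite /collision di hi eqn_leq le andbT.
move: di; rewrite leq_eqVlt => /orP[/eqP e|di].
  by subst d; rewrite pos_diag (leq_trans (leqnSn i)) ?leq_pos.
have dn : (d.+1 < n)%N by lia.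
have /forallP/(_ i) := implyP (od (Ordinal dn)) (leqnn _); rewrite /= di hi /=.
have di1 : (d < i.+1)%N by apply: ltnW.
by rewrite (pos_step b di) (pos_step b di1); case: entry; case: entry; lia.
Qed.

Lemma pos_mono n (b : array n) d i j : b \in path_arrays n -> (d <= i)%N -> (i < j)%N -> (j < n)%N ->
  (pos b i d < pos b j d)%N.
Proof.
rewrite inE => /andP[_ ob] di ij jn.
have step k : (d <= k)%N -> (k.+1 < n)%N -> (pos b k d < pos b k.+1 d)%N.
  move=> dk kn; have dn : (d < n)%N by lia.
  have /forallP/(_ (Ordinal (ltnW kn))) := implyP (forallP ob (Ordinal dn)) isT.
  by rewrite /= dk kn.
elim: j ij jn => // j IH; rewrite ltnS leq_eqVlt => /orP[/eqP <-|ij] jn; first exact: step.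
by apply: ltn_trans (IH ij (ltnW jn)) _; apply: step; lia.
Qed.

(** The picked index depends only on the positions on line d, which the exchange below that line
    preserves; this makes the map an involution. *)
Definition swap_collision n d (b : array n) : array n :=
  if [pick i | collision b d i] is Some a then swap_tails b d a else b.

Lemma pick_swap_tails n d (b : array n) a : (a.+1 < n)%N ->
  [pick i | collision (swap_tails b d a) d i] = [pick i | collision b d i].
Proof.
by move=> an; apply: eq_pick => i; rewrite /collision !pos_swap_tails_high.
Qed.

Lemma swap_collisionK n d : involutive (@swap_collision n d).
Proof.
move=> b; rewrite /swap_collision; case E: [pick i | collision b d i] => [a|].
  move: (E); case: pickP => // c /and3P[dc cn _] [ca]; rewrite ca in cn.
  by rewrite pick_swap_tails // E swap_tailsK.
by rewrite E.
Qed.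

(** On the way down, the first failure of the order is on line d. *)
Definition unordered n d (b : array n) :=
  [&& triangular b, ordered_from b d.+1 & ~~ ordered_at b d].

Lemma ordered_at_swap_tails n (b : array n) d e a : (a.+1 < n)%N -> (d <= e)%N ->
  ordered_at (swap_tails b d a) e = ordered_at b e.
Proof. by move=> an de; apply: eq_forallb => i; rewrite !pos_swap_tails_high. Qed.

Lemma unordered_swap_tails n d (b : array n) a : (a.+1 < n)%N -> (d <= a)%N ->
  unordered d (swap_tails b d a) = unordered d b.
Proof.
move=> an da; rewrite /unordered ordered_at_swap_tails //; congr (_ && (_ && _)).
  apply/idP/idP => [h|]; last exact: triangular_swap_tails.
  by rewrite -(swap_tailsK b d an); apply: triangular_swap_tails.
apply: eq_forallb => e; case: (ltnP d e) => //= de.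
by rewrite ordered_at_swap_tails // ltnW.
Qed.

Lemma unordered_swap_collision n d (b : array n) :
  unordered d (swap_collision d b) = unordered d b.
Proof.
rewrite /swap_collision; case: pickP => // a /and3P[da an _].
exact: unordered_swap_tails.
Qed.

Definition end_sign n (b : array n) := vandermonde_sign (fun i : 'I_n => pos b i 0).

Lemma end_sign_swap n d (b : array n) : unordered d b ->
  end_sign (swap_collision d b) = - end_sign b.
Proof.
case/and3P => tb ob nb; have [c cc] := not_ordered_collision tb ob nb.
rewrite /swap_collision; case: pickP => [a /and3P[da an /eqP e]|/(_ c)]; last by rewrite cc.
pose s := tperm a (Ordinal an).
have ne : a != Ordinal an by apply/eqP => /(congr1 val) /= h; lia.
rewrite -[RHS]mulN1r -[-1]/((-1) ^+ true) -{1}ne -(odd_tperm a (Ordinal an)) -vandermonde_sign_perm.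
apply: eq_vandermonde_sign => i; rewrite pos_swap_tails_end //; congr pos.
case: tpermP => [->|->|/eqP h1 /eqP h2] /=.
- by rewrite eqxx.
- by rewrite eqxx; case: eqP => // h; lia.
- rewrite [i == a :> nat](negPf h1).
  by case: eqP => // h; case/eqP: h2; apply: val_inj.
Qed.

Lemma sum_end_sign_unordered n d :
  \sum_(b : array n | unordered d b) end_sign b = 0.
Proof.
set S := \sum_(b | _) _; have : S = - S; last by move=> h; lra.
rewrite {1}/S (reindex_inj (inv_inj (@swap_collisionK n d))) /= -sumrN.
by apply: eq_big => [b|b]; rewrite unordered_swap_collision //; exact: end_sign_swap.
Qed.

Lemma sum_end_sign_step n d : (d < n)%N ->
  \sum_(b : array n | triangular b && ordered_from b d) end_sign b =
  \sum_(b : array n | triangular b && ordered_from b d.+1) end_sign b.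
Proof.
move=> dn; rewrite [RHS](bigID (fun b => ordered_at b d)) /= [X in _ + X](_ : _ = 0) ?addr0.
  apply: eq_bigl => b; rewrite ordered_fromS //.
  by case: (triangular b) => //=; rewrite andbC.
rewrite -[RHS](sum_end_sign_unordered n d); apply: eq_bigl => b.
by rewrite /unordered andbA.
Qed.

(** Imposing the order line by line downwards loses only families that cancel in pairs, and a fully
    ordered family has sign 1. *)
Lemma card_path_arrays n :
  #|path_arrays n|%:R = \sum_(b : array n | triangular b) end_sign b.
Proof.
transitivity (\sum_(b : array n | triangular b && ordered_from b 0) end_sign b).
  rewrite (eq_bigr (fun=> 1)) => [|b /andP[tb ob]].
    by rewrite sumr_const; congr (_ *+ _); apply: eq_card => b; rewrite !inE.
  apply: vandermonde_sign_incr => i j ij.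
  by apply: (pos_mono _ (leq0n i) ij (ltn_ord j)); rewrite inE tb.
have H d : (d <= n)%N -> \sum_(b : array n | triangular b && ordered_from b 0) end_sign b =
    \sum_(b : array n | triangular b && ordered_from b d) end_sign b.
  by elim: d => // d IH dn; rewrite IH ?(ltnW dn) // sum_end_sign_step.
rewrite (H n) //; apply: eq_bigl => b; case: (triangular b) => //=.
by apply/forallP => e; rewrite leqNgt ltn_ord.
Qed.

(** * Arrays and the path matrix *)

Lemma exp_one_plus_X n i : (i <= n)%N ->
  (1 + 'X) ^+ i = \sum_(b : {ffun 'I_n -> bool} | [forall k : 'I_n, (i <= k)%N ==> ~~ b k])
     'X^(\sum_(k < n) b k) :> {poly rat}.
Proof.
move=> hi.
pose F (k : 'I_n) (c : bool) : {poly rat} := if (i <= k)%N && c then 0 else 'X^c.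
transitivity (\prod_(k < n) \sum_(c : bool) F k c).
  rewrite (bigID (fun k : 'I_n => (k < i)%N)) /= [X in _ * X]big1 ?mulr1; last first.
    by move=> k; rewrite -leqNgt => ik; rewrite big_bool /F ik /= expr0 add0r.
  rewrite (eq_bigr (fun=> 1 + 'X)) => [|k ki].
    by rewrite -(big_ord_widen n (fun=> 1 + 'X) hi) prodr_const card_ord.
  by rewrite big_bool /F leqNgt ki /= expr1 expr0 addrC.
rewrite bigA_distr_bigA /= [RHS]big_mkcond; apply: eq_bigr => b _.
case: ifP => [/forallP h|/negbT/forallPn[k]].
  rewrite -prodrXr; apply: eq_bigr => k _; rewrite /F.
  by have := h k; case: (i <= k)%N; case: (b k).
by rewrite negb_imply negbK => bk; rewrite (bigD1 k) //= /F bk mul0r.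
Qed.

Definition row_end n i (r : {ffun 'I_n -> bool}) : nat := (i + \sum_(k < n) r k)%N.

Lemma path_mxE n M (i : 'I_n) (r : 'I_M) :
  path_mx 0 n M i r =
  \sum_(b : {ffun 'I_n -> bool} | [forall k : 'I_n, (i <= k)%N ==> ~~ b k])
     (row_end i b == r)%:R.
Proof.
rewrite mxE addn0 /step_poly exprMn (exp_one_plus_X (ltnW (ltn_ord i))) mulr_sumr coef_sum.
by apply: eq_bigr => b _; rewrite -exprD coefXn eq_sym.
Qed.

Lemma row_end_pos n (b : array n) (i : 'I_n) : triangular b -> row_end i (b i) = pos b i 0.
Proof.
move=> tb; rewrite /row_end /pos big_mkord; congr addn.
rewrite (big_ord_widen n (fun k => entry b i k : nat) (ltnW (ltn_ord i))) [RHS]big_mkcond.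
apply: eq_bigr => k _; rewrite entryE; case: ltnP => // ik.
by move/forallP/(_ i)/forallP/(_ k): tb; rewrite ik /= => /negbTE ->.
Qed.

(** Each matrix entry is a sum over rows of bits. Expanding the products gives a sum over arrays in
    which only the f recording the ends survives; path i ends at most at 2i, below M. *)
Lemma sum_end_sign n M : (n.*2 <= M)%N ->
  \sum_(b : array n | triangular b) end_sign b = minor_sum (path_mx 0 n M).
Proof.
move=> nM; rewrite /minor_sum.
pose F (i : 'I_n) (r : 'I_M) (b : {ffun 'I_n -> bool}) : rat :=
  if [forall k : 'I_n, (i <= k)%N ==> ~~ b k] then (row_end i b == r)%:R else 0.
transitivity (\sum_(f : {ffun 'I_n -> 'I_M}) \sum_(b : array n)
    (\prod_i F i (f i) (b i)) * vandermonde_sign (fun i => f i)); last first.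
  apply: eq_bigr => f _; rewrite -mulr_suml; congr (_ * _).
  rewrite -(bigA_distr_bigA (fun i b => F i (f i) b)); apply: eq_bigr => i _.
  by rewrite path_mxE [RHS]big_mkcond.
rewrite exchange_big big_mkcond; apply: eq_bigr => b _ /=.
case: ifP => [tb|/negbT/forallPn[i ti]]; last first.
  rewrite big1 // => f _; rewrite (bigD1 i) //= /F ifF ?mul0r //; exact/negbTE.
have eM (i : 'I_n) : (pos b i 0 < M)%N.
  by have := pos_leq b (leq0n i); have := ltn_ord i; lia.
rewrite (bigD1 [ffun i => Ordinal (eM i)]) //= [X in _ = _ + X]big1 ?addr0.
  rewrite [X in _ = X * _]big1 ?mul1r => [|i _].
    by rewrite /end_sign; apply: eq_vandermonde_sign => i; rewrite ffunE.
  rewrite /F ffunE /= row_end_pos // eqxx ifT //.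
  by move/forallP: tb; apply.
move=> f nf; have [i ni] : exists i, f i != Ordinal (eM i).
  apply/existsP; apply: contraR nf => /existsPn h; apply/eqP/ffunP => i.
  by rewrite ffunE; apply/eqP; move: (h i); rewrite negbK.
rewrite (bigD1 i) //= /F row_end_pos //; case: ifP => _; last by rewrite !mul0r.
case: eqP => [e|_]; last by rewrite !mul0r.
by case/eqP: ni; apply: val_inj.
Qed.

Theorem card_path_arraysE n : (0 < n)%N -> #|path_arrays n|%:R = factorial_product n.
Proof.
move=> n0; rewrite -(@minor_sum_path n (n.*2 + 5)) //; last by lia.
by rewrite -sum_end_sign ?leq_addr // -card_path_arrays ger0_norm ?ler0n.
Qed.

(** * Lozenges *)

Local Open Scope fset_scope.
Local Open Scope ring_scope.

(* The upward unit triangles have s = 1 and the downward ones s = -1. The     *)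
(* sides of tri s p have the midpoints p + (s / 2) v for v = (1, 0), (0, 1),  *)
(* (1, 1), and neighbour s p v is the triangle on the other side.             *)
Definition tri (s : int) (p : point) : triangle :=
  [fset p; (p.1 + s, p.2); (p.1, p.2 + s)].

Definition is_sign (s : int) : bool := (s == 1) || (s == -1).

Definition is_side (v : point) : bool := [|| v == (1, 0), v == (0, 1) | v == (1, 1)].

Definition neighbour (s : int) (p v : point) : triangle :=
  tri (- s) (p.1 + s * v.1, p.2 + s * v.2).

Lemma in_tri s p q : (q \in tri s p) =
  [|| (q.1 == p.1) && (q.2 == p.2), (q.1 == p.1 + s) && (q.2 == p.2)
    | (q.1 == p.1) && (q.2 == p.2 + s)].
Proof. by case: p q => [a b] [c d]; rewrite !inE /= !xpair_eqE -!orbA. Qed.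

Lemma sqdist1 (p q : point) : sqdist p q = 1 ->
  exists d : point, [/\ p.1 = q.1 + d.1, p.2 = q.2 + d.2 &
    d \in [:: (1, 0); (-1, 0); (0, 1); (0, -1); (1, -1); (-1, 1)]].
Proof.
case: p q => [a b] [c d].
have -> : sqdist (a, b) (c, d) = (a - c) ^+ 2 + (a - c) * (b - d) + (b - d) ^+ 2 by [].
move=> e; exists (a - c, b - d) => /=; split; [lia|lia|].
have bound (u v : int) : u ^+ 2 + u * v + v ^+ 2 = 1 -> u = -1 \/ u = 0 \/ u = 1.
  move=> euv; have e4 : 3 * u ^+ 2 + (2 * v + u) ^+ 2 = 4.
    by transitivity (4 * (u ^+ 2 + u * v + v ^+ 2)); [ring | rewrite euv].
  have := sqr_ge0 (2 * v + u); move: ((2 * v + u) ^+ 2) e4 => w e4 w0.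
  have hu : u <= 1 by nia.
  have hu' : - 1 <= u by nia.
  by lia.
have h1 := bound _ _ e; have h2 : b - d = -1 \/ b - d = 0 \/ b - d = 1.
  by apply: (bound _ (a - c)); rewrite -e; ring.
by case: h1 => [|[|]] h; case: h2 => [|[|]] h'; move: e; rewrite h h'.
Qed.

Lemma unit_triangleP t : is_unit_triangle t -> exists s p, is_sign s /\ t = tri s p.
Proof.
case/andP => /eqP c3 /forallP d1.
have dist p q : p \in t -> q \in t -> p != q -> sqdist p q = 1.
  by move=> pt qt ne; have /forallP/(_ [` qt])/implyP := d1 [` pt]; move=> /(_ ne)/eqP.
have mt z : (z \in t) = (z \in enum_fset t) by [].
move: c3 (fset_uniq t); case: (enum_fset t) mt => [|p [|q [|r [|]]]] //= mt _.
rewrite !inE negb_or andbT => /andP[/andP[pq pr] qr].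
have pt : p \in t by rewrite mt !inE eqxx.
have qt : q \in t by rewrite mt !inE eqxx orbT.
have rt : r \in t by rewrite mt !inE eqxx !orbT.
have [[d1' d2'] [/= e1 e2 e3]] := sqdist1 (dist _ _ pt qt pq).
have [[e1' e2'] [/= f1 f2 f3]] := sqdist1 (dist _ _ pt rt pr).
have [[g1' g2'] [/= g1 g2 g3]] := sqdist1 (dist _ _ qt rt qr).
have key s u : is_sign s -> (forall z : point, (z \in [:: p; q; r]) = (z \in tri s u)) ->
    exists s p, is_sign s /\ t = tri s p.
  by move=> hs h; exists s, u; split => //; apply/fsetP => z; rewrite mt h.
have {}key s u : is_sign s -> (forall z1 z2 : int, [|| (z1 == p.1) && (z2 == p.2),
   (z1 == q.1) && (z2 == q.2) | (z1 == r.1) && (z2 == r.2)] = 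
   [|| (z1 == u.1) && (z2 == u.2), (z1 == u.1 + s) && (z2 == u.2)
    | (z1 == u.1) && (z2 == u.2 + s)]) -> exists s p, is_sign s /\ t = tri s p.
  move=> hs h; apply: (key s u hs) => -[z1 z2]; rewrite in_tri -h.
  by case: (p) (q) (r) => [? ?] [? ?] [? ?]; rewrite !inE !xpair_eqE.
clear mt pt qt rt dist d1.
move: e1 e2 f1 f2 g1 g2 e3 f3 g3 key; rewrite !inE !xpair_eqE.
case: p q r pq pr qr => [a b] [a' b'] [a'' b''] /= _ _ _ e1 e2 f1 f2 g1 g2.
have ha : a' = a - d1' by lia.
have hb : b' = b - d2' by lia.
have ha2 : a'' = a - e1' by lia.
have hb2 : b'' = b - e2' by lia.
have hg : g1' = e1' - d1' by lia.
have hg2 : g2' = e2' - d2' by lia.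
clear e1 e2 f1 f2 g1 g2; subst.
do 5?[case/orP]; case/andP => /eqP-> /eqP->;
do 5?[case/orP]; case/andP => /eqP-> /eqP-> => // _ key;
  solve [apply: (key 1 (a, b) isT) => z1 z2 /=; lia
  | apply: (key (-1) (a, b) isT) => z1 z2 /=; lia
  | apply: (key 1 (a - 1, b) isT) => z1 z2 /=; lia
  | apply: (key 1 (a, b - 1) isT) => z1 z2 /=; lia
  | apply: (key (-1) (a + 1, b) isT) => z1 z2 /=; lia
  | apply: (key (-1) (a, b + 1) isT) => z1 z2 /=; lia].
Qed.

Lemma card2P (K : choiceType) (A : {fset K}) : #|` A| = 2%N ->
  exists x y, x != y /\ A = [fset x; y].
Proof.
have mA z : (z \in A) = (z \in enum_fset A) by [].
move: (fset_uniq A); case: (enum_fset A) mA => [|x [|y []]] //= mA; rewrite inE andbT => xy _.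
by exists x, y; split => //; apply/fsetP => z; rewrite mA !inE.
Qed.

Lemma lozengeP l t : is_lozenge l -> t \in l ->
  exists u, [/\ l = [fset t; u], t != u, is_unit_triangle t, is_unit_triangle u & #|` t `&` u| = 2%N].
Proof.
case/and3P => /eqP/card2P[x [y [xy ->]]] /forallP tri2 /forallP meet.
have tri_of z : z \in [fset x; y] -> is_unit_triangle z by move=> h; apply: (tri2 [` h]).
have meet_of z w : z \in [fset x; y] -> w \in [fset x; y] -> z != w -> #|` z `&` w| = 2%N.
  by move=> hz hw ne; have /forallP/(_ [` hw])/implyP/(_ ne)/eqP := meet [` hz].
have mx : x \in [fset x; y] by rewrite !inE eqxx.
have my : y \in [fset x; y] by rewrite !inE eqxx orbT.
rewrite !inE => /orP[] /eqP ->.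
  by exists y; split => //; [apply: tri_of|apply: tri_of|apply: meet_of].
exists x; split; [by rewrite fsetUC|by rewrite eq_sym|by apply: tri_of|by apply: tri_of|].
by apply: meet_of; rewrite // eq_sym.
Qed.

(** Distinct triangles of equal orientation share at most one vertex; for opposite orientations, two
    common vertices leave three positions. *)
Lemma lozenge_neighbour l s p : is_lozenge l -> is_sign s -> tri s p \in l ->
  exists2 v, is_side v & l = [fset tri s p; neighbour s p v].
Proof.
move=> hl hs ht; have [u [-> tu _ /unit_triangleP[s' [p' [hs' eu]]]]] := lozengeP hl ht.
move: tu; rewrite {}eu => ne c2.
have [x [y [xy e]]] := card2P c2.
have : x \in tri s p `&` tri s' p' by rewrite e !inE eqxx.
have : y \in tri s p `&` tri s' p' by rewrite e !inE eqxx orbT.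
rewrite !in_fsetI !in_tri => /andP[y1 y2] /andP[x1 x2].
have [e1|[e1|[e1|e1]]] : (s' = s /\ p'.1 = p.1 /\ p'.2 = p.2) \/
    (s' = - s /\ p'.1 = p.1 + s /\ p'.2 = p.2) \/
    (s' = - s /\ p'.1 = p.1 /\ p'.2 = p.2 + s) \/
    (s' = - s /\ p'.1 = p.1 + s /\ p'.2 = p.2 + s).
- move: xy x1 x2 y1 y2 hs hs'; rewrite /is_sign {ne c2 e ht}.
  case: p p' x y => [a b] [a' b'] [c d] [c' d'] /=; rewrite xpair_eqE => xy x1 x2 y1 y2.
  by case/orP => /eqP hs; case/orP => /eqP hs'; subst; lia.
- case: e1 => e1 [e2 e3]; case/eqP: ne; rewrite e1.
  by congr tri; case: p e2 e3 {ht c2 e x1 y1} => ? ? /=; case: p' {x2 y2} => ? ? /= -> ->.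
- exists (1, 0) => //; rewrite /neighbour /=; case: e1 => -> [e2 e3].
  by rewrite mulr1 mulr0 addr0 -e2 -e3 -surjective_pairing.
- exists (0, 1) => //; rewrite /neighbour /=; case: e1 => -> [e2 e3].
  by rewrite mulr1 mulr0 addr0 -e2 -e3 -surjective_pairing.
- exists (1, 1) => //; rewrite /neighbour /=; case: e1 => -> [e2 e3].
  by rewrite mulr1 -e2 -e3 -surjective_pairing.
Qed.

Lemma tri_inj s s' p p' : is_sign s -> is_sign s' -> tri s p = tri s' p' -> s = s' /\ p = p'.
Proof.
move=> hs hs' /fsetP e.
have := e p; rewrite !in_tri !eqxx /=.
have := e (p.1 + s, p.2); rewrite !in_tri !eqxx /= orbT.
have := e (p.1, p.2 + s); rewrite !in_tri !eqxx /= !orbT.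
case: p p' {e} => [a b] [a' b'] /= h1 h2 h3.
suff [-> [-> ->]] : s = s' /\ a = a' /\ b = b' by [].
by move: hs hs' h1 h2 h3; rewrite /is_sign; case/orP => /eqP hs; case/orP => /eqP hs'; subst; lia.
Qed.

Lemma unit_tri s p : is_sign s -> is_unit_triangle (tri s p).
Proof.
move=> hs; have s0 : s != 0 by case/orP: hs => /eqP ->.
apply/andP; split.
  case: p => a b; rewrite /tri -fsetUA cardfsU1 cardfs2 !inE !xpair_eqE /=.
  by case/orP: hs => /eqP ->; lia.
apply/forallP => x; apply/forallP => y; apply/implyP => xy.
move: xy; rewrite -(inj_eq val_inj).
move: (valP x) (valP y); rewrite /= !in_tri; move: (fsval x) (fsval y) => {x y} [a b] [c d].
case: p => [e f] /= hx hy; rewrite xpair_eqE => ne.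
have -> : sqdist (a, b) (c, d) = (a - c) ^+ 2 + (a - c) * (b - d) + (b - d) ^+ 2 by [].
move: hs; rewrite /is_sign; case/orP => /eqP hs; subst s;
case/or3P: hx => /andP[/eqP? /eqP?]; case/or3P: hy => /andP[/eqP? /eqP?]; subst; lia.
Qed.

Lemma lozenge_tri s p v : is_sign s -> is_side v -> is_lozenge [fset tri s p; neighbour s p v].
Proof.
move=> hs hv; have hs' : is_sign (- s) by case/orP: hs => /eqP ->.
have ne : tri s p != neighbour s p v.
  by apply/eqP => /(tri_inj hs hs')[h _]; move: hs h; rewrite /is_sign; lia.
have c2 : #|` tri s p `&` neighbour s p v| = 2%N.
  pose x : point := if v == (0, 1) then p else (p.1 + s, p.2).
  pose y : point := if v == (1, 0) then p else (p.1, p.2 + s).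
  rewrite (_ : _ `&` _ = [fset x; y]) ?cardfs2.
    rewrite /x /y; case/or3P: hv => /eqP -> /=; case: (p) => ? ?; rewrite !xpair_eqE /=;
    by move: hs; rewrite /is_sign; lia.
  apply/fsetP => z; rewrite in_fsetI !in_tri !inE /x /y; case: (p) z => [a b] [c d].
  by case/or3P: hv => /eqP -> /=; rewrite !xpair_eqE; move: hs; rewrite /is_sign; 
    case/orP => /eqP ->; lia.
apply/and3P; split; first by rewrite cardfs2 ne.
  apply/forallP => x; have := valP x; rewrite /= in_fset2 => /orP[] /eqP ->; exact: unit_tri.
apply/forallP => x; apply/forallP => y; apply/implyP => xy.
have {xy} : val x != val y by [].
have := valP x; have := valP y; rewrite /= !in_fset2.
by case/orP => /eqP ->; case/orP => /eqP ->; rewrite ?eqxx // => _; rewrite ?c2 // fsetIC c2.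
Qed.

Lemma lozenge_normal l : is_lozenge l ->
  exists s p v, [/\ is_sign s, is_side v & l = [fset tri s p; neighbour s p v]].
Proof.
move=> hl; have : exists t, t \in l.
  by case/and3P: (hl) => /eqP/card2P[x [y [_ ->]]] _ _; exists x; rewrite !inE eqxx.
case=> t tl; have [u [_ _ /unit_triangleP[s [p [hs et]]] _ _]] := lozengeP hl tl.
move: tl; rewrite et => tl; have [v hv ->] := lozenge_neighbour hl hs tl.
by exists s, p, v.
Qed.

Lemma in_hexagon m (p : point) : (p \in hexagon m m m) =
  [&& - m%:Z <= p.1 <= m%:Z, 0 <= p.2 <= (m + m)%N%:Z & 0 <= p.1 + p.2 <= (m + m)%N%:Z].
Proof.
rewrite in_fset; case: p => x y; rewrite [LHS]inE; apply/andP/and3P => [[/allpairsP h s]|[hx hy s]].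
  by case: h => -[i j]; rewrite !mem_iota => -[/= hi hj [ex ey]]; move: s => /=; split; lia.
split=> //; apply/allpairsP; exists (absz (x + m%:Z), absz y); rewrite /= in hx hy s.
by rewrite !mem_iota /=; split; [lia|lia|congr pair; lia].
Qed.

Lemma triangles_in_tri m s p : is_sign s ->
  (tri s p \in triangles_in (hexagon m m m)) =
  [&& p \in hexagon m m m, (p.1 + s, p.2) \in hexagon m m m & (p.1, p.2 + s) \in hexagon m m m].
Proof.
move=> hs; rewrite in_fset [LHS]inE unit_tri // andbT fpowersetE /tri.
by rewrite !fsubUset !fsub1set -andbA.
Qed.

(** Doubled midpoints strictly inside the doubled hexagon: the side is not on the boundary. *)
Definition inner m (e : point) : bool :=
  [&& `|e.1| < (m + m)%N%:Z, `|e.2| < (m + m)%N%:Z & `|e.1 + e.2| < (m + m)%N%:Z].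

(* Twice the vector from the center of H(m,m,m) to the midpoint of a side.    *)
Definition side_mid m s (p v : point) : point :=
  (2 * p.1 + s * v.1, 2 * (p.2 - m%:Z) + s * v.2).

Lemma lozenges_in_tri m s p v : is_sign s -> is_side v ->
  ([fset tri s p; neighbour s p v] \in lozenges_in (hexagon m m m)) = inner m (side_mid m s p v).
Proof.
move=> hs hv; have hs' : is_sign (- s) by case/orP: hs => /eqP ->.
rewrite in_fset [LHS]inE lozenge_tri // andbT fpowersetE fsubUset !fsub1set.
rewrite !triangles_in_tri // !in_hexagon /inner /side_mid; case: p => x y /=.
by case/orP: hs => /eqP ->; case/or3P: hv => /eqP -> /=; lia.
Qed.

(** Six times the vector from the center to the midpoint of the common side. As a sum over vertices
    it commutes with linear symmetries whatever description of the lozenge is chosen. *)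
Definition weight m (l : lozenge) : point := \sum_(t <- l) \sum_(p <- t) (p - center m).

Lemma pairD (a b c d : int) : (a, b) + (c, d) = (a + c, b + d) :> point.
Proof. by []. Qed.

Lemma sum_tri m s p : is_sign s ->
  \sum_(q <- tri s p) (q - center m) = (3 * p.1 + s, 3 * (p.2 - m%:Z) + s) :> point.
Proof.
move=> hs; have s0 : s != 0 by case/orP: hs => /eqP ->.
rewrite /tri -fsetUA !big_fsetU1 ?big_seq_fset1 /=; last 2 first.
- by case: p => a b; rewrite !inE !xpair_eqE /=; lia.
- by case: p => a b; rewrite !inE !xpair_eqE /=; lia.
case: p => a b; rewrite /center /=.
have E (u v : int) : (u, v) - (0, m%:Z) = (u, v - m%:Z) :> point by congr pair; rewrite subr0.
by rewrite !E pairD; congr pair => /=; ring.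
Qed.

Lemma weight_tri m s p v : is_sign s -> is_side v ->
  weight m [fset tri s p; neighbour s p v] = side_mid m s p v *+ 3.
Proof.
move=> hs hv; have hs' : is_sign (- s) by case/orP: hs => /eqP ->.
rewrite /weight big_fsetU1 ?big_seq_fset1 /= ?sum_tri //; last first.
  by rewrite inE; apply/eqP => /(tri_inj hs hs')[h _]; move: hs h; rewrite /is_sign; lia.
by rewrite /side_mid !mulrS mulr0n !pairD addr0 /=; congr pair; ring.
Qed.

Definition midpoint m (l : lozenge) : point := ((weight m l).1 %/ 3, (weight m l).2 %/ 3)%Z.

Lemma midpoint_tri m s p v : is_sign s -> is_side v ->
  midpoint m [fset tri s p; neighbour s p v] = side_mid m s p v.
Proof.
move=> hs hv; rewrite /midpoint weight_tri //; case: side_mid => x y.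
rewrite !mulrS mulr0n !pairD addr0 /=.
by congr pair; lia.
Qed.

(** Described from its upward triangle, a lozenge has a doubled midpoint whose parities, up to the
    fixed shift by the center, reveal the direction v and then the base point. *)
Lemma midpoint_inj m l l' : is_lozenge l -> is_lozenge l' -> midpoint m l = midpoint m l' -> l = l'.
Proof.
have normal k : is_lozenge k -> exists p v, is_side v /\ k = [fset tri 1 p; neighbour 1 p v].
  move=> /lozenge_normal[s [p [v [hs hv ->]]]].
  case/orP: hs => /eqP ->; first by exists p, v.
  exists (p.1 - v.1, p.2 - v.2), v; split => //; rewrite fsetUC /neighbour opprK !mulN1r /=.
  congr [fset _; _]; congr tri; rewrite [LHS]surjective_pairing /=; congr pair; ring.
move=> /normal[p [v [hv ->]]] /normal[q [w [hw ->]]].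
rewrite !midpoint_tri // /side_mid !mul1r => -[].
case: p q => [a b] [c d] /=.
case/or3P: hv => /eqP -> /=; case/or3P: hw => /eqP -> /= e1 e2; try (exfalso; lia).
- by have [-> ->] : a = c /\ b = d by lia.
- by have [-> ->] : a = c /\ b = d by lia.
- by have [-> ->] : a = c /\ b = d by lia.
Qed.

(** * Tilings and their fields of side midpoints *)

Definition field_of m (T : tiling) (e : point) : bool := has (fun l => midpoint m l == e) T.

Definition tiling_of m (b : point -> bool) : tiling :=
  [fset l in lozenges_in (hexagon m m m) | b (midpoint m l)].

Lemma in_triangles_in H t : (t \in triangles_in H) = (t `<=` H) && is_unit_triangle t.
Proof. by rewrite in_fset [LHS]inE fpowersetE. Qed.

Lemma in_lozenges_in H l : (l \in lozenges_in H) = (l `<=` triangles_in H) && is_lozenge l.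
Proof. by rewrite in_fset [LHS]inE fpowersetE. Qed.

Lemma in_tiling_of m b l :
  (l \in tiling_of m b) = (l \in lozenges_in (hexagon m m m)) && b (midpoint m l).
Proof. by rewrite in_fset [LHS]inE. Qed.

Definition hexagon_symmetry m (f : point -> point) : Prop :=
  [/\ {morph f : p q / p + q}, forall p q, sqdist (f p) (f q) = sqdist p q
    & forall p, p \in hexagon m m m -> about (center m) f p \in hexagon m m m].

Lemma sqdist_eq0 (p q : point) : (sqdist p q == 0) = (p == q).
Proof.
case: p q => [a b] [c d]; rewrite xpair_eqE.
have -> : sqdist (a, b) (c, d) = (a - c) ^+ 2 + (a - c) * (b - d) + (b - d) ^+ 2 by [].
apply/eqP/andP => [|[/eqP -> /eqP ->]]; last by rewrite !subrr.
move: (a - c) (b - d) (subr_eq0 a c) (subr_eq0 b d) => u v <- <- e.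
have : 3 * u ^+ 2 + (2 * v + u) ^+ 2 = 4 * 0 by rewrite -e; ring.
have := sqr_ge0 (2 * v + u); have := sqr_ge0 u => u2 w2 h.
have /eqP : u ^+ 2 = 0 by lia.
by rewrite sqrf_eq0 => /eqP u0; move: e; rewrite u0 expr0n mul0r !add0r => /eqP; rewrite sqrf_eq0.
Qed.

Section Symmetry.
Variables (m : nat) (f : point -> point).
Hypothesis sf : hexagon_symmetry m f.
Let s := about (center m) f.

Lemma sqdist_about p q : sqdist (s p) (s q) = sqdist p q.
Proof.
case: sf => fD fS _; rewrite /s /about.
have E (x y z : point) : sqdist (x + y) (x + z) = sqdist y z.
  by rewrite /sqdist opprD addrACA subrr add0r.
rewrite E fS; have -> (x y : point) : sqdist (x - y) (q - y) = sqdist x q.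
  by rewrite ![_ - y]addrC E.
by [].
Qed.

Lemma about_inj : injective s.
Proof. by move=> p q e; apply/eqP; rewrite -sqdist_eq0 -sqdist_about e sqdist_eq0. Qed.

Lemma move_triangle_inj : injective (move_triangle s).
Proof.
move=> t u /fsetP e; apply/fsetP => p.
by have := e (s p); rewrite !(mem_imfset _ _ about_inj).
Qed.

Lemma move_lozenge_inj : injective (move_lozenge s).
Proof.
move=> t u /fsetP e; apply/fsetP => p.
by have := e (move_triangle s p); rewrite !(mem_imfset _ _ move_triangle_inj).
Qed.

Lemma move_unit_triangle t : is_unit_triangle t -> is_unit_triangle (move_triangle s t).
Proof.
case/andP => /eqP c3 /forallP d1; apply/andP; split.
  by rewrite card_imfset /= ?c3 //; exact: about_inj.
apply/forallP => x; apply/forallP => y; apply/implyP.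
rewrite -(inj_eq val_inj); have /imfsetP[p pt ->] := valP x; have /imfsetP[q qt ->] := valP y.
rewrite (inj_eq about_inj) sqdist_about => pq.
by have /forallP/(_ [` qt])/implyP/(_ pq) := d1 [` pt].
Qed.

Lemma move_is_lozenge l : is_lozenge l -> is_lozenge (move_lozenge s l).
Proof.
case/and3P => /eqP c2 /forallP ut /forallP meet; apply/and3P; split.
- by rewrite card_imfset /= ?c2 //; exact: move_triangle_inj.
- apply/forallP => x; have /imfsetP[t tl ->] := valP x.
  by apply: move_unit_triangle; apply: (ut [` tl]).
apply/forallP => x; apply/forallP => y; apply/implyP.
rewrite -(inj_eq val_inj); have /imfsetP[t tl ->] := valP x; have /imfsetP[u ul ->] := valP y.
rewrite (inj_eq move_triangle_inj) => tu.
rewrite /move_triangle -imfsetI; last by move=> p q _ _; apply: about_inj.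
rewrite card_imfset /=; last exact: about_inj.
by have /forallP/(_ [` ul])/implyP/(_ tu) := meet [` tl].
Qed.

Lemma move_lozenges_in l : l \in lozenges_in (hexagon m m m) ->
  move_lozenge s l \in lozenges_in (hexagon m m m).
Proof.
rewrite !in_lozenges_in => /andP[/fsubsetP lH hl].
rewrite move_is_lozenge // andbT; apply/fsubsetP => _ /imfsetP[t /lH ht ->].
move: ht; rewrite !in_triangles_in.
case/andP => /fsubsetP tH ut; rewrite move_unit_triangle // andbT.
by apply/fsubsetP => _ /imfsetP[p /tH pH ->]; case: sf => _ _; apply.
Qed.

Lemma morph_sum (I : eqType) (r : seq I) (F : I -> point) :
  f (\sum_(i <- r) F i) = \sum_(i <- r) f (F i).
Proof.
case: sf => fD _ _; apply: big_morph => //.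
by apply: (addrI (f 0)); rewrite -fD !addr0.
Qed.

Lemma weight_move l : weight m (move_lozenge s l) = f (weight m l).
Proof.
rewrite /weight big_imfset /=; last by move=> t u _ _; apply: move_triangle_inj.
rewrite morph_sum; apply: eq_bigr => t _.
rewrite big_imfset /=; last by move=> p q _ _; apply: about_inj.
by rewrite morph_sum; apply: eq_bigr => p _; rewrite /s /about addrC addKr.
Qed.

Lemma midpoint_move l : is_lozenge l -> midpoint m (move_lozenge s l) = f (midpoint m l).
Proof.
move=> hl; have w3 k : is_lozenge k -> weight m k = midpoint m k *+ 3.
  move=> /lozenge_normal[r [p [v [hr hv ->]]]].
  by rewrite weight_tri // midpoint_tri.
have := weight_move l; rewrite (w3 _ hl) w3 ?move_is_lozenge //.
case: sf => fD _ _; rewrite !mulrS !mulr0n !addr0 !fD.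
case: (midpoint m _) => a b; case: (f _) => c d; rewrite !pairD => -[e1 e2].
by congr pair; lia.
Qed.

Lemma field_of_move T e : invariant_tiling s T -> field_of m T e -> T `<=` lozenges_in (hexagon m m m) ->
  field_of m T (f e).
Proof.
move=> /eqP iT /hasP[l lT /eqP <-] /fsubsetP TH; apply/hasP; exists (move_lozenge s l).
  by rewrite -iT; apply: in_imfset.
by have := TH _ lT; rewrite in_lozenges_in => /andP[_ hl]; rewrite midpoint_move.
Qed.

Lemma tiling_of_invariant b : (forall e, b (f e) = b e) -> invariant_tiling s (tiling_of m b).
Proof.
move=> bf; rewrite /invariant_tiling eqEfcard; apply/andP; split.
  apply/fsubsetP => _ /imfsetP[l lT ->]; move: lT.
  rewrite !in_tiling_of => /andP[lH bl].
  rewrite move_lozenges_in //= midpoint_move ?bf //.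
  by move: lH; rewrite in_lozenges_in => /andP[].
by rewrite (card_imfset _ _ move_lozenge_inj).
Qed.

End Symmetry.

Lemma rotation120_symmetry m : hexagon_symmetry m (rot60 \o rot60).
Proof.
split=> [[a b] [c d]|[a b] [c d]|[a b]].
- by rewrite /rot60 /=; congr pair; rewrite /=; ring.
- by rewrite /rot60 /sqdist /= ; ring.
- by rewrite !in_hexagon /about /center /rot60 /=; lia.
Qed.

Lemma rotation180_symmetry m : hexagon_symmetry m (rot60 \o rot60 \o rot60).
Proof.
split=> [[a b] [c d]|[a b] [c d]|[a b]].
- by rewrite /rot60 /=; congr pair; rewrite /=; ring.
- by rewrite /rot60 /sqdist /= ; ring.
- by rewrite !in_hexagon /about /center /rot60 /=; lia.
Qed.

Lemma reflection_symmetry m : hexagon_symmetry m refl_e1.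
Proof.
split=> [[a b] [c d]|[a b] [c d]|[a b]].
- by rewrite /refl_e1 /=; congr pair; rewrite /=; ring.
- by rewrite /refl_e1 /sqdist /= ; ring.
- by rewrite !in_hexagon /about /center /refl_e1 /=; lia.
Qed.

Lemma one_sideP (c : point -> bool) :
  (c (1, 0)%R + c (0, 1)%R + c (1, 1)%R = 1)%N <->
  exists v, [/\ is_side v, c v & forall w, is_side w -> c w -> w = v].
Proof.
split=> [e|[v [hv cv u]]].
  have [c1|[c2|c3]] : c (1, 0) \/ c (0, 1) \/ c (1, 1) by move: e; do 3!case: (c _); auto.
  - exists (1, 0); split => // w /or3P[] /eqP -> // cw; exfalso; move: e; rewrite c1 cw; lia.
  - exists (0, 1); split => // w /or3P[] /eqP -> // cw; exfalso; move: e; rewrite c2 cw; lia.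
  - exists (1, 1); split => // w /or3P[] /eqP -> // cw; exfalso; move: e; rewrite c3 cw; lia.
have F w : is_side w -> w != v -> c w = false.
  by move=> hw; apply: contraNF => /(u _ hw) ->.
by case/or3P: hv cv F {u} => /eqP -> -> F; rewrite !F.
Qed.

Definition tiles_at m (b : point -> bool) s p : nat :=
  (b (side_mid m s p (1, 0)%R) + b (side_mid m s p (0, 1)%R) + b (side_mid m s p (1, 1)%R))%N.

Lemma tiling_exact m T s p : is_tiling (hexagon m m m) T -> is_sign s ->
  tri s p \in triangles_in (hexagon m m m) -> tiles_at m (field_of m T) s p = 1%N.
Proof.
case/andP => /fsubsetP TH /forallP cov hs ht.
have lT l : l \in T -> is_lozenge l by move=> /TH; rewrite in_lozenges_in => /andP[].
have /cardfs1P[l /fsetP el] := cov [` ht].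
have : l \in [fset l] by rewrite inE.
rewrite -el in_fset /= => /andP[/= lt tl].
have [v hv ev] := lozenge_neighbour (lT _ lt) hs tl.
apply/(one_sideP (fun v => field_of m T (side_mid m s p v))); exists v; split => //.
  by apply/hasP; exists l; rewrite // ev midpoint_tri.
move=> w hw /hasP[k kT /eqP]; rewrite -midpoint_tri // => /midpoint_inj.
move=> /(_ (lT _ kT) (lozenge_tri p hs hw)) ek.
have : k \in [fset l].
  by rewrite -el in_fset; apply/andP; split => //=; rewrite ek !inE eqxx.
rewrite inE => /eqP kl; move: (midpoint_tri m p hs hw) (midpoint_tri m p hs hv).
rewrite -ek -ev kl => -> [].
case/or3P: hv => /eqP -> /=; case/or3P: hw => /eqP -> //=;
  by case/orP: hs => /eqP ->; lia.
Qed.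

Lemma field_of_inner m T e : T `<=` lozenges_in (hexagon m m m) -> field_of m T e -> inner m e.
Proof.
move=> /fsubsetP TH /hasP[l /TH lH /eqP <-].
have := lH; rewrite in_lozenges_in => /andP[_ /lozenge_normal[s [p [v [hs hv el]]]]].
by move: lH; rewrite el lozenges_in_tri // midpoint_tri.
Qed.

Lemma field_ofK m T : T `<=` lozenges_in (hexagon m m m) -> tiling_of m (field_of m T) = T.
Proof.
move=> /fsubsetP TH; apply/fsetP => l; rewrite in_tiling_of.
apply/andP/idP => [[lH /hasP[k kT /eqP/midpoint_inj]]|lT].
  have := TH _ kT; move: lH; rewrite !in_lozenges_in => /andP[_ hl] /andP[_ hk].
  by move=> /(_ hk hl) <-.
by split; [apply: TH|apply/hasP; exists l].
Qed.

Lemma tiling_ofK m b s p v : is_sign s -> is_side v -> inner m (side_mid m s p v) ->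
  field_of m (tiling_of m b) (side_mid m s p v) = b (side_mid m s p v).
Proof.
move=> hs hv hi; apply/hasP/idP => [[l lT /eqP <-]|bv].
  by move: lT; rewrite in_tiling_of => /andP[].
exists [fset tri s p; neighbour s p v]; last by rewrite midpoint_tri.
by rewrite in_tiling_of lozenges_in_tri // hi midpoint_tri.
Qed.

Lemma tiling_of_tiling m (b : point -> bool) : (forall e, b e -> inner m e) ->
  (forall s p, is_sign s -> tri s p \in triangles_in (hexagon m m m) -> tiles_at m b s p = 1%N) ->
  is_tiling (hexagon m m m) (tiling_of m b).
Proof.
move=> bi b1; apply/andP; split.
  by apply/fsubsetP => l; rewrite in_tiling_of => /andP[].
apply/forallP => -[t tH] /=; have := tH; rewrite in_triangles_in => /andP[_].
move=> /unit_triangleP[s [p [hs et]]]; move: tH; rewrite {}et => tH.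
have /(one_sideP (fun v => b (side_mid m s p v)))[v [hv bv u]] := b1 _ _ hs tH.
apply/cardfs1P; exists [fset tri s p; neighbour s p v]; apply/fsetP => l.
rewrite in_fset in_fset1; apply/andP/eqP => /= [[lT tl]|->].
  move: lT; rewrite in_tiling_of in_lozenges_in => /andP[/andP[_ hl] bl].
  have [w hw el] := lozenge_neighbour hl hs tl.
  by rewrite el (u w) //; move: bl; rewrite el midpoint_tri.
split; last by rewrite !inE eqxx.
by rewrite in_tiling_of lozenges_in_tri // midpoint_tri // bv bi.
Qed.

(** * The fundamental sector *)

Definition symmetric_field (b : point -> bool) : Prop := forall x y : int,
  [/\ b (- x - y, x) = b (x, y), b (- x, - y) = b (x, y) & b (x + y, - y) = b (x, y)].

Lemma symmetric_swap b (x y : int) : symmetric_field b -> b (y, x) = b (x, y).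
Proof.
move=> sb; have E u v u' v' : u = u' -> v = v' -> b (u, v) = b (u', v') by move=> -> ->.
have [_ _ <-] := sb y x; have [<- _ _] := sb (y + x) (- x).
transitivity (b (- y, x + y)); first by apply: E; lia.
transitivity (b (x, - x - y)).
  by have [_ _ <-] := sb x (- x - y); apply: E; lia.
have [_ <- _] := sb x (- x - y); have [_ _ <-] := sb x y; have [<- _ _] := sb (x + y) (- y).
by apply: E; lia.
Qed.

Lemma symmetric_shift b (x y : int) : symmetric_field b -> b (y, - x - y) = b (x, y).
Proof.
move=> sb; have E u v u' v' : u = u' -> v = v' -> b (u, v) = b (u', v') by move=> -> ->.
by have [<- _ _] := sb y (- x - y); apply: E; lia.
Qed.

(* The doubled midpoints of the sides of the upward triangle at (x, y).       *)
Definition edge_a (b : point -> bool) (x y : nat) := b (x.*2.+1%:Z, y.*2%:Z).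
Definition edge_b (b : point -> bool) (x y : nat) := b (x.*2%:Z, y.*2.+1%:Z).
Definition edge_c (b : point -> bool) (x y : nat) := b (x.*2.+1%:Z, y.*2.+1%:Z).

(** The upward triangle at (x, y), then the downward one across its side c. For y = x each has a
    side beyond the wall. *)
Definition exact_chamber m b := forall x y : nat, (y <= x)%N ->
  ((x + y < m)%N -> (edge_a b x y + edge_b b x y + edge_c b x y = 1)%N) /\
  ((x + y.+1 < m)%N -> (edge_c b x y + edge_a b x y.+1 + edge_b b x.+1 y = 1)%N).

Definition exact_field m b := forall s p, is_sign s ->
  tri s p \in triangles_in (hexagon m m m) -> tiles_at m b s p = 1%N.

(** An upward triangle corresponds to x, y and -1 - x - y. Two of these are both nonnegative or both
    negative, so a permutation moves it into the sector or to the opposite of a downward triangle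
    there. *)
Lemma triangle_sym_ind (P : int -> int -> Prop) :
  (forall x y : int, P x y -> P y x) -> (forall x y : int, P y (- 1 - x - y) -> P x y) ->
  (forall x y : nat, (y <= x)%N -> P x y) ->
  (forall x y : nat, (y <= x)%N -> P (- 1 - x%:Z) (- 1 - y%:Z)) ->
  forall x y, P x y.
Proof.
move=> Ps Pr Pp Pn.
have pp (x y : int) : 0 <= x -> 0 <= y -> P x y.
  move=> x0 y0; rewrite -(gez0_abs x0) -(gez0_abs y0).
  by case: (leqP `|y|%N `|x|%N) => [/Pp //|/ltnW/Pp/Ps].
have nn (x y : int) : x < 0 -> y < 0 -> P x y.
  move=> x0 y0; have -> : x = - 1 - (absz (- 1 - x)%R)%:Z by lia.
  have -> : y = - 1 - (absz (- 1 - y)%R)%:Z by lia.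
  set j := absz (- 1 - y)%R; set i := absz (- 1 - x)%R.
  by case: (leqP j i) => [/Pn //|/ltnW/Pn/Ps].
have np (x y : int) : x < 0 -> 0 <= y -> P x y.
  move=> x0 y0; apply: (Pr); case: (lerP 0 (- 1 - x - y)) => z0; first exact: pp.
  by apply: Pr; apply: nn; lia.
move=> x y; case: (lerP 0 x) => hx; case: (lerP 0 y) => hy.
- exact: pp.
- by apply/Ps/np.
- exact: np.
- exact: nn.
Qed.

Lemma exact_field_chamber m b : exact_field m b -> exact_chamber m b.
Proof.
move=> eb x y yx; have E (u v u' v' : int) : u = u' -> v = v' -> b (u, v) = b (u', v').
  by move=> -> ->.
split=> hxy.
  rewrite -(eb 1 (x%:Z, y%:Z + m%:Z)) //; last first.
    by rewrite triangles_in_tri // !in_hexagon /=; lia.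
  rewrite /tiles_at /side_mid /edge_a /edge_b /edge_c /=.
  by congr (nat_of_bool _ + nat_of_bool _ + nat_of_bool _)%N; apply: E; lia.
rewrite -(eb (-1) (x%:Z + 1, y%:Z + 1 + m%:Z)) //; last first.
  by rewrite triangles_in_tri // !in_hexagon /=; lia.
rewrite /tiles_at /side_mid /edge_a /edge_b /edge_c /= -addnA addnC.
by congr (nat_of_bool _ + nat_of_bool _ + nat_of_bool _)%N; apply: E; lia.
Qed.

Lemma exact_chamber_field m b : symmetric_field b -> exact_chamber m b -> exact_field m b.
Proof.
move=> sb cb; have E (u v u' v' : int) : u = u' -> v = v' -> b (u, v) = b (u', v').
  by move=> -> ->.
pose up x y : nat := (b (2 * x + 1, 2 * y)%R + b (2 * x, 2 * y + 1)%R + b (2 * x + 1, 2 * y + 1)%R)%N.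
pose inside (x : int) := (- m%:Z <= x) && (x < m%:Z).
have main x y : inside x -> inside y -> inside (- 1 - x - y) -> up x y = 1%N.
  move: x y; apply: triangle_sym_ind.
  - move=> x y h hy hx hz; rewrite -[RHS](h hx hy); last by move: hz; rewrite /inside; lia.
    rewrite /up ![b (2 * y + _, _)]symmetric_swap // ![b (2 * y, _)]symmetric_swap //.
    by rewrite -!addnA [RHS]addnCA.
  - move=> x y h hx hy hz; rewrite -[RHS](h hy hz); last by move: hx; rewrite /inside; lia.
    rewrite /up -[b (2 * x + 1, 2 * y)](symmetric_shift _ _ sb) -[b (2 * x, 2 * y + 1)](symmetric_shift _ _ sb).
    rewrite -[b (2 * x + 1, 2 * y + 1)](symmetric_shift _ _ sb).
    by rewrite [LHS]addnC addnA; congr (nat_of_bool _ + nat_of_bool _ + nat_of_bool _)%N; apply: E; lia.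
  - move=> x y yx hx hy hz; have [h _] := cb x y yx; rewrite -[RHS]h; last by move: hz; rewrite /inside; lia.
    rewrite /up /edge_a /edge_b /edge_c.
    by congr (nat_of_bool _ + nat_of_bool _ + nat_of_bool _)%N; apply: E; lia.
  - move=> x y yx hx hy hz; have [_ h] := cb x y yx; rewrite -[RHS]h; last by move: hz; rewrite /inside; lia.
    rewrite /up /edge_a /edge_b /edge_c addnC addnA.
    have N u v : b (u, v) = b (- u, - v) by have [_ -> _] := sb u v.
    by rewrite !(N (2 * _ + 1)) !(N (2 * _));
    congr (nat_of_bool _ + nat_of_bool _ + nat_of_bool _)%N; apply: E; lia.
move=> s [x y] hs; rewrite triangles_in_tri // !in_hexagon /= => ht.
have N u v : b (u, v) = b (- u, - v) by have [_ -> _] := sb u v.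
case/orP: hs ht => /eqP -> ht.
  rewrite -(main x (y - m%:Z)); [|move: ht; rewrite /inside; lia..].
  rewrite /tiles_at /side_mid /up /=.
  by congr (nat_of_bool _ + nat_of_bool _ + nat_of_bool _)%N; apply: E; lia.
rewrite -(main (- x) (m%:Z - y)); [|move: ht; rewrite /inside; lia..].
rewrite /tiles_at /side_mid /up /= ![b (2 * x + _, _)]N.
by congr (nat_of_bool _ + nat_of_bool _ + nat_of_bool _)%N; apply: E; lia.
Qed.

Lemma pos_inj n (b : array n) d i j : b \in path_arrays n -> (d <= i)%N -> (d <= j)%N ->
  (i < n)%N -> (j < n)%N -> pos b i d = pos b j d -> i = j.
Proof.
move=> hb di dj hi hj e; case: (ltngtP i j) => // h.
  by have := pos_mono hb di h hj; rewrite e ltnn.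
by have := pos_mono hb dj h hi; rewrite e ltnn.
Qed.

Definition on_path n (b : array n) (x d : nat) : bool :=
  [exists i : 'I_n, (d <= i)%N && (pos b i d == x)].

(* A path reaches (x, d.+1) and goes on to line d by a step of kind c.        *)
Definition step_up n (b : array n) (c : bool) (x d : nat) : bool :=
  [exists i : 'I_n, [&& (d < i)%N, entry b i d == c & pos b i d.+1 == x]].

(** Odd U and even V is a horizontal side, marked when no path uses it. Odd V gives the lozenges
    crossed by the two kinds of steps, together with the forced ones on the wall U = V. Two even
    coordinates are not a midpoint. *)
Definition chamber_field n (b : array n) (U V : nat) : bool :=
  if odd U then
    if odd V then (U == V) || step_up b false U./2 V./2 else ~~ on_path b U./2 V./2
  else odd V && (0 < U)%N && step_up b true U./2.-1 V./2.

(* The symmetries of the hexagon permute the coordinates x, y, - x - y and    *)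
(* change all their signs; hence the point of the sector 0 <= y <= x          *)
(* equivalent to e is (fold_max e - fold_min e, fold_min e).                  *)
Definition fold_max (e : point) : nat := maxn (maxn `|e.1| `|e.2|) `|e.1 + e.2|.
Definition fold_min (e : point) : nat := minn (minn `|e.1| `|e.2|) `|e.1 + e.2|.

Lemma fold_swap x y : fold_max (y, x) = fold_max (x, y) /\ fold_min (y, x) = fold_min (x, y).
Proof. by rewrite /fold_max /fold_min /=; split; lia. Qed.

Lemma fold_opp x y : fold_max (- x, - y) = fold_max (x, y) /\ fold_min (- x, - y) = fold_min (x, y).
Proof. by rewrite /fold_max /fold_min /=; split; lia. Qed.

Lemma fold_shift x y : fold_max (y, - x - y) = fold_max (x, y) /\ fold_min (y, - x - y) = fold_min (x, y).
Proof. by rewrite /fold_max /fold_min /=; split; lia. Qed.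

Lemma fold_chamber (U V : nat) : (V <= U)%N ->
  fold_max (U%:Z, V%:Z) = (U + V)%N /\ fold_min (U%:Z, V%:Z) = V.
Proof. by move=> VU; rewrite /fold_max /fold_min /=; split; lia. Qed.

Definition path_field n (b : array n) (e : point) : bool :=
  (fold_max e < n.*2.*2)%N && chamber_field b (fold_max e - fold_min e) (fold_min e).

Lemma path_field_symmetric n (b : array n) : symmetric_field (path_field b).
Proof.
move=> x y; rewrite /path_field; have E e e' : fold_max e = fold_max e' -> fold_min e = fold_min e' ->
  (fold_max e < n.*2.*2)%N && chamber_field b (fold_max e - fold_min e) (fold_min e) =
  (fold_max e' < n.*2.*2)%N && chamber_field b (fold_max e' - fold_min e') (fold_min e').
  by move=> -> ->.
by split; apply: E; rewrite /fold_max /fold_min /=; lia.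
Qed.

Lemma path_fieldE n (b : array n) (U V : nat) : (V <= U)%N ->
  path_field b (U%:Z, V%:Z) = (U + V < n.*2.*2)%N && chamber_field b U V.
Proof. by move=> /fold_chamber[eM em]; rewrite /path_field eM em addnK. Qed.

Lemma symmetric_fold b (e : point) : symmetric_field b ->
  b e = b ((fold_max e - fold_min e)%N%:Z, (fold_min e)%:Z).
Proof.
move=> sb; case: e => x y.
pose Q (u v : int) := b (u, v) =
  b ((fold_max (u, v) - fold_min (u, v))%N%:Z, (fold_min (u, v))%:Z).
have QS u v : Q v u -> Q u v.
  by rewrite /Q; have [-> ->] := fold_swap u v; rewrite symmetric_swap.
have QN u v : Q (- u) (- v) -> Q u v.
  by rewrite /Q; have [-> ->] := fold_opp u v; have [_ -> _] := sb u v.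
have QC u v : Q v (- u - v) -> Q u v.
  by rewrite /Q; have [-> ->] := fold_shift u v; rewrite symmetric_shift.
have Qp (u v : int) : 0 <= u -> 0 <= v -> Q u v.
  have H (i j : nat) : (j <= i)%N -> Q i j.
    by move=> ij; rewrite /Q; have [-> ->] := fold_chamber ij; rewrite addnK.
  move=> u0 v0; rewrite -(gez0_abs u0) -(gez0_abs v0).
  by case: (leqP `|v|%N `|u|%N) => [/H //|/ltnW/H/QS].
have Qpn (u v : int) : 0 <= u -> v < 0 -> Q u v.
  move=> u0 v0; apply: (QC); case: (lerP 0 (u + v)) => h; first by apply/QN/Qp; lia.
  by apply/QC/Qp; lia.
rewrite -/(Q x y); case: (lerP 0 x) => hx; case: (lerP 0 y) => hy.
- exact: Qp.
- exact: Qpn.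
- by apply/QS/Qpn.
- by apply/QN/Qp; lia.
Qed.

Lemma path_field_a n (b : array n) x y : (y <= x)%N ->
  edge_a (path_field b) x y = (x + y < n.*2)%N && ~~ on_path b x y.
Proof.
move=> yx; rewrite /edge_a path_fieldE; last by lia.
by rewrite /chamber_field /= !odd_double /= uphalf_double doubleK; congr andb; lia.
Qed.

Lemma path_field_b n (b : array n) x y : (y <= x)%N ->
  edge_b (path_field b) x.+1 y = (x + y.+1 < n.*2)%N && step_up b true x y.
Proof.
move=> yx; rewrite /edge_b path_fieldE; last by lia.
by rewrite /chamber_field !odd_double /= odd_double /= uphalf_double doubleK; congr andb; lia.
Qed.

Lemma path_field_c n (b : array n) x y : (y <= x)%N ->
  edge_c (path_field b) x y = (x + y.+1 < n.*2)%N && ((x == y) || step_up b false x y).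
Proof.
move=> yx; rewrite /edge_c path_fieldE; last by lia.
rewrite /chamber_field /= !odd_double /= !uphalf_double; congr (_ && (_ || _)); lia.
Qed.

Lemma edge_diag b x : symmetric_field b -> edge_b b x x = edge_a b x x.
Proof. by move=> sb; rewrite /edge_a /edge_b symmetric_swap. Qed.

Lemma edge_subdiag b x : symmetric_field b -> edge_a b x x.+1 = edge_b b x.+1 x.
Proof. by move=> sb; rewrite /edge_a /edge_b symmetric_swap. Qed.

Lemma on_path_diag n (b : array n) x : (x < n)%N -> on_path b x x.
Proof. by move=> xn; apply/existsP; exists (Ordinal xn); rewrite /= leqnn pos_diag eqxx. Qed.

Lemma on_pathP n (b : array n) x d : b \in path_arrays n -> (d < x)%N ->
  on_path b x d = step_up b true x.-1 d || step_up b false x d :> bool.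
Proof.
move=> hb dx; apply/existsP/orP => [[i /andP[di /eqP e]]|[]/existsP[i /and3P[di /eqP ei /eqP e]]].
- have {}di : (d < i)%N.
    by move: di; rewrite leq_eqVlt => /orP[/eqP h|//]; move: e; rewrite -h pos_diag; lia.
  rewrite (pos_step b di) in e; case ei: (entry b i d) e => e; [left|right]; apply/existsP; exists i;
  by rewrite di ei /=; lia.
- by exists i; rewrite (ltnW di) (pos_step b di) e ei /=; lia.
- by exists i; rewrite (ltnW di) (pos_step b di) e ei addn0 /= eqxx.
Qed.

Lemma step_up_disjoint n (b : array n) x d : b \in path_arrays n -> (d < x)%N ->
  step_up b true x.-1 d -> step_up b false x d = false.
Proof.
move=> hb dx /existsP[i /and3P[di /eqP ei /eqP e]]; apply/existsP => -[j /and3P[dj /eqP ej /eqP e']].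
have ij : i = j :> nat.
  apply: (pos_inj hb (ltnW di) (ltnW dj) (ltn_ord i) (ltn_ord j)).
  by rewrite (pos_step b di) (pos_step b dj) e e' ei ej /=; lia.
by move: ei; rewrite ij ej.
Qed.

Lemma on_path_step n (b : array n) x d : b \in path_arrays n ->
  (on_path b x d.+1 = step_up b true x d (+) step_up b false x d :> bool) /\
  (step_up b true x d && step_up b false x d = false).
Proof.
move=> hb.
have dis : step_up b true x d -> step_up b false x d = false.
  move=> /existsP[i /and3P[di /eqP ei /eqP e]]; apply/existsP => -[j /and3P[dj /eqP ej /eqP e']].
  have ij : i = j :> nat by apply: (pos_inj hb di dj (ltn_ord i) (ltn_ord j)); rewrite e e'.
  by move: ei; rewrite ij ej.
split; last by case: (step_up b true x d) dis => // ->.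
have -> : on_path b x d.+1 = step_up b true x d || step_up b false x d.
  apply/existsP/orP => [[i /andP[di e]]|[]/existsP[i /and3P[di _ e]]]; try by exists i; rewrite di.
  by case ei: (entry b i d); [left|right]; apply/existsP; exists i; rewrite di ei e.
by case: (step_up b true x d) dis => // ->.
Qed.

Lemma step_up_subdiag n (b : array n) c x d : (x <= d)%N -> step_up b c x d = false.
Proof.
move=> xd; apply/existsP => -[i /and3P[di _ /eqP e]].
by have := leq_pos b i d.+1; lia.
Qed.

Lemma step_up_bound n (b : array n) c x d : step_up b c x d -> (x + d.+1 <= n.-1.*2)%N /\ (0 < n)%N.
Proof.
move=> /existsP[i /and3P[di _ /eqP <-]]; have := pos_leq b di; have := ltn_ord i.
by move: (pos b i d.+1) => p; split; lia.
Qed.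

(** If a path uses the horizontal side of a triangle, its step crosses exactly one other side;
    otherwise the horizontal side is the marked one. On the wall the side c is marked. *)
Lemma path_field_exact n (b : array n) : b \in path_arrays n ->
  exact_chamber n.*2 (path_field b).
Proof.
move=> hb x y yx; have sb := path_field_symmetric b; split=> hxy.
  case: (ltngtP y x) yx hxy => // [yx _ hxy|<- _ hxy]; last first.
    rewrite edge_diag // path_field_a // path_field_c // eqxx /= on_path_diag; last by lia.
    by rewrite /= andbF andbT; lia.
  case: x yx hxy => // x yx hxy; rewrite path_field_a ?(ltnW yx) //= path_field_b // path_field_c ?(ltnW yx) //.
  rewrite hxy (on_pathP hb yx) /=; have := step_up_disjoint hb yx => /=.
  have -> : (x + y.+1 < n.*2)%N by lia.
  have -> : (x.+1 == y) = false by lia.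
  case: (boolP (step_up b true x y)) => [_ /(_ isT) ->|_ _]; first by case: (x.+1 + _ < _)%N.
  case: (boolP (step_up b false x.+1 y)) => [/step_up_bound|_]; last by case: (x.+1 + _ < _)%N.
  by case=> h n0; have -> : (x.+1 + y.+1 < n.*2)%N by lia.
case: (ltngtP y x) yx hxy => // [yx _ hxy|<- _ hxy]; last first.
  rewrite edge_subdiag // path_field_b // path_field_c // eqxx /= step_up_subdiag //.
  by rewrite andbF andbT; lia.
rewrite path_field_a // path_field_c ?(ltnW yx) // path_field_b ?(ltnW yx) //.
rewrite hxy /=; have -> : (x == y) = false by lia.
have [-> ] := on_path_step x y hb; by do 2!case: step_up.
Qed.

(** * From symmetric fields to paths *)

Definition follows n (B : nat -> nat -> bool) (b : array n) : Prop :=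
  forall i k, (k < i)%N -> (i < n)%N -> entry b i k = B (pos b i k.+1).+1 k.

(** The abscissa of path i after j steps, computed from B alone so that the array can be defined
    without circularity. *)
Fixpoint trace (B : nat -> nat -> bool) (i j : nat) : nat :=
  if j is j'.+1 then (trace B i j' + B (trace B i j').+1 (i - j)%N)%N else i.

Lemma follows_exists n (B : nat -> nat -> bool) :
  exists2 b : array n, triangular b & follows B b.
Proof.
pose b : array n := [ffun i : 'I_n => [ffun k : 'I_n =>
  (k < i)%N && B (trace B i (i - k.+1)).+1 k]].
have eb i k : (k < i)%N -> (i < n)%N -> entry b i k = B (trace B i (i - k.+1)).+1 k.
  move=> ki hi; have kn := ltn_trans ki hi.
  by rewrite (entryE b (Ordinal hi) (Ordinal kn)) !ffunE /= ki.
exists b.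
  by apply/forallP => i; apply/forallP => k; apply/implyP => ik; rewrite !ffunE ltnNge ik.
have pb i j : (j <= i)%N -> (i < n)%N -> pos b i (i - j) = trace B i j.
  elim: j => [|j IH] ji hi; first by rewrite subn0 pos_diag.
  have ij : (i - j.+1 < i)%N by lia.
  have e1 : (i - j.+1).+1 = (i - j)%N by lia.
  have e2 : (i - (i - j))%N = j by lia.
  by rewrite (pos_step b ij) eb // e1 (IH (ltnW ji) hi) e2.
move=> i k ki hi; rewrite eb // -pb //; last by lia.
by congr (B (pos b i _).+1 k); lia.
Qed.

Lemma follows_unique n (B : nat -> nat -> bool) (b b' : array n) :
  triangular b -> triangular b' -> follows B b -> follows B b' -> b = b'.
Proof.
move=> tb tb' fb fb'.
have pp i j : (j <= i)%N -> (i < n)%N -> pos b i (i - j) = pos b' i (i - j).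
  elim: j => [|j IH] ji hi; first by rewrite subn0 !pos_diag.
  have ij : (i - j.+1 < i)%N by lia.
  have e1 : (i - j.+1).+1 = (i - j)%N by lia.
  by rewrite (pos_step b ij) (pos_step b' ij) fb // fb' // e1 (IH (ltnW ji) hi).
apply/ffunP => i; apply/ffunP => k; rewrite -!entryE.
case: (ltnP k i) => ki; last first.
  by apply/idP/idP => /entry_ltn h; [have := h tb | have := h tb']; rewrite ltnNge ki.
rewrite fb // fb' //; have := pp i (i - k.+1)%N; rewrite subKn //.
by move=> -> //; lia.
Qed.

Lemma follows_path_field n (b : array n) : b \in path_arrays n ->
  follows (edge_b (path_field b)) b.
Proof.
move=> hb i k ki hi; rewrite path_field_b; last by have := leq_pos b i k.+1; lia.
have -> : (pos b i k.+1 + k.+1 < n.*2)%N by have := pos_leq b ki; move: (pos _ _ _) => p; lia.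
apply/idP/existsP => [e|[j /and3P[kj /eqP ej /eqP e]]].
  by exists (Ordinal hi); rewrite /= ki e !eqxx.
by rewrite -(pos_inj hb kj ki (ltn_ord j) hi e) ej.
Qed.

Section FieldPaths.
Variables (n : nat) (F : point -> bool) (b : array n).
Hypotheses (sF : symmetric_field F) (xF : exact_chamber n.*2 F).
Hypothesis iF : forall e, F e -> inner n.*2 e.
Hypotheses (tb : triangular b) (fb : follows (edge_b F) b).

Let edge_c_bound x y : edge_c F x y -> (x + y.+1 < n.*2)%N.
Proof. by move=> /iF; rewrite /inner /=; lia. Qed.

(** On the wall the reflection exchanges the sides a and b of the triangle; exactness leaves only
    c. *)
Let edge_a_diag x : (x < n)%N -> edge_a F x x = false /\ edge_c F x x.
Proof.
move=> xn; have xx : (x + x < n.*2)%N by lia.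
have [/(_ xx) h _] := xF (leqnn x).
by move: h; rewrite edge_diag //; case: edge_a; case: edge_c.
Qed.

Let edge_b_subdiag x : (x < n)%N -> edge_b F x.+1 x = false.
Proof.
move=> xn; have xx : (x + x.+1 < n.*2)%N by lia.
have [_ /(_ xx) h] := xF (leqnn x).
by move: h; rewrite edge_subdiag //; case: edge_b; case: edge_c.
Qed.

(** An unmarked top of a downward triangle means that its lozenge uses side b or c; this lozenge
    also covers the upward triangle below, whose bottom is then unmarked. *)
Lemma edge_a_pos i d : (d <= i)%N -> (i < n)%N -> edge_a F (pos b i d) d = false.
Proof.
move=> di hi; rewrite -(subKn di); have := leq_subr d i; move: (i - d)%N => {d di} j.
elim: j => [|j IH] ji; first by rewrite subn0 pos_diag; have [] := edge_a_diag hi.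
have {IH} := IH (ltnW ji); set d := (i - j.+1)%N; have di : (d < i)%N by rewrite /d; lia.
have -> : (i - j)%N = d.+1 by rewrite /d; lia.
rewrite (pos_step b di) fb //; have := leq_pos b i d.+1; have := pos_leq b di.
move: (pos b i d.+1) => x px ix a0.
have xd : (d <= x)%N by lia.
have xd' : (x + d.+1 < n.*2)%N by lia.
have x1d : (x.+1 + d < n.*2)%N by lia.
have x0d : (x + d < n.*2)%N by lia.
have [/(_ x0d) + /(_ xd')] := xF xd.
have [/(_ x1d) + _] := xF (leqW xd); rewrite a0.
case: (edge_b F x.+1 d); rewrite ?addn1 ?addn0; first by case: (edge_a F x.+1 d); case: edge_c.
by move=> _; case: (edge_c F x d) => //; case: (edge_a F x d); case: edge_b.
Qed.

(** Paths could meet only from abscissas x and x + 1 by opposite steps, and the upward triangle at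
    (x + 1, d) would then have two marked sides. *)
Lemma follows_ordered i d : (d <= i)%N -> (i.+1 < n)%N -> (pos b i d < pos b i.+1 d)%N.
Proof.
move=> di hi; rewrite -(subKn di); have := leq_subr d i; move: (i - d)%N => {d di} j.
elim: j => [|j IH] ji; first by rewrite subn0 pos_diag leq_pos.
have {IH} := IH (ltnW ji); set d := (i - j.+1)%N; have di : (d < i)%N by rewrite /d; lia.
have -> : (i - j)%N = d.+1 by rewrite /d; lia.
have di1 : (d < i.+1)%N by apply: ltnW.
rewrite (pos_step b di) (pos_step b di1) !fb //; last exact: ltnW.
have := leq_pos b i d.+1; have := pos_leq b di; have := pos_leq b di1.
have := edge_a_pos di1 hi.
move: (pos b i d.+1) (pos b i.+1 d.+1) => x y ay py px ix.
rewrite leq_eqVlt => /orP[/eqP exy|]; last by case: edge_b; case: edge_b; lia.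
rewrite -exy in py ay *; have xd : (d <= x.+1)%N by lia.
have x1d : (x.+1 + d < n.*2)%N by lia.
have y1d : (x.+1 + d.+1 < n.*2)%N by lia.
have [/(_ x1d) h1 /(_ y1d) h2] := xF xd.
by move: h1 h2; rewrite ay; case: (edge_b F x.+1 d); case: (edge_b F x.+2 d);
  case: edge_c; case: edge_a => //=; lia.
Qed.

Lemma follows_path_array : b \in path_arrays n.
Proof.
rewrite inE tb; apply/forallP => d; apply/implyP => _; apply/forallP => i.
by apply/implyP => /andP[di hi]; apply: follows_ordered.
Qed.

(** The lozenge above an unmarked horizontal side leads to another unmarked one on the next line.
    Since x - d decreases, this climb ends on the wall, where a path begins. *)
Lemma edge_a_on_path x d : (d <= x)%N -> (x + d < n.*2)%N -> edge_a F x d = false -> on_path b x d.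
Proof.
have [j] := ubnP (x - d); elim: j x d => // j IH x d xj.
rewrite leq_eqVlt => /orP[/eqP <- h _|dx xdn a0]; first by apply: on_path_diag; lia.
have [/(_ xdn) up _] := xF (ltnW dx); move: up; rewrite a0 add0n.
have IH' y : (d < y)%N -> (y <= x)%N -> (y + d.+1 < n.*2)%N -> edge_a F y d.+1 = false ->
    exists i : 'I_n, (d < i)%N /\ pos b i d = (y + edge_b F y.+1 d)%N.
  move=> dy yx yn ay; have yj : (y - d.+1 < j)%N by lia.
  have /existsP[i /andP[di /eqP e]] := IH y d.+1 yj dy yn ay.
  by exists i; split => //; rewrite (pos_step b di) e fb // e.
case cx: (edge_c F x d).
  (* A marked side lies strictly inside the hexagon, so exactness also applies to the triangle
     beyond it. *)
  move=> _; have xn := edge_c_bound cx.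
  have [_ /(_ xn)] := xF (ltnW dx); rewrite cx => down.
  have [|i [di e]] := IH' x dx (leqnn x) xn; first by move: down; case: edge_a.
  apply/existsP; exists i; rewrite (ltnW di) e.
  by move: down; case: (edge_b F x.+1 d) => /=; lia.
case: x xj dx xdn a0 {cx} IH' => // x xj dx xdn a0 IH'; rewrite addn0 => bx.
have {}bx : edge_b F x.+1 d by move: bx; case: edge_b.
have xn : (x + d.+1 < n.*2)%N by lia.
have [_ /(_ xn)] := xF (dx : (d <= x)%N); rewrite bx => down.
move: dx; rewrite ltnS leq_eqVlt => /orP[/eqP dx|dx].
  by move: bx; rewrite dx edge_b_subdiag //; lia.
have [|i [di e]] := IH' x dx (leqnSn x) xn; first by move: down; case: edge_a; case: edge_c.
by apply/existsP; exists i; rewrite (ltnW di) e bx addn1 /= eqxx.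
Qed.

Lemma edge_a_path x y : (y <= x)%N -> (x + y < n.*2)%N ->
  edge_a F x y = edge_a (path_field b) x y.
Proof.
move=> yx xyn; rewrite path_field_a // xyn /=; apply/idP/negP => [ax /existsP[i /andP[yi /eqP e]]|].
  by move: ax; rewrite -e edge_a_pos.
by apply: contra_notT => /negbTE; apply: edge_a_on_path.
Qed.

Lemma edge_b_path x y : (y <= x)%N -> (x + y.+1 < n.*2)%N ->
  edge_b F x.+1 y = edge_b (path_field b) x.+1 y.
Proof.
move=> yx xyn; rewrite path_field_b // xyn /=; apply/idP/existsP => [bx|[i /and3P[yi /eqP ei /eqP e]]].
  have [_ /(_ xyn)] := xF yx; rewrite bx => down.
  move: yx; rewrite leq_eqVlt => /orP[/eqP yx|yx].
    by move: bx; rewrite yx edge_b_subdiag //; lia.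
  have /existsP[i /andP[yi /eqP e]] : on_path b x y.+1.
    by apply: edge_a_on_path => //; move: down; case: edge_a; case: edge_c.
  by exists i; rewrite yi fb // e bx !eqxx.
by rewrite -e -fb // ei.
Qed.

Lemma edge_c_path x y : (y <= x)%N -> (x + y < n.*2)%N ->
  edge_c F x y = edge_c (path_field b) x y.
Proof.
move=> yx xyn; have [/(_ xyn) h1 _] := xF yx.
have [/(_ xyn) h2 _] := path_field_exact follows_path_array yx.
have ea := edge_a_path yx xyn.
have eb : edge_b F x y = edge_b (path_field b) x y.
  case: (ltngtP y x) yx xyn => // [yx _|<- _] xyn; last first.
    by rewrite !edge_diag ?edge_a_path //; exact: path_field_symmetric.
  by case: x yx xyn {h1 h2 ea} => // x yx xyn; apply: edge_b_path; lia.
by move: h1 h2; rewrite ea eb; case: edge_c; case: edge_c => //; lia.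
Qed.

Lemma path_field_chamber (U V : nat) : (V <= U)%N -> (U + V < n.*2.*2)%N ->
  odd U || odd V -> F (U%:Z, V%:Z) = path_field b (U%:Z, V%:Z).
Proof.
move: (odd_double_half U) (odd_double_half V).
case: (odd U); case: (odd V); move: U./2 V./2 => x y <- <- // VU UV _.
- by apply: edge_c_path; lia.
- by apply: edge_a_path; lia.
- by case: x VU UV => [|x] VU UV; [lia | apply: edge_b_path; lia].
Qed.

End FieldPaths.

(** * The bijection and the count *)

Definition symmetric_tilings m : {fset tiling} :=
  [fset T in tilings m m m
       | [&& invariant_tiling (rotation120 m) T,
             invariant_tiling (rotation180 m) T &
             invariant_tiling (reflection m) T]].

Lemma in_symmetric_tilings m T : (T \in symmetric_tilings m) =
  [&& is_tiling (hexagon m m m) T, invariant_tiling (rotation120 m) T,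
      invariant_tiling (rotation180 m) T & invariant_tiling (reflection m) T].
Proof.
rewrite in_fset [LHS]inE in_fset [X in X && _]inE fpowersetE /is_tiling.
by case: (T `<=` _).
Qed.

Lemma rotation120E (x y : int) : (rot60 \o rot60) (x, y) = (- x - y, x).
Proof. by rewrite /rot60 /=; congr pair; ring. Qed.

Lemma rotation180E (x y : int) : (rot60 \o rot60 \o rot60) (x, y) = (- x, - y).
Proof. by rewrite /rot60 /=; congr pair; ring. Qed.

Lemma field_of_symmetric m T : T \in symmetric_tilings m -> symmetric_field (field_of m T).
Proof.
rewrite in_symmetric_tilings => /and4P[/andP[TH _] i120 i180 ir] x y.
have E (u v u' v' : int) : u = u' -> v = v' -> (u, v) = (u', v') by move=> -> ->.
have rot u v : field_of m T (u, v) -> field_of m T (- u - v, u).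
  by move=> h; rewrite -rotation120E; apply: (field_of_move (rotation120_symmetry m)).
have opp u v : field_of m T (u, v) -> field_of m T (- u, - v).
  by move=> h; rewrite -rotation180E; apply: (field_of_move (rotation180_symmetry m)).
have ref u v : field_of m T (u, v) -> field_of m T (u + v, - v).
  by move=> h; apply: (field_of_move (reflection_symmetry m) ir h TH).
split; apply/idP/idP; auto.
- by move/rot/rot; congr (is_true (field_of _ _ _)); apply: E; lia.
- by move/opp; congr (is_true (field_of _ _ _)); apply: E; lia.
- by move/ref; congr (is_true (field_of _ _ _)); apply: E; lia.
Qed.

Lemma fold_max_inner m e : inner m e = (fold_max e < m.*2)%N.
Proof. by rewrite /inner /fold_max; case: e => x y /=; lia. Qed.

Lemma fold_odd e : odd `|e.1|%N || odd `|e.2|%N ->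
  odd (fold_max e - fold_min e) || odd (fold_min e).
Proof. by rewrite /fold_max /fold_min; case: e => x y /=; lia. Qed.

Lemma side_mid_odd m s p v : is_sign s -> is_side v ->
  odd `|(side_mid m s p v).1|%N || odd `|(side_mid m s p v).2|%N.
Proof.
by case/orP => /eqP ->; case/or3P => /eqP -> /=; lia.
Qed.

Lemma symmetric_tiling_path n T : T \in symmetric_tilings n.*2 ->
  exists2 b : array n, b \in path_arrays n & T = tiling_of n.*2 (path_field b).
Proof.
move=> sT; have := sT; rewrite in_symmetric_tilings => /and4P[tT _ _ _].
have /andP[TH _] := tT.
pose F := field_of n.*2 T; have sF : symmetric_field F by apply: field_of_symmetric.
have xF : exact_chamber n.*2 F.
  by apply: exact_field_chamber => s p hs ht; apply: tiling_exact.
have iF e : F e -> inner n.*2 e by apply: field_of_inner.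
have [b tb fb] := follows_exists n (edge_b F).
exists b; first by apply: follows_path_array fb.
rewrite -{1}(field_ofK TH); apply/fsetP => l; rewrite !in_tiling_of.
case lH: (l \in _) => //=; have := lH; rewrite in_lozenges_in => /andP[_ /lozenge_normal].
case=> s [p [v [hs hv el]]]; move: lH; rewrite el lozenges_in_tri // midpoint_tri //.
rewrite fold_max_inner => lt; rewrite -/(F _) (symmetric_fold _ sF).
rewrite [RHS](symmetric_fold _ (path_field_symmetric b)).
have := fold_odd (side_mid_odd n.*2 p hs hv); move: (side_mid _ _ _ _) lt => e lt od.
apply: (path_field_chamber sF xF iF tb fb) => //.
  by rewrite /fold_max /fold_min; case: (e) => x y /=; lia.
by rewrite subnK //; rewrite /fold_max /fold_min; case: (e) => x y /=; lia.
Qed.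

Lemma path_tiling_symmetric n (b : array n) : b \in path_arrays n ->
  tiling_of n.*2 (path_field b) \in symmetric_tilings n.*2.
Proof.
move=> hb; have sb := path_field_symmetric b.
rewrite in_symmetric_tilings; apply/and4P; split.
- apply: tiling_of_tiling => [e|]; first by rewrite fold_max_inner => /andP[].
  by apply: (exact_chamber_field sb); apply: path_field_exact.
- apply: (tiling_of_invariant (rotation120_symmetry _)) => -[x y].
  by rewrite rotation120E; have [-> _ _] := sb x y.
- apply: (tiling_of_invariant (rotation180_symmetry _)) => -[x y].
  by rewrite rotation180E; have [_ -> _] := sb x y.
- apply: (tiling_of_invariant (reflection_symmetry _)) => -[x y].
  by rewrite /refl_e1 /=; have [_ _ ->] := sb x y.
Qed.

(** A path array follows the sides b of its own field, and those it consults are inside the hexagon,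
    hence can be read off from the tiling. *)
Lemma path_tiling_inj n : {in path_arrays n &, injective (fun b => tiling_of n.*2 (path_field b))}.
Proof.
move=> b b' hb hb' e; apply: (follows_unique (B := edge_b (path_field b))).
- by move: hb; rewrite inE => /andP[].
- by move: hb'; rewrite inE => /andP[].
- exact: follows_path_field.
move=> i k ki hi; rewrite (follows_path_field hb') //.
have := pos_leq b' ki; have := leq_pos b' i k.+1; move: (pos b' i k.+1) => x ix xk.
pose p : point := (x.+1%:Z, k%:Z + n.*2%:Z).
have E : side_mid n.*2 1 p (0, 1) = (x.+1.*2%:Z, k.*2.+1%:Z).
  by rewrite /side_mid /=; congr pair; lia.
have hi' : inner n.*2 (side_mid n.*2 1 p (0, 1)) by rewrite E /inner /=; lia.
by rewrite /edge_b -E -(@tiling_ofK _ _ 1 p (0, 1)) // -e tiling_ofK.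
Qed.

Lemma TSSC_path_arrays n : TSSC (2 * n) = #|path_arrays n|.
Proof.
rewrite mul2n -[TSSC _]/(#|` symmetric_tilings n.*2|).
have -> : symmetric_tilings n.*2 =
    [fset tiling_of n.*2 (path_field b) | b in path_arrays n].
  apply/fsetP => T; apply/idP/imfsetP => /= [/symmetric_tiling_path[b hb ->]|[b hb ->]].
    by exists b.
  exact: path_tiling_symmetric.
rewrite card_in_imfset /=; first by rewrite cardE.
exact: path_tiling_inj.
Qed.

Theorem corollary5p3 (n : nat) (hn : (1 <= n)%N) :
  (TSSC (2 * n))%:R =
    \prod_(0 <= i < n) ((3 * i + 1)`!%:R / (n + i)`!%:R) :> rat.
Proof. by rewrite TSSC_path_arrays card_path_arraysE. Qed.
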